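(* Let $\mathfrak g$ be a finite-dimensional real semi-simple Lie algebra and let $\mathfrak h\le\mathfrak g$ be any semi-simple subalgebra. Then every Cartan involution $\sigma':\mathfrak h\to\mathfrak h$ is the restriction to $\mathfrak h$ of some Cartan involution $\sigma:\mathfrak g\to\mathfrak g$.
   Context: A Cartan involution of a real semi-simple Lie algebra $\mathfrak g$ with Killing form $B_{\mathfrak g}$ is an involutive Lie algebra automorphism $\theta$ of $\mathfrak g$ such that the bilinear form $(X,Y)\mapsto -B_{\mathfrak g}(\theta X,Y)$ is positive definite. *)

(* Defs.v *)
From HB Require Import structures.
From mathcomp Require Import all_boot all_order all_algebra.
From mathcomp Require Export reals.

Set Implicit Arguments.
Unset Strict Implicit.
Unset Printing Implicit Defensive.

Import Order.TTheory GRing.Theory Num.Theory.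
Local Open Scope ring_scope.

HB.mixin Record Vector_isLie (K : fieldType) L of Vector K L := {
  lie : L -> L -> L;
  lie_linearl : forall y : L, linear (lie^~ y);
  lie_linearr : forall x : L, linear (lie x);
  liexx : forall x : L, lie x x = 0;
  lie_jacobi : forall x y z : L,
    lie x (lie y z) + lie y (lie z x) + lie z (lie x y) = 0
}.

#[short(type="lieAlgType")]
HB.structure Definition LieAlgebra (K : fieldType) :=
  { L of Vector K L & Vector_isLie K L }.

Section LieTheory.
Variables (K : fieldType) (L : lieAlgType K).
Implicit Types (x y : L) (U V W I : {vspace L}).

HB.instance Definition _ x := GRing.isSemilinear.Build K L L _ (lie x)
  (GRing.semilinear_linear (lie_linearr x)).

Definition ad x : 'End(L) := linfun (lie x).

Lemma adE x y : ad x y = lie x y. Proof. by rewrite lfunE. Qed.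

Lemma lie0l y : lie 0 y = 0.
Proof.
by have /= := lie_linearl y (-1) 0 0; rewrite scaler0 addr0 scaleN1r addNr.
Qed.

Lemma lie_suml n (c : 'I_n -> L) y :
  lie (\sum_i c i) y = \sum_i lie (c i) y.
Proof.
apply: (big_morph (lie^~ y)) => [u v|].
  by have /= := lie_linearl y 1 u v; rewrite !scale1r.
exact: lie0l.
Qed.

Lemma lieZl a x y : lie (a *: x) y = a *: lie x y.
Proof.
by have /= := lie_linearl y a x 0; rewrite !addr0 lie0l addr0.
Qed.

(* The span of all brackets [u, v] with u in U and v in V (see [lievP]). *)
Definition liev U V : {vspace L} :=
  <<[seq lie u v | u <- vbasis U, v <- vbasis V]>>%VS.

Lemma memv_lie U V : {in U & V, forall u v, lie u v \in liev U V}.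
Proof.
move=> u v /coord_vbasis-> /coord_vbasis->.
rewrite lie_suml; apply: memv_suml => i _.
rewrite linear_sum; apply: memv_suml => j _ /=.
rewrite lieZl linearZ !memvZ // memv_span //.
by apply/allpairsP; exists ((vbasis U)`_i, (vbasis V)`_j); rewrite !memt_nth.
Qed.

Lemma lievP U V W :
  reflect {in U & V, forall u v, lie u v \in W} (liev U V <= W)%VS.
Proof.
apply: (iffP idP) => [sUVW u v Uu Vv | sUVW].
  by rewrite (subvP sUVW) ?memv_lie.
apply/span_subvP=> _ /allpairsP[[u v] /= [Uu Vv ->]].
by rewrite sUVW ?vbasis_mem.
Qed.

Definition lie_ideal I : Prop :=
  forall x y, y \in I -> lie x y \in I.

Definition derived_series (n : nat) I : {vspace L} :=
  iter n (fun J => liev J J) I.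

Definition solvable_ideal I : Prop :=
  lie_ideal I /\ exists n, derived_series n I = 0%VS.

Definition semisimple : Prop :=
  forall I, solvable_ideal I -> I = 0%VS.

End LieTheory.

Arguments semisimple {K} L.

Section Trace.
Variables (K : fieldType) (V : vectType K).

Definition lftrace (f : 'End(V)) : K :=
  \tr (passmx.mxof (vbasis {:V}) (vbasis {:V}) f).

Lemma lftrace_basis (e : (\dim {:V}).-tuple V) (f : 'End(V)) :
  basis_of {:V} e -> lftrace f = \tr (passmx.mxof e e f).
Proof.
move=> eB; have bB := vbasisP {:V}.
rewrite /lftrace -[f in LHS]comp_lfun1l -[(\1 \o f)%VF]comp_lfun1r.
rewrite (passmx.mxof_comp _ _ eB) (passmx.mxof_comp _ _ eB).
rewrite mulmxA mxtrace_mulC !mulmxA -passmx.mxof_comp //.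
by rewrite comp_lfun1l passmx.mxof1 ?mul1mx ?(basis_free eB).
Qed.

Lemma lftraceC (f g : 'End(V)) : lftrace (f \o g)%VF = lftrace (g \o f)%VF.
Proof.
by rewrite /lftrace !(passmx.mxof_comp _ _ (vbasisP _)) mxtrace_mulC.
Qed.

End Trace.

Definition killing (K : fieldType) (L : lieAlgType K) (x y : L) : K :=
  lftrace (ad x \o ad y)%VF.

Record lieSubalg (K : fieldType) (L : lieAlgType K) := LieSubalg {
  lieSub_vspace :> {vspace L};
  lieSub_closed : {in lieSub_vspace &, forall x y, lie x y \in lieSub_vspace}
}.

Section SubLie.
Variables (K : fieldType) (L : lieAlgType K) (H : lieSubalg L).

Definition subvs_lie (x y : subvs_of H) : subvs_of H :=
  Subvs (lieSub_closed (subvsP x) (subvsP y)).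

Fact subvs_lie_linearl y : linear (subvs_lie^~ y).
Proof. by move=> a u v; apply/val_inj/lie_linearl. Qed.
Fact subvs_lie_linearr x : linear (subvs_lie x).
Proof. by move=> a u v; apply/val_inj/lie_linearr. Qed.
Fact subvs_liexx x : subvs_lie x x = 0.
Proof. exact/val_inj/liexx. Qed.
Fact subvs_lie_jacobi x y z :
  subvs_lie x (subvs_lie y z) + subvs_lie y (subvs_lie z x)
    + subvs_lie z (subvs_lie x y) = 0.
Proof. exact/val_inj/lie_jacobi. Qed.

HB.instance Definition _ := Vector_isLie.Build K (subvs_of H)
  subvs_lie_linearl subvs_lie_linearr subvs_liexx subvs_lie_jacobi.

Lemma vsval_lie (x y : subvs_of H) : vsval (lie x y) = lie (vsval x) (vsval y).
Proof. by []. Qed.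

End SubLie.

Section Cartan.
Variables (R : realType) (L : lieAlgType R).

Definition lie_morphism (theta : 'End(L)) : Prop :=
  forall x y : L, theta (lie x y) = lie (theta x) (theta y).

(* Bijectivity of theta follows from involutivity.  The form is automatically
   symmetric, because automorphisms preserve the Killing form (see
   [cartan_form_sym]), so that positive definiteness is only asserted on the
   diagonal. *)
Definition cartan_involution (theta : 'End(L)) : Prop :=
  [/\ involutive theta, lie_morphism theta &
      forall x : L, x != 0 -> 0 < - killing (theta x) x].

End Cartan.

Lemma killingC (K : fieldType) (L : lieAlgType K) (x y : L) :
  killing x y = killing y x.
Proof. exact: lftraceC. Qed.

Lemma cartan_form_sym (R : realType) (L : lieAlgType R) (theta : 'End(L))
    (x y : L) : cartan_involution theta ->
  - killing (theta x) y = - killing (theta y) x.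
Proof.
move=> [tK tM _]; congr (- _); rewrite (killingC (theta y)) /killing.
have adT z : ad (theta z) = (theta \o ad z \o theta)%VF.
  by apply/lfunP=> u; rewrite !comp_lfunE !adE tM tK.
by rewrite !adT -!comp_lfunA lftraceC -!comp_lfunA.
Qed.

(* Main.v *)
From HB Require Import structures.
From mathcomp Require Import all_boot all_order all_algebra falgebra.
From mathcomp Require Import complex ring lra.
From mathcomp Require Import boolp classical_sets reals topology normedtype derive.
Require Import Defs.
Set Implicit Arguments. Unset Strict Implicit. Unset Printing Implicit Defensive.
Import Order.TTheory GRing.Theory Num.Theory.
Local Open Scope ring_scope.

(** The involution on g is found as a symmetry of a shortest vector.

    In coordinates, g is R^n with a bracket W, and h is R^m with a basis that is
    orthonormal for the scalar product -K_h(sigma' x, y); in such a basis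
    (ad w)^T = - ad (s w), where s is the matrix of sigma'.  The bracket W of g
    together with the adjoint action R of h on g is a vector t0 = (W, R) of a
    Euclidean space of tensors, on which GL_n acts by change of basis of R^n.
    Let p be a vector of least norm in the closure of the orbit of t0 under the
    matrices a with det a = +-1.

    The point p lies in the orbit of t0 under GL_n.  Indeed the equations that
    express that W is a Lie bracket, that R is a representation of h and that h
    acts by derivations are closed conditions, and so is the value of the
    determinant of the Killing form; hence p is again a semisimple Lie algebra
    with an action of h.  Such pairs are rigid ([rigidity]): the linearised
    equations at p have only the infinitesimal changes of basis as solutions
    ([d_exact]), because H^2(g, g) = 0 and H^1(h, V) = 0
    ([whitehead2_adjoint], [whitehead1]), and a quantitative Newton step
    ([improvement]) turns this into conjugacy of all nearby pairs.  Orbit points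
    close to p are therefore conjugate to p ([minimal_vector]).

    Minimality makes p critical: <S p, p> = c tr S for every matrix S
    ([critical_trace]).  If a pair (S, D) of gl_n x gl_m kills p and
    <[S, S^T] p + [D, D^T] p, p> = 0, then (S^T, D^T) kills p as well
    ([act_transpose_eq0]).  The pairs (R(w), ad w) kill p, which gives
    R(w)^T = - R(s w) ([rep_tr]).  It follows that the bracket of p is critical
    by itself, so its derivations, which are all inner, are stable under
    transposition: W(z)^T = - W(theta z) for some matrix theta ([ad_tr]).  This
    theta is an involutive automorphism, -K(theta z, z) = tr (W(z)^T W(z)) is
    positive definite, and theta restricts to s on h ([cartan_of_critical]).
    Transporting theta from p back to t0 gives sigma.

    The vanishing theorems and the inner derivations rest on the nondegeneracy of
    the Killing form of a semisimple algebra, which is deduced from Engel's theorem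
    ([engel]) and Cartan's criterion ([cartan_criterion]), and on averaging with
    the Casimir element. *)

(** * Linear maps given by plain functions *)

Section LinearCombinators.
Variable F : fieldType.

(** A name for [linear] that simplification keeps folded, for the tactic [lin] below
    to match. *)
Definition islin (U V : lmodType F) (f : U -> V) := linear f.

Variables U V Z : lmodType F.

Lemma islin_id : islin (fun x : U => x). Proof. by []. Qed.
Lemma islin_cst0 : islin (fun x : U => 0 : V).
Proof. by move=> c x y; rewrite scaler0 addr0. Qed.
Lemma islinD (f g : U -> V) : islin f -> islin g -> islin (fun x => f x + g x).
Proof. by move=> fl gl c x y; rewrite fl gl scalerDr addrACA. Qed.
Lemma islinN (f : U -> V) : islin f -> islin (fun x => - f x).
Proof. by move=> fl c x y; rewrite fl opprD scalerN. Qed.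
Lemma islin_comp (h : {linear V -> Z}) (f : U -> V) : islin f -> islin (fun x => h (f x)).
Proof. by move=> fl c x y; rewrite fl linearP. Qed.
Lemma islin_mull m n p (f : U -> 'M[F]_(m, n)) (B : 'M[F]_(n, p)) :
  islin f -> islin (fun x => f x *m B).
Proof. by move=> fl c x y; rewrite fl mulmxDl scalemxAl. Qed.
Lemma islin_mulr m n p (f : U -> 'M[F]_(n, p)) (A : 'M[F]_(m, n)) :
  islin f -> islin (fun x => A *m f x).
Proof. by move=> fl c x y; rewrite fl mulmxDr scalemxAr. Qed.
Lemma islin_tr m n (f : U -> 'M[F]_(m, n)) : islin f -> islin (fun x => (f x)^T).
Proof. by move=> fl c x y; rewrite fl linearP. Qed.

Lemma islin_add (f : U -> V) x y : islin f -> f (x + y) = f x + f y.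
Proof. by move=> fl; have := fl 1 x y; rewrite !scale1r. Qed.

Definition lin_pack (f : U -> V) (fl : islin f) : {linear U -> V} :=
  HB.pack f (GRing.isLinear.Build _ _ _ _ _ fl).

End LinearCombinators.

(** * Engel's theorem *)

Section Engel.
Variables (F : fieldType) (A : falgType F).
Implicit Types (U V W : {vspace A}) (u v w x : A).

Definition commv u v : A := u * v - v * u.

Definition comm_closed U := {in U &, forall u v, commv u v \in U}.

Fixpoint ad_killed W (k : nat) u : Prop :=
  if k is k'.+1 then forall w, w \in W -> ad_killed W k' (commv w u)
  else u \in W.

(** The k-fold commutators of an element of [U] with elements of [W] expand into
    products w ... w u w ... w, which lie here. *)
Definition sandwich W U k : {vspace A} :=
  (\sum_(i < k.+1) W ^+ i * U * W ^+ (k - i))%VS.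

Lemma commv_sandwich W U k w u :
  w \in W -> u \in sandwich W U k -> commv w u \in sandwich W U k.+1.
Proof.
move=> wW /memv_sumP[f fP ->]; rewrite /commv mulr_sumr mulr_suml.
have sb (i : 'I_k.+2) : (W ^+ i * U * W ^+ (k.+1 - i) <= sandwich W U k.+1)%VS.
  exact: (sumv_sup i).
apply: rpredB; apply: rpred_sum => i _; have fi := fP i isT.
  apply: (subvP (sb (lift ord0 i))); rewrite /= /bump /= add1n subSS.
  by rewrite expvSl -!prodvA memv_mul // prodvA.
apply: (subvP (sb (widen_ord (leqnSn _) i))).
by rewrite /= subSn -1?ltnS // expvSr prodvA memv_mul.
Qed.

Lemma sandwich_nilp W U n : (W ^+ n = 0)%VS -> sandwich W U (n + n) = 0%VS.
Proof.
move=> W0; apply/eqP; rewrite -subv0; apply/subv_sumP => i _.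
have big m : (n <= m)%N -> (W ^+ m = 0)%VS.
  by move=> /subnK <-; rewrite expvD W0 prodv0.
have [/big->|lt_in] := leqP n i; first by rewrite !prod0v.
by rewrite (big (n + n - i)%N) ?prodv0 // -addnBA ?leq_addr // ltnW.
Qed.

Lemma ad_killedW W U n k u : (W ^+ n = 0)%VS -> (k <= n + n)%N ->
  u \in sandwich W U (n + n - k) -> ad_killed W k u.
Proof.
move=> W0; elim: k u => [|k IH] u kn /=.
  by rewrite subn0 sandwich_nilp // memv0 => /eqP->; rewrite mem0v.
move=> uZ w wW; apply: IH; first exact: ltnW.
by rewrite -(subnSK kn); apply: commv_sandwich.
Qed.

(** A nilpotent [W] acts nilpotently on U / W by commutators, so among the
    iterated commutators of an element outside [W] there is one that is still outside
    and normalises [W]. *)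
Lemma exists_normalising W U n : comm_closed U -> (W <= U)%VS ->
    ~~ (U <= W)%VS -> (W ^+ n = 0)%VS ->
  exists2 u, (u \in U) && (u \notin W) & forall w, w \in W -> commv w u \in W.
Proof.
move=> Ucl sWU nUW W0.
have [u0 u0U u0W] : exists2 u, u \in U & u \notin W by apply/subvPn.
have k0 : ad_killed W (n + n) u0.
  apply: (ad_killedW (U := U) W0) => //; rewrite subnn.
  by rewrite /sandwich big_ord1 /= expv0 prod1v prodv1.
elim: (n + n)%N u0 u0U u0W k0 => [|k IH] u uU uW /=; first by rewrite (negbTE uW).
move=> uk.
have [/allP ok|/allPn[w wW nw]] := boolP (all [pred w | commv w u \in W] (vbasis W)).
  exists u; first by rewrite uU.
  move=> w /coord_vbasis->; rewrite /commv mulr_suml mulr_sumr -sumrB.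
  apply: rpred_sum => i _; rewrite -scalerAl -scalerAr -scalerBr rpredZ //.
  by apply: ok; rewrite mem_nth // size_tuple.
have {}wW : w \in W by apply: vbasis_mem.
by apply: (IH (commv w u)) => //; [apply: Ucl => //; apply: (subvP sWU) | apply: uk].
Qed.

(** As w u lies in u W + W, right multiplication by u preserves every A W^i.  Modulo
    A W^(i+1), a product of elements of W + <u> acts on A W^i as a multiple of a power
    of u, so p factors lead from A W^i to A W^(i+1). *)
Lemma extend_nilp W u n p : (W ^+ n = 0)%VS -> u ^+ p = 0 ->
    (forall w, w \in W -> commv w u \in W) ->
  (((W + <[u]>) ^+ (p * n)) = 0)%VS.
Proof.
move=> W0 u0 uW; set W' := (W + _)%VS.
pose G i := (fullv * W ^+ i)%VS.
have GS i : (G i.+1 <= G i)%VS.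
  by rewrite /G expvSl prodvA prodvSl ?subvf.
have GW i : (G i * W <= G i.+1)%VS by rewrite /G expvSr prodvA.
have Wu : (W * <[u]> <= <[u]> * W + W)%VS.
  apply/prodvP => w v wW /vlineP[c ->].
  rewrite -scalerAr rpredZ // -[w * u](subrK (u * w)) addrC.
  by apply: memv_add; [rewrite memv_mul ?memv_line | apply: uW].
have Gu i : (G i * <[u]> <= G i)%VS.
  elim: i => [|i IH]; first by rewrite /G expv0 prodv1 subvf.
  rewrite {1}/G expvSr prodvA -prodvA.
  apply: (subv_trans (prodvSr _ Wu)); rewrite prodvDr subv_add GW andbT prodvA.
  exact: (subv_trans (prodvSl _ IH)).
have GW' i : (G i * W' <= G i)%VS.
  by rewrite prodvDr subv_add Gu andbT (subv_trans (GW _)).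
have step i k : (G i * W' ^+ k <= G i * <[u]> ^+ k + G i.+1)%VS.
  elim: k => [|k IH]; first by rewrite !expv0 prodv1 addvSl.
  rewrite expvSr prodvA; apply: (subv_trans (prodvSl _ IH)).
  rewrite prodvDl subv_add; apply/andP; split; last first.
    by apply: (subv_trans (GW' _)); apply: addvSr.
  rewrite prodvDr addvC subv_add expvSr prodvA addvSl /=.
  have Guk : (G i * <[u]> ^+ k <= G i)%VS.
    elim: k {IH} => [|k IH]; first by rewrite expv0 prodv1.
    by rewrite expvSr prodvA (subv_trans _ (Gu i)) // prodvSl.
  by apply: (subv_trans _ (addvSr _ _)); apply: (subv_trans (prodvSl _ Guk)).
have up : (<[u]> ^+ p = 0)%VS.
  apply/eqP; rewrite -subv0.
  have : (<[u]> ^+ p <= <[u ^+ p]>)%VS.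
    elim: (p) => [|k IH]; first by rewrite expv0 expr0.
    by rewrite expvSr exprSr (subv_trans (prodvSl _ IH)) // prodv_line.
  by move=> /subv_trans; apply; rewrite u0 -memvE mem0v.
have stepp i : (G 0%N * W' ^+ (p * i) <= G i)%VS.
  elim: i => [|i IH]; first by rewrite muln0 expv0 prodv1.
  rewrite mulnS addnC expvD prodvA (subv_trans (prodvSl _ IH)) //.
  by rewrite (subv_trans (step _ _)) // up prodv0 add0v.
have := stepp n; rewrite /G W0 prodv0 expv0 prodv1 => sub0.
apply/eqP; rewrite -subv0; apply: (subv_trans _ sub0).
by rewrite -[X in (X <= _)%VS]prod1v prodvSl ?subvf.
Qed.

(** A nilpotent subalgebra [W] of [U] that is not all of [U] is enlarged by an
    element normalising it; iterating exhausts the dimension. *)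
Theorem engel U : comm_closed U ->
  (forall u, u \in U -> exists k, u ^+ k = 0) -> exists n, (U ^+ n = 0)%VS.
Proof.
move=> Ucl Unil.
have main k W : (\dim U - \dim W <= k)%N -> (W <= U)%VS -> comm_closed W ->
   (exists n, (W ^+ n = 0)%VS) -> exists n, (U ^+ n = 0)%VS.
  elim: k W => [|k IH] W.
    rewrite leqn0 subn_eq0 => dUW sWU _.
    suff -> : W = U by [].
    by apply/eqP; rewrite eqEdim sWU.
  move=> dW sWU Wcl [n W0].
  have [sUW|nUW] := boolP (U <= W)%VS.
    by exists n; rewrite -W0; congr (_ ^+ _)%VS; apply/eqP; rewrite eqEsubv sUW.
  have [u /andP[uU uW] uN] := exists_normalising Ucl sWU nUW W0.
  have [p up] := Unil u uU.
  apply: (IH (W + <[u]>)%VS).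
  - have : (\dim W < \dim (W + <[u]>))%N.
      rewrite ltn_neqAle dimvS ?addvSl // andbT; apply/eqP => /eqP.
      rewrite (eq_sym (\dim _)) => e; have : (W == W + <[u]>)%VS.
        by rewrite eqEdim addvSl (eqP e) /=.
      by move=> /eqP eW; case/negP: uW; rewrite eW (subvP (addvSr _ _)) // memv_line.
    move: dW; rewrite !leq_subLR => dW lt; apply: (leq_trans dW).
    by rewrite addnS -addSn leq_add2r.
  - by rewrite subv_add sWU -memvE.
  - move=> x y /memv_addP[a aW [_ /vlineP[c ->] ->]].
    move=> /memv_addP[b bW [_ /vlineP[d ->] ->]].
    have -> : commv (a + c *: u) (b + d *: u) =
        commv a b + d *: commv a u - c *: commv b u.
      rewrite /commv !mulrDl !mulrDr -!scalerAl -!scalerAr !scalerA [d * c]mulrC.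
      rewrite !scalerBr !opprD !opprK !addrA.
      move: (a * b) (d *: (a * u)) (c *: (u * b)) (d *: (u * a)) (b * a)
        (c *: (b * u)) ((c * d) *: (u * u)) => a1 a2 a3 a4 a5 a6 a7.
      rewrite [LHS](ACl (1*5*2*6*7*3*(4*8)))/=; rewrite subrr addr0.
      by rewrite [LHS](ACl (1*2*3*5*4*6)).
    apply: (subvP (addvSl _ _)); apply: rpredB; last by rewrite rpredZ ?uN.
    by apply: rpredD; [apply: Wcl | rewrite rpredZ ?uN].
  - by exists (p * n)%N; apply: extend_nilp.
apply: (main (\dim U) 0%VS); rewrite ?leq_subr ?sub0v //.
  by move=> u v; rewrite !memv0 => /eqP-> /eqP->; rewrite /commv mul0r subr0.
by exists 1%N; rewrite expv1.
Qed.

(** If [U] is spanned by commutators, U is contained in U^2, hence in every U^k. *)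
Corollary engel_perfect U :
    comm_closed U -> (forall u, u \in U -> exists k, u ^+ k = 0) ->
    (forall W, {in U &, forall u v, commv u v \in W} -> (U <= W)%VS) ->
  U = 0%VS.
Proof.
move=> Ucl Unil Uperf; have [n Un0] := engel Ucl Unil.
have UU : (U <= U * U)%VS.
  by apply: Uperf => u v uU vU; rewrite rpredB ?memv_mul.
have UUn k : (U <= U ^+ k.+1)%VS.
  elim: k => [|k IH]; first by rewrite expv1.
  by rewrite expvSr (subv_trans UU) // prodvSl.
apply/eqP; rewrite -subv0; apply: (subv_trans (UUn n)).
by rewrite expvSr Un0 prod0v.
Qed.

End Engel.

(** * Cartan's criterion *)

Section HermiteInterpolation.
Variable F : fieldType.

Lemma coprimep_prod_XsubC (x : F) (s : seq F) N :
  x \notin s -> coprimep (('X - x%:P) ^+ N) (\prod_(y <- s) ('X - y%:P) ^+ N).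
Proof.
elim: s => [|y s IH]; first by rewrite big_nil coprimep1.
rewrite inE negb_or big_cons => /andP[xy xs]; rewrite coprimepMr IH // andbT.
by rewrite coprimep_expl // coprimep_expr // coprimep_XsubC2 // subr_eq0 eq_sym.
Qed.

Lemma dvdp_prod_XsubC (s : seq F) N (f : {poly F}) : uniq s ->
  (forall x, x \in s -> ('X - x%:P) ^+ N %| f) ->
  \prod_(y <- s) ('X - y%:P) ^+ N %| f.
Proof.
elim: s => [|x s IH] /=; first by rewrite big_nil dvd1p.
move=> /andP[xs us] sf; rewrite big_cons Gauss_dvdp ?coprimep_prod_XsubC //.
by rewrite sf ?mem_head // IH // => y ys; rewrite sf // inE ys orbT.
Qed.

(** Only the values are prescribed, but with flat contact of order [N], so that
    evaluation at an operator whose eigenvalues lie in [s] with multiplicity at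
    most [N] is the semisimple operator with the new eigenvalues [nu x]. *)
Lemma hermite_interpolation (s : seq F) (nu : F -> F) N : uniq s ->
  exists q : {poly F}, forall x, x \in s -> ('X - x%:P) ^+ N %| q - (nu x)%:P.
Proof.
elim: s => [|x s IH] /=; first by exists 0.
move=> /andP[xs /IH[q0 q0P]].
have /Bezout_eq1_coprimepP[[u v] /= uv1] := coprimep_prod_XsubC N xs.
set p := (_ ^+ N) in uv1; set P := (\prod_(_ <- _) _) in uv1.
exists (q0 * (u * p) + (nu x)%:P * (v * P)) => y; rewrite inE => /predU1P[->|ys].
  have vP : v * P = 1 - u * p by rewrite -uv1; ring.
  rewrite vP (_ : _ + _ - _ = (q0 - (nu x)%:P) * u * p); last by ring.
  exact: dvdp_mull.
have up : u * p = 1 - v * P by rewrite -uv1; ring.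
rewrite up (_ : _ + _ - _ = q0 - (nu y)%:P + ((nu x)%:P - q0) * v * P); last by ring.
rewrite dvdp_add ?q0P // dvdp_mull //.
rewrite /P (perm_big _ (perm_to_rem ys)) /= big_cons dvdp_mulr //.
Qed.

End HermiteInterpolation.

Section OperatorPolynomial.
Variables (F : fieldType) (V : lmodType F) (D : {linear V -> V}).

(** Needed for the commutator with a matrix, an endomorphism that is not itself given
    as a matrix. *)
Definition opeval (r : {poly F}) (a : V) : V :=
  \sum_(k < size r) r`_k *: iter k D a.

Lemma opevalE n (r : {poly F}) a : (size r <= n)%N ->
  opeval r a = \sum_(k < n) r`_k *: iter k D a.
Proof.
move=> rn; rewrite /opeval (big_ord_widen _ (fun k => r`_k *: iter k D a) rn).
rewrite [RHS](bigID (fun i : 'I_n => (i < size r)%N)) /= [X in _ + X]big1 ?addr0 //.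
by move=> i; rewrite -leqNgt => ?; rewrite nth_default ?scale0r.
Qed.

Lemma iter_linear k : linear (iter k D).
Proof. by elim: k => [//|k IH] c x y; rewrite !iterS IH linearP. Qed.

Lemma opeval_linear r : linear (opeval r).
Proof.
move=> c x y; rewrite /opeval scaler_sumr -big_split /=; apply: eq_bigr => k _.
by rewrite iter_linear scalerDr !scalerA mulrC.
Qed.

HB.instance Definition _ r := GRing.isLinear.Build F V V _ (opeval r)
  (opeval_linear r).

Lemma opevalD r1 r2 a : opeval (r1 + r2) a = opeval r1 a + opeval r2 a.
Proof.
pose n := maxn (size r1) (size r2).
rewrite !(@opevalE n) ?size_polyD ?leq_maxl ?leq_maxr // -big_split /=.
by apply: eq_bigr => k _; rewrite coefD scalerDl.
Qed.

Lemma opevalC c a : opeval c%:P a = c *: a.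
Proof. by rewrite (@opevalE 1) ?size_polyC_leq1 // big_ord1 coefC. Qed.

Lemma opevalMX r a : opeval (r * 'X) a = opeval r (D a).
Proof.
have sz : (size (r * 'X)%R <= (size r).+1)%N.
  by apply: leq_trans (size_polyMleq _ _) _; rewrite size_polyX addn2.
rewrite (opevalE _ sz) big_ord_recl coefMX /= scale0r add0r.
by apply: eq_bigr => k _; rewrite coefMX /= -iterSr.
Qed.

Lemma opevalZ c r a : opeval (c *: r) a = c *: opeval r a.
Proof.
rewrite (opevalE _ (size_scale_leq c r)) /opeval scaler_sumr.
by apply: eq_bigr => k _; rewrite coefZ scalerA.
Qed.

Lemma opevalM r1 r2 a : opeval (r1 * r2) a = opeval r1 (opeval r2 a).
Proof.
elim/poly_ind: r2 a => [|r2 c IH] a.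
  by rewrite mulr0 -[0]/(0%:P) !opevalC !scale0r linear0.
rewrite mulrDr mulrA !opevalD !opevalMX IH opevalC linearD /=; congr (_ + _).
by rewrite mulrC mul_polyC opevalZ linearZ.
Qed.

End OperatorPolynomial.

Section CommvLinear.
Variables (F : fieldType) (A : falgType F).
Fact commv_linear (u : A) : linear (commv u).
Proof.
move=> c x y; rewrite /commv mulrDr mulrDl -scalerAl -scalerAr scalerBr.
by rewrite opprD addrACA.
Qed.
HB.instance Definition _ u := GRing.isLinear.Build F A A _ (commv u)
  (commv_linear u).
End CommvLinear.

Section Trig.
Variables (F : fieldType) (n : nat).
Implicit Types S T : 'M[F]_n.+1.

Lemma trig_mulmx S T : is_trig_mx S -> is_trig_mx T ->
  is_trig_mx (S *m T) /\ forall i, (S *m T) i i = S i i * T i i.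
Proof.
move=> /is_trig_mxP tS /is_trig_mxP tT; split.
  apply/is_trig_mxP => i j ij; rewrite mxE big1 // => k _.
  have [ik|ki] := ltnP i k; first by rewrite tS // mul0r.
  by rewrite tT ?mulr0 // (leq_ltn_trans ki).
move=> i; rewrite mxE (bigD1 i) //= big1 ?addr0 // => k.
rewrite neq_ltn => /orP[ki|ik]; first by rewrite [T k i]tT ?mulr0.
by rewrite tS ?mul0r.
Qed.

Lemma trig_horner T q : is_trig_mx T ->
  is_trig_mx (horner_mx T q) /\ forall i, (horner_mx T q) i i = q.[T i i].
Proof.
move=> tT; elim/poly_ind: q => [|q c [tq dq]].
  by rewrite rmorph0 mx0_is_trig; split=> // i; rewrite mxE horner0.
rewrite rmorphD rmorphM /= horner_mx_X horner_mx_C.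
have [tqT dqT] := trig_mulmx tq tT; split.
  apply/is_trig_mxP => i j ij; rewrite mxE (is_trig_mxP tqT) // add0r mxE.
  by rewrite -val_eqE ltn_eqF.
by move=> i; rewrite mxE dqT dq mxE eqxx hornerMXaddC.
Qed.

End Trig.

Section ConjugateSemisimplePart.
Variables (C : numClosedFieldType) (n : nat) (X : 'M[C]_n.+1).

(** On a block sent to zero by a power of X - l from the left and by a power of
    X - k from the right, the commutator with X has the only eigenvalue l - k:
    (ad X - (l - k)) a = (X - l) a - a (X - k). *)
Lemma killed_commv (l k : C) (i j : nat) (a : 'M[C]_n.+1) :
    (X - l%:M) ^+ i * a = 0 -> a * (X - k%:M) ^+ j = 0 ->
  opeval (commv X) (('X - (l - k)%:P) ^+ (i + j)) a = 0.
Proof.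
move: {2}(i + j)%N (leqnn (i + j)) => m.
elim: m i j a => [|m IH] [|i] [|j] a //= ijm;
  rewrite ?expr0 ?mul1r ?mulr1 => ai aj; rewrite ?ai ?aj ?linear0 //.
have -> : ('X - (l - k)%:P) ^+ (i.+1 + j.+1)
    = ('X - (l - k)%:P) ^+ (i + j.+1) * ('X - (l - k)%:P) by rewrite addSn exprSr.
rewrite opevalM.
have -> : opeval (commv X) ('X - (l - k)%:P) a = commv X a + - (l - k) *: a.
  by rewrite opevalD -polyCN opevalC -['X]mul1r opevalMX -[1]/(1%:P) opevalC scale1r.
have -> : commv X a + - (l - k) *: a = (X - l%:M) * a - a * (X - k%:M).
  rewrite /commv mulrBl mulrBr -(scalemx1 _ l) -(scalemx1 _ k) -[_ * (k *: 1%:M)]scalerAr.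
  rewrite -scalerAl mul1r mulr1 scaleNr scalerBl !opprB !addrA.
  by rewrite [LHS](ACl (1*4*3*2))/=.
rewrite linearB /=; apply/eqP; rewrite subr_eq0; apply/eqP.
transitivity (0 : 'M[C]_n.+1).
  apply: IH; first by rewrite -ltnS.
    by rewrite mulrA -exprSr.
  by rewrite -mulrA aj mulr0.
rewrite addnS -addSn; apply/esym; apply: IH; first by rewrite addSn -addnS -ltnS.
  by rewrite mulrA ai mul0r.
by rewrite -mulrA -exprS.
Qed.

(** The matrix q(X) is the complex conjugate of the semisimple part of X: q takes
    the value l^* near every eigenvalue l.  Its commutator is a polynomial r(ad X),
    where r takes the value m^* near every difference m of eigenvalues; this is
    where conjugation enters, being additive.  The trace of X q(X) is then the sum of
    the |l|^2. *)
Lemma conj_semisimple_part : exists q r : {poly C},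
  (forall a, commv (horner_mx X q) a = opeval (commv X) r a) /\
  exists t : 'I_n.+1 -> C, \tr (X *m horner_mx X q) = \sum_i t i * (t i)^* /\
    ((forall i, t i = 0) -> X ^+ n.+1 = 0).
Proof.
have [P /unitarymx_unit Pu trigT] := Schur X isT.
rewrite /similar_to conjumx //= in trigT.
set T := P *m X *m invmx P in trigT.
have XE : X = invmx P *m T *m P by rewrite /T !mulmxA mulVmx // mul1mx mulmxKV.
pose t i := T i i.
have charT : char_poly T = \prod_i ('X - (t i)%:P) by apply: char_poly_trig.
have charX0 : horner_mx X (char_poly T) = 0.
  by rewrite XE horner_mx_uconjC // Cayley_Hamilton mulmx0 mul0mx.
pose s := undup [seq t i | i : 'I_n.+1].
have us : uniq s by apply: undup_uniq.
have ts i : t i \in s by rewrite mem_undup map_f // mem_enum.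
have annih f : (forall l, l \in s -> ('X - l%:P) ^+ n.+1 %| f) ->
    horner_mx X f = 0.
  move=> /(dvdp_prod_XsubC us); rewrite prodrXl => sf.
  suff /dvdpP[g ->] : char_poly T %| f by rewrite rmorphM /= charX0 mulr0.
  apply: dvdp_trans sf; rewrite charT.
  have -> : (\prod_(y <- s) ('X - y%:P)) ^+ n.+1
     = \prod_(i < n.+1) \prod_(y <- s) ('X - y%:P).
    by rewrite prodr_const card_ord.
  elim/big_rec2: _ => // i y1 y2 _; apply: dvdp_mul.
  by rewrite (perm_big _ (perm_to_rem (ts i))) /= big_cons dvdp_mulr.
have [q qP] := hermite_interpolation (fun x => x^*) n.+1 us.
pose s2 := undup [seq l - k | l <- s, k <- s].
have [r rP] := hermite_interpolation (fun x => x^*) (n.+1 + n.+1) (undup_uniq _ : uniq s2).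
exists q, r; split; last first.
  exists t; split.
    have -> : X *m horner_mx X q = invmx P *m (T *m horner_mx T q) *m P.
      rewrite [X in horner_mx X]XE horner_mx_uconjC // [X in X *m _]XE.
      by rewrite !mulmxA mulmxK.
    rewrite mxtrace_mulC !mulmxA mulmxV // mul1mx.
    have [tq dq] := trig_horner q trigT.
    rewrite /mxtrace; apply: eq_bigr => i _.
    rewrite (trig_mulmx trigT tq).2 dq -/(t i); congr (_ * _).
    have /dvdpP[g /(canRL (subrK _)) ->] := qP _ (ts i).
    by rewrite hornerD hornerM exprS hornerM hornerXsubC subrr mul0r mulr0 add0r hornerC.
  move=> t0; rewrite -[X in X ^+ _]horner_mx_X -rmorphXn /=.
  by rewrite -[RHS]charX0 charT (eq_bigr (fun=> 'X)) ?prodr_const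
     ?card_ord // => i _; rewrite t0 subr0.
pose delta (l x : C) : C := (x == l)%:R.
(* The matrices e_l(X) are the projections to the generalised eigenspaces; every a
   is the sum of its blocks E l * a * E k, on which both sides are scalar. *)
have /fin_all_exists[e eP] : forall l : seq_sub s, exists f : {poly C},
    forall x, x \in s -> ('X - x%:P) ^+ n.+1 %| f - (delta (val l) x)%:P.
  by move=> l; apply: hermite_interpolation.
pose E l := horner_mx X (e l).
have sumE : \sum_l E l = 1.
  apply/eqP; rewrite -subr_eq0 /E -rmorph_sum -[1](rmorph1 (horner_mx X)).
  rewrite -rmorphB /=; apply/eqP/annih => x xs.
  have -> : \sum_l e l - 1 = \sum_l (e l - (delta (val l) x)%:P).
    rewrite sumrB; congr (_ - _); rewrite (bigD1 (SeqSub xs)) //= big1 ?addr0.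
      by rewrite /delta eqxx.
    move=> l; rewrite -val_eqE /= /delta eq_sym => /negbTE -> //.
  apply: (big_ind (fun p => ('X - x%:P) ^+ n.+1 %| p)) => [|p1 p2|l _].
  - exact: dvdp0.
  - exact: dvdp_add.
  - exact: eP.
have eX l f : ('X - (val l)%:P) ^+ n.+1 %| f -> horner_mx X (f * e l) = 0.
  move=> lf; apply: annih => x xs.
  have [->|xl] := eqVneq x (val l); first exact: dvdp_mulr.
  by apply: dvdp_mull; have := eP l x xs; rewrite /delta (negbTE xl) subr0.
move=> a; have -> : a = \sum_l \sum_k E l * a * E k.
  under eq_bigr do rewrite -mulr_sumr sumE mulr1.
  by rewrite -mulr_suml sumE mul1r.
rewrite !linear_sum; apply: eq_bigr => l _; rewrite !linear_sum; apply: eq_bigr => k _ /=.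
set b := E l * a * E k; set lv := val l; set kv := val k.
have lkS : lv - kv \in s2.
  rewrite mem_undup; apply/allpairsP; exists (lv, kv).
  by split=> //; [apply: (valP l) | apply: (valP k)].
have hX x m : horner_mx X (('X - x%:P) ^+ m) = (X - x%:M) ^+ m.
  by rewrite rmorphXn rmorphB /= horner_mx_X horner_mx_C.
have -> : opeval (commv X) r b = (lv - kv)^* *: b.
  have /dvdpP[g /(canRL (subrK _)) ->] := rP _ lkS.
  rewrite opevalD opevalC opevalM killed_commv ?linear0 ?add0r //.
    by rewrite /b !mulrA -hX -rmorphM /= eX ?mul0r.
  by rewrite /b -!mulrA -hX -rmorphM mulrC /= eX ?mulr0.
rewrite /commv.
have -> : horner_mx X q * b = lv^* *: b.
  have := eX l _ (qP _ (valP l)); rewrite rmorphM rmorphB /= horner_mx_C => /eqP.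
  rewrite mulrBl subr_eq0 -/(E l) => /eqP qE.
  by rewrite /b !mulrA qE -scalemx1 -scalerAl mul1r -!scalerAl.
have -> : b * horner_mx X q = kv^* *: b.
  have := eX k _ (qP _ (valP k)); rewrite mulrC rmorphM rmorphB /= horner_mx_C => /eqP.
  rewrite mulrBr subr_eq0 -/(E k) => /eqP qE.
  by rewrite /b -!mulrA qE -scalemx1 -scalerAr mulr1 -!scalerAr.
by rewrite -scalerBl -rmorphB.
Qed.

End ConjugateSemisimplePart.

Section CartanCriterion.
Variables (R : rcfType) (n : nat).
Implicit Types (U W : {vspace 'M[R]_n.+1}) (a b x : 'M[R]_n.+1).

(* The conjugate of the semisimple part of a real matrix need not be real; its real
   part still has a commutator that is a real polynomial in ad x. *)
Let toC := @real_complex R.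
Let ReM m p (z : 'M[R[i]]_(m, p)) := map_mx (@complex.Re R) z.

Local Lemma ReMl m p q (z : 'M[R[i]]_(m, p)) (a : 'M[R]_(p, q)) :
  ReM (z *m map_mx toC a) = ReM z *m a.
Proof.
apply/matrixP => i j; rewrite !mxE raddf_sum; apply: eq_bigr => k _.
by rewrite !mxE; case: (z i k) => u v /=; rewrite mulr0 subr0.
Qed.

Local Lemma ReMr m p q (z : 'M[R[i]]_(p, q)) (a : 'M[R]_(m, p)) :
  ReM (map_mx toC a *m z) = a *m ReM z.
Proof.
apply/matrixP => i j; rewrite !mxE raddf_sum; apply: eq_bigr => k _.
by rewrite !mxE; case: (z k j) => u v /=; rewrite mul0r subr0.
Qed.

Lemma real_conj_semisimple_part x : exists y (r : {poly R}),
  (forall a, commv y a = opeval (commv x) r a) /\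
  (\tr (x *m y) = 0 -> x ^+ n.+1 = 0).
Proof.
have [q [r [qr [t [trX nilX]]]]] := conj_semisimple_part (map_mx toC x).
set X := map_mx toC x in qr trX nilX; set Y := horner_mx X q in qr trX.
exists (ReM Y), (\poly_(k < size r) complex.Re r`_k); split.
  move=> a; rewrite (opevalE _ _ (size_poly _ _)).
  transitivity (ReM (commv Y (map_mx toC a))).
    rewrite /commv /ReM map_mxB; congr (_ - _).
      exact: (esym (ReMl Y a)).
    exact: (esym (ReMr Y a)).
  rewrite qr /opeval /ReM raddf_sum; apply: eq_bigr => k _.
  rewrite coef_poly ltn_ord.
  have -> : iter k (commv X) (map_mx toC a) = map_mx toC (iter k (commv x) a).
    elim: (k : nat) => //= m ->; rewrite /commv /X.
    by rewrite map_mxB; congr (_ - _); exact: (esym (map_mxM _ _ _)).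
  apply/matrixP => i j; rewrite !mxE; case: (r`_k) => u v /=.
  by rewrite mulr0 subr0.
move=> trxy0.
have z0 : \sum_i t i * (t i)^* = 0.
  have zge0 : 0 <= \sum_i t i * (t i)^* by apply: sumr_ge0 => i _; apply: mul_conjC_ge0.
  have Rez : complex.Re (\sum_i t i * (t i)^*) = 0.
    rewrite -trX -trxy0 -[in RHS](ReMr Y x) /mxtrace raddf_sum.
    by apply: eq_bigr => i _; rewrite [RHS]mxE.
  move: zge0 Rez; case: (\sum_i _) => u v /=; rewrite lecE /= => /andP[/eqP-> _] ->.
  by [].
have t0 i : t i = 0.
  have := psumr_eq0P (fun i _ => mul_conjC_ge0 (t i)) z0 (i := i) isT.
  by move/eqP; rewrite mul_conjC_eq0 => /eqP.
apply/eqP; rewrite -(map_mx_eq0 toC) -[map_mx _ _]/(map_mx toC (x ^+ n.+1)).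
by rewrite rmorphXn /= (nilX t0).
Qed.

(** For x in [U] and y the matrix of [real_conj_semisimple_part], ad y preserves
    [U], so that tr ([a, b] y) = - tr (a [y, b]) = 0; as the commutators span [U],
    tr (x y) = 0 and x is nilpotent.  Engel's theorem concludes. *)
Theorem cartan_criterion U :
    comm_closed U -> {in U &, forall a b, \tr (a *m b) = 0} ->
    (forall W, {in U &, forall a b, commv a b \in W} -> (U <= W)%VS) ->
  U = 0%VS.
Proof.
move=> Ucl trU Uperf; apply: engel_perfect => // x xU; exists n.+1.
have [y [r [yr]]] := real_conj_semisimple_part x; apply.
have yU a : a \in U -> commv y a \in U.
  move=> aU; rewrite yr /opeval; apply: rpred_sum => k _; apply: rpredZ.
  by elim: (k : nat) => //= m; apply: Ucl.
pose f (c : 'M[R]_n.+1) : R^o := \tr (c *m y).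
have fl : linear f by move=> c a b; rewrite /f mulmxDl -scalemxAl linearP.
have /subvP/(_ x xU) : (U <= lker (linfun (lin_pack fl)))%VS; last first.
  by rewrite memv_ker lfunE /= => /eqP.
apply: Uperf => a b aU bU; rewrite memv_ker lfunE /= /f /commv.
have -> : \tr ((a * b - b * a) *m y) = - \tr (a *m commv y b).
  rewrite /commv mulmxBl mulmxBr !linearB /= opprB; congr (_ - _).
    by rewrite -!mulmxA.
  by rewrite -[b * a *m y]mulmxA mxtrace_mulC -mulmxA.
by rewrite trU ?oppr0 // yU.
Qed.

End CartanCriterion.

(** * Lie algebras in coordinates and the Casimir element *)

Section ColumnBasis.
Variables (F : fieldType) (n : nat).

Definition ebase (i : 'I_n) : 'cV[F]_n := delta_mx i 0.

Lemma cV_sum_ebase (v : 'cV[F]_n) : v = \sum_i v i 0 *: ebase i.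
Proof.
by rewrite {1}(matrix_sum_delta v); apply: eq_bigr => i _; rewrite big_ord1.
Qed.

Lemma mulmx_ebase m (A : 'M[F]_(m, n)) i : A *m ebase i = col i A.
Proof. by rewrite colE. Qed.

Lemma mulmx_cV_inj m (A B : 'M[F]_(m, n)) : (forall v : 'cV_n, A *m v = B *m v) -> A = B.
Proof.
move=> AB; apply/matrixP => i j; have := AB (ebase j).
by rewrite !mulmx_ebase => /matrixP/(_ i 0); rewrite !mxE.
Qed.

Lemma mxtrace_ebase (A : 'M[F]_n) : \tr A = \sum_i ((ebase i)^T *m A *m ebase i) 0 0.
Proof.
apply: eq_bigr => i _; rewrite -mulmxA mulmx_ebase trmx_delta -rowE.
by rewrite !mxE.
Qed.

Variables (Z : lmodType F) (f : 'cV[F]_n -> 'cV[F]_n -> Z).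
Hypotheses (fl : forall v, linear (f^~ v)) (fr : forall u, linear (f u)).

Lemma bilinear_suml (I : finType) (c : I -> F) (u : I -> 'cV_n) v :
  f (\sum_i c i *: u i) v = \sum_i c i *: f (u i) v.
Proof.
rewrite -[LHS]/(lin_pack (fl v) _) linear_sum; apply: eq_bigr => i _.
by rewrite linearZ.
Qed.

Lemma bilinear_sumr (I : finType) (c : I -> F) (u : I -> 'cV_n) v :
  f v (\sum_i c i *: u i) = \sum_i c i *: f v (u i).
Proof.
rewrite -[LHS]/(lin_pack (fr v) _) linear_sum; apply: eq_bigr => i _.
by rewrite linearZ.
Qed.

(** The tensor sum_i e_i (x) e_i is sent by X (x) Y to the same tensor as by
    1 (x) (Y X^T). *)
Lemma bilinear_sum_move (X Y : 'M[F]_n) :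
  \sum_i f (X *m ebase i) (Y *m ebase i) = \sum_i f (ebase i) (Y *m X^T *m ebase i).
Proof.
transitivity (\sum_i \sum_k X k i *: f (ebase k) (Y *m ebase i)).
  apply: eq_bigr => i _; rewrite {1}[X *m _]cV_sum_ebase bilinear_suml.
  by apply: eq_bigr => k _; rewrite mulmx_ebase mxE.
rewrite exchange_big /=; apply: eq_bigr => k _.
rewrite -mulmxA [X^T *m _]cV_sum_ebase mulmx_sumr.
under [in RHS]eq_bigr do rewrite -scalemxAr.
by rewrite bilinear_sumr; apply: eq_bigr => i _; rewrite [X^T *m _]mulmx_ebase !mxE.
Qed.

End ColumnBasis.
Arguments ebase {F n} i.

Lemma mxtraceB (F : pzRingType) n (A B : 'M[F]_n) : \tr (A - B) = \tr A - \tr B.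
Proof. exact: raddfB. Qed.

Lemma mxtraceN (F : pzRingType) n (A : 'M[F]_n) : \tr (- A) = - \tr A.
Proof. exact: raddfN. Qed.

(** The matrix [W u] is that of ad u; the second clause is the Jacobi identity. *)
Definition lie_tensor (F : fieldType) n (W : 'cV[F]_n -> 'M[F]_n) : Prop :=
  (forall u v, W u *m v = - (W v *m u)) /\
  (forall u v, W (W u *m v) = W u *m W v - W v *m W u).

Definition lie_rep (F : fieldType) m n (W : 'cV[F]_m -> 'M[F]_m)
    (r : 'cV[F]_m -> 'M[F]_n) : Prop :=
  forall u v, r (W u *m v) = r u *m r v - r v *m r u.

Definition trace_form (F : fieldType) m n (r : 'cV[F]_m -> 'M[F]_n) : 'M[F]_m :=
  \matrix_(i, j) \tr (r (ebase i) *m r (ebase j)).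

(** The Killing form is the trace form of the adjoint representation. *)
Notation killing_mx W := (trace_form W).

Lemma bilin_form_inj (F : fieldType) n (A B : 'M[F]_n) :
  (forall u v : 'cV_n, (u^T *m A *m v) 0 0 = (u^T *m B *m v) 0 0) -> A = B.
Proof.
move=> AB; apply/matrixP => i j; have := AB (ebase i) (ebase j).
by rewrite -!mulmxA !mulmx_ebase !trmx_delta -!rowE !mxE.
Qed.

Section TraceForm.
Variables (F : fieldType) (m n : nat) (r : {linear 'cV[F]_m -> 'M[F]_n}).

Lemma trace_formE u v :
  \tr (r u *m r v) = (u^T *m trace_form r *m v) 0 0.
Proof.
have rE w : r w = \sum_i w i 0 *: r (ebase i).
  rewrite {1}[w]cV_sum_ebase linear_sum; apply: eq_bigr => i _; exact: linearZ.
rewrite (rE u) (rE v) mulmx_suml linear_sum mxE /=.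
transitivity (\sum_i \sum_j u i 0 * v j 0 * trace_form r i j).
  apply: eq_bigr => i _; rewrite mulmx_sumr linear_sum /=.
  apply: eq_bigr => j _; rewrite -scalemxAl -scalemxAr !linearZ /= mxE; ring.
rewrite exchange_big; apply: eq_bigr => j _; rewrite mxE mulr_suml.
by apply: eq_bigr => i _; rewrite [u^T _ _]mxE; ring.
Qed.

Lemma trace_form_sym : (trace_form r)^T = trace_form r.
Proof. by apply/matrixP => i j; rewrite !mxE mxtrace_mulC. Qed.

Lemma trace_form_invariant (W : 'cV[F]_m -> 'M[F]_m) x :
  lie_rep W r -> (W x)^T *m trace_form r = - (trace_form r *m W x).
Proof.
move=> rW; apply: bilin_form_inj => u v.
rewrite mulmxN mulNmx [RHS]mxE !mulmxA -trmx_mul.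
rewrite -[_ *m W x *m v]mulmxA -!trace_formE !rW.
rewrite mulmxBl mulmxBr !mxtraceB opprB -!mulmxA.
by rewrite [\tr (r x *m _)]mxtrace_mulC -!mulmxA.
Qed.

End TraceForm.

Section LieTensor.
Variables (F : fieldType) (n : nat).

Variable W : {linear 'cV[F]_n -> 'M[F]_n}.
Hypotheses (Wlie : lie_tensor W) (Wnd : killing_mx W \in unitmx).
Let K := killing_mx W.
Let Q := invmx K.

Let Wanti u v : W u *m v = - (W v *m u). Proof. exact: Wlie.1. Qed.
Let Wbr u v : W (W u *m v) = W u *m W v - W v *m W u. Proof. exact: Wlie.2. Qed.

Let killing_invariant x : (W x)^T *m K = - (K *m W x).
Proof. exact/trace_form_invariant/Wlie.2. Qed.

Lemma casimir_shift x : Q *m (W x)^T = - (W x *m Q).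
Proof.
have := killing_invariant x => /(congr1 (fun M => Q *m M *m Q)).
rewrite mulmxN mulNmx [Q *m (K *m _)]mulmxA mulVmx // mul1mx => <-.
by rewrite !mulmxA mulmxK.
Qed.

(** The vectors Q e_i form the basis dual to the e_i for the Killing form, so this is
    the invariance of the Casimir tensor sum_i e_i (x) Q e_i under ad x. *)
Lemma casimir_invariance (Z : lmodType F) (f : 'cV[F]_n -> 'cV[F]_n -> Z) x :
    (forall v, linear (f^~ v)) -> (forall u, linear (f u)) ->
  \sum_i f (W x *m ebase i) (Q *m ebase i) =
  - \sum_i f (ebase i) (W x *m (Q *m ebase i)).
Proof.
move=> fl fr; rewrite bilinear_sum_move // casimir_shift -sumrN.
apply: eq_bigr => i _; rewrite mulNmx -mulmxA.
by rewrite -[LHS]/(lin_pack (fr (ebase i)) _) linearN.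
Qed.

(** The Casimir element acts as the identity on the adjoint representation, since
    the invariant form used to define it is the trace form of that representation. *)
Lemma casimir_adjoint : \sum_i W (ebase i) *m W (Q *m ebase i) = 1%:M.
Proof.
suff : K *m (\sum_i W (ebase i) *m W (Q *m ebase i)) = K *m 1%:M.
  by move=> /(congr1 (mulmx Q)); rewrite !mulmxA mulVmx // !mul1mx.
rewrite mulmx1; apply: bilin_form_inj => x y; rewrite -trace_formE.
rewrite -[W x *m W y](mulKmx Wnd) mxtrace_mulC -/Q mxtrace_ebase.
rewrite mulmx_sumr mulmx_sumr mulmx_suml summxE; apply: eq_bigr => i _.
have xW : x^T *m K *m W (ebase i) = - ((ebase i)^T *m K *m W x).
  have trW : (W (ebase i) *m x)^T = - ((ebase i)^T *m (W x)^T).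
    by rewrite Wanti raddfN /= trmx_mul.
  have := congr1 (mulmx x^T) (killing_invariant (ebase i)).
  rewrite mulmxA -trmx_mul trW mulNmx mulmxN => /oppr_inj.
  by rewrite -[X in X = _ -> _]mulmxA killing_invariant mulmxN !mulmxA => <-.
by rewrite !mulmxA xW !mulNmx -mulmxA Wanti mulmxN opprK !mulmxA.
Qed.

(** The derivation [A] is the inner derivation by the contraction of the Casimir
    tensor with the cocycle A, which is the usual averaging proof of H^1(g, g) = 0. *)
Theorem derivation_inner (A : 'M[F]_n) :
    (forall v, A *m W v - W v *m A = W (A *m v)) ->
  exists z, A = W z.
Proof.
move=> Ader; pose q i := Q *m ebase i.
exists (- \sum_i W (ebase i) *m (A *m q i)); apply: mulmx_cV_inj => y.
rewrite Wanti mulmxN opprK mulmx_sumr.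
transitivity (\sum_i W (W y *m ebase i) *m (A *m q i)
   + \sum_i W (ebase i) *m (W y *m (A *m q i))); last first.
  rewrite -big_split; apply: eq_bigr => i _.
  by rewrite /= Wbr mulmxBl -!mulmxA subrK.
pose f (u v : 'cV[F]_n) := W u *m (A *m v).
have fl v : linear (f^~ v).
  by move=> c u w; rewrite /f linearP mulmxDl scalemxAl.
have fr u : linear (f u).
  by move=> c v w; rewrite /f !mulmxDr -!scalemxAr.
rewrite (casimir_invariance y fl fr) /f addrC -sumrB -[LHS]mul1mx -casimir_adjoint mulmx_suml.
apply: eq_bigr => i _; rewrite -mulmxBr -mulmxA; congr (_ *m _).
by rewrite Wanti -Ader mulmxBl -!mulmxA opprB.
Qed.

Lemma ad_inj u : W u = 0 -> u = 0.
Proof.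
move=> Wu0; have : K *m u = 0.
  apply/matrixP => i j; rewrite ord1 [RHS]mxE.
  have := trace_formE W (ebase i) u; rewrite Wu0 mulmx0 mxtrace0.
  by rewrite trmx_delta -mulmxA -rowE -/K [RHS]mxE => <-.
by move=> /(congr1 (mulmx Q)); rewrite mulmxA mulVmx // mul1mx mulmx0.
Qed.

(** This is H^2(g, g) = 0: an infinitesimal deformation [D] of the bracket is the
    derivative of a change of basis.  The primitive is the contraction of [D] with
    the Casimir tensor, the Casimir operator being the identity. *)
Theorem whitehead2_adjoint (D : {linear 'cV[F]_n -> 'M[F]_n}) :
    (forall x y, D x *m y = - (D y *m x)) ->
    (forall x y, D (W x *m y) + W (D x *m y) =
       (W x *m D y - D y *m W x) + (D x *m W y - W y *m D x)) ->
  exists a, forall x, D x = W (a *m x) + W x *m a - a *m W x.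
Proof.
move=> Danti Dcoc; pose q i := Q *m ebase i.
pose a := \sum_i W (ebase i) *m D (q i); exists a => x.
pose f (u v : 'cV[F]_n) := W u *m D v.
have fl v : linear (f^~ v).
  by move=> c u w; rewrite /f linearP mulmxDl scalemxAl.
have fr u : linear (f u).
  by move=> c v w; rewrite /f linearP mulmxDr -!scalemxAr.
have invf : \sum_i W (W x *m ebase i) *m D (q i) = - \sum_i W (ebase i) *m D (W x *m q i).
  exact: casimir_invariance x fl fr.
have -> : W x *m a = \sum_i W (ebase i) *m (W x *m D (q i) - D (W x *m q i)).
  transitivity (\sum_i (W (W x *m ebase i) *m D (q i) + W (ebase i) *m (W x *m D (q i)))).
    rewrite mulmx_sumr; apply: eq_bigr => i _.
    by rewrite Wbr mulmxBl -!mulmxA subrK.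
  rewrite big_split /= invf addrC -sumrB; apply: eq_bigr => i _.
  by rewrite mulmxBr.
have -> : W (a *m x) = \sum_i (W (D x *m q i) *m W (ebase i) - W (ebase i) *m W (D x *m q i)).
  rewrite mulmx_suml linear_sum; apply: eq_bigr => i _.
  by rewrite -mulmxA Danti mulmxN linearN /= Wbr opprB.
pose g (u v : 'cV[F]_n) := W u *m (D x *m v).
have gl v : linear (g^~ v).
  by move=> c u w; rewrite /g linearP mulmxDl scalemxAl.
have gr u : linear (g u).
  by move=> c v w; rewrite /g !mulmxDr -!scalemxAr.
have swap : \sum_i W (D x *m q i) *m W (ebase i) = \sum_i W (ebase i) *m D x *m W (q i).
  apply: mulmx_cV_inj => y; rewrite !mulmx_suml.
  transitivity (\sum_i g (W y *m ebase i) (q i)).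
    by apply: eq_bigr => i _; rewrite -mulmxA Wanti /g [W (ebase i) *m y]Wanti linearN mulNmx opprK.
  rewrite (casimir_invariance y gl gr) -sumrN; apply: eq_bigr => i _.
  by rewrite /g -/(q i) -!mulmxA [W (q i) *m y]Wanti !mulmxN.
rewrite sumrB swap -[LHS]mul1mx -casimir_adjoint !mulmx_suml -sumrB -big_split /= -sumrB.
apply: eq_bigr => i _; rewrite -/(q i).
rewrite -!mulmxA -!mulmxBr -!mulmxDr -!mulmxBr; congr (_ *m _).
have /eqP := Dcoc x (q i); rewrite -subr_eq0 => /eqP coc; apply/eqP.
rewrite -subr_eq0 -coc !opprD !opprK !addrA.
by rewrite [eqbLHS](ACl (5*3*4*6*2*1))/=.
Qed.

End LieTensor.

(** * Whitehead's first lemma *)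

Section Idempotents.
Variable F : fieldType.

(** The Fitting decomposition: p(A) is the projection to the part on which [A] is
    invertible, along the part on which it is nilpotent, and d(A) inverts [A] on the
    former. *)
Lemma fitting n (A : 'M[F]_n.+1) : exists p d : {poly F},
  [/\ horner_mx A p *m horner_mx A p = horner_mx A p,
      A *m horner_mx A d = horner_mx A p &
      horner_mx A p = 0 -> exists k, A ^+ k = 0].
Proof.
have cp0 : char_poly A != 0 by rewrite monic_neq0 ?char_poly_monic.
have [k [q q0 cpE]] := multiplicity_XsubC (char_poly A) 0.
rewrite cp0 /= subr0 in q0 cpE.
have Aq : horner_mx A (q * 'X^k) = 0 by rewrite -cpE Cayley_Hamilton.
have : coprimep 'X^(k.+1) q.
  by rewrite coprimep_expl // coprimep_sym coprimepX.
move=> /Bezout_eq1_coprimepP[[u v] /= uv1].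
have pk : horner_mx A (u * 'X^(k.+1)) *m horner_mx A (v * q) = 0.
  rewrite -[LHS](rmorphM (horner_mx A)).
  have -> : u * 'X^(k.+1) * (v * q) = u * v * 'X * (q * 'X^k) by rewrite exprS; ring.
  by rewrite rmorphM /= Aq mulr0.
have one : horner_mx A (u * 'X^(k.+1)) + horner_mx A (v * q) = 1.
  by rewrite -rmorphD uv1 rmorph1.
exists (u * 'X^(k.+1)), (u * 'X^k); split.
- by rewrite -[RHS]mulr1 -one mulrDr [X in _ + X]pk addr0.
- by rewrite exprS mulrCA [RHS]rmorphM /= horner_mx_X.
- move=> p0; exists k; rewrite -[A]horner_mx_X -rmorphXn /= -['X^k]mul1r -uv1.
  rewrite mulrDl rmorphD [X in X + _]rmorphM /= p0 mul0r add0r.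
  by rewrite -mulrA rmorphM /= Aq mulr0.
Qed.

Lemma rank_factorisation n (A : 'M[F]_n) : exists r (L : 'M[F]_(n, r)) U B D,
  [/\ r = \rank A, A = L *m U, B *m L = 1%:M & U *m D = 1%:M].
Proof.
have /row_fullP[B BL] := col_base_full A.
have /row_freeP[D UD] := row_base_free A.
by exists (\rank A), (col_base A), (row_base A), B, D; rewrite mulmx_base.
Qed.

(** With P = L U of full rank r, P P = P forces U L = 1, a matrix of size r. *)
Lemma mxtrace_idem n (P : 'M[F]_n) : P *m P = P -> \tr P = (\rank P)%:R.
Proof.
have [r [L [U [B [D [<- -> BL UD]]]]]] := rank_factorisation P.
move=> /(congr1 (fun M => B *m M *m D)).
rewrite /= !mulmxA BL !mul1mx -!mulmxA UD !mulmx1 => UL.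
by rewrite mxtrace_mulC UL mxtrace1.
Qed.

(** A factorisation A = L U through the rank replaces A by U L, which has the same
    trace and a smaller nilpotency order. *)
Lemma mxtrace_nilp n k (A : 'M[F]_n) : A ^+ k = 0 -> \tr A = 0.
Proof.
elim: k n A => [|k IH] n A Ak.
  by rewrite -[A]mulmx1 -[1%:M]/(A ^+ 0) Ak mulmx0 mxtrace0.
have [r [L [U [B [D [_ LU BL UD]]]]]] := rank_factorisation A.
rewrite LU mxtrace_mulC; apply: IH.
have AE j : A ^+ j.+1 = L *m (U *m L) ^+ j *m U.
  elim: j => [|j IHj]; first by rewrite expr1 expr0 mulmx1 LU.
  by rewrite exprS IHj [A in A * _]LU !exprS /GRing.mul /= !mulmxA.
have : B *m A ^+ k.+1 *m D = 0 by rewrite Ak mulmx0 mul0mx.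
by rewrite AE !mulmxA BL mul1mx -!mulmxA UD mulmx1.
Qed.

End Idempotents.

Section WhiteheadOne.
Variables (R : rcfType) (m n : nat).
Variable W : {linear 'cV[R]_m.+1 -> 'M[R]_m.+1}.
Hypotheses (Wlie : lie_tensor W) (Wnd : killing_mx W \in unitmx).
Let K := killing_mx W.
Let Q : 'M[R]_m.+1 := invmx K.
Let q i : 'cV[R]_m.+1 := Q *m ebase i.

(** The Casimir operator being the identity, every element is a sum of brackets. *)
Lemma lie_perfect (x : 'cV[R]_m.+1) : x = \sum_i W (ebase i) *m (W (q i) *m x).
Proof.
rewrite -[LHS]mul1mx -(casimir_adjoint Wlie Wnd) mulmx_suml.
by apply: eq_bigr => i _; rewrite mulmxA.
Qed.

Lemma trace_form0_rep (r : {linear 'cV[R]_m.+1 -> 'M[R]_n.+1}) :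
  lie_rep W r -> trace_form r = 0 -> forall x, r x = 0.
Proof.
move=> rW T0 x; pose U := limg (linfun r).
have UP a : reflect (exists x, a = r x) (a \in U).
  apply: (iffP memv_imgP) => [[y _ ->]|[y ->]]; exists y; rewrite ?lfunE //.
  exact: memvf.
have -> : U = 0%VS -> r x = 0.
  by move=> U0; apply/eqP; rewrite -memv0 -U0; apply/UP; exists x.
  by [].
apply: cartan_criterion.
- move=> a b /UP[y ->] /UP[z ->]; apply/UP; exists (W y *m z).
  by rewrite rW.
- by move=> a b /UP[y ->] /UP[z ->]; rewrite trace_formE T0 mulmx0 mul0mx mxE.
- move=> V UV; apply/subvP => a /UP[y ->]; rewrite [y]lie_perfect linear_sum.
  by apply: rpred_sum => i _; rewrite rW; apply: UV; apply/UP; eexists.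
Qed.

Lemma ad_centroid (S : 'M[R]_m.+1) :
  (forall x, S *m W x = W x *m S) -> forall x, W (S *m x) = S *m W x.
Proof.
move=> SW x; apply: mulmx_cV_inj => y.
by rewrite Wlie.1 mulmxA -SW -!mulmxA [W y *m x]Wlie.1 mulmxN opprK.
Qed.

(** If S commutes with every ad x and S^2 = 0, then ad (S x) ad y has square zero,
    so S x is orthogonal to everything for the Killing form. *)
Lemma centroid_sqr0 (S : 'M[R]_m.+1) :
  (forall x, S *m W x = W x *m S) -> S *m S = 0 -> S = 0.
Proof.
move=> SW SS0; apply: mulmx_cV_inj => x; rewrite mul0mx.
apply: (ad_inj Wnd); apply/eqP; rewrite ad_centroid //; apply/eqP.
suff KS y : \tr (W (S *m x) *m W y) = 0.
  rewrite -ad_centroid //.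
  have : K *m (S *m x) = 0.
    apply/matrixP => i j; rewrite ord1 [RHS]mxE.
    have := KS (ebase i); rewrite mxtrace_mulC trace_formE.
    by rewrite trmx_delta -mulmxA -rowE mxE.
  by move=> /(congr1 (mulmx Q)); rewrite mulmxA mulVmx // mul1mx mulmx0 => ->; rewrite linear0.
apply: (@mxtrace_nilp _ _ 2); rewrite ad_centroid // expr2.
rewrite -[LHS]/(S *m W x *m W y *m (S *m W x *m W y)) !mulmxA.
have -> : S *m W x *m W y *m S = S *m S *m (W x *m W y).
  by rewrite -!mulmxA -[W y *m S]SW [W x *m (S *m _)]mulmxA -SW !mulmxA.
by rewrite SS0 !mul0mx.
Qed.

Lemma centroid_nilp (S : 'M[R]_m.+1) k :
  (forall x, S *m W x = W x *m S) -> S ^+ k = 0 -> S = 0.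
Proof.
move=> SW Sk; have : S ^+ (2 ^ k) = 0.
  by rewrite -(subnK (ltnW (ltn_expl k (ltnSn 1)))) exprD Sk mulr0.
elim: k {Sk} => [|k IH]; first by rewrite expn0 expr1.
rewrite expnSr exprM expr2 => /centroid_sqr0 S0; apply: IH; apply: S0 => x.
elim: (2 ^ k)%N => [|j IHj]; first by rewrite expr0 mulmx1 mul1mx.
by rewrite exprS -mulmxA IHj !mulmxA SW.
Qed.

(** This is H^1(h, V) = 0.  The induction is on the rank of an idempotent [E] that
    commutes with h and carries the cocycle.  If the operator S = K^-1 T comparing
    the trace form T of E V with the Killing form is nilpotent, then S = 0, T = 0
    and h acts trivially on E V by Cartan's criterion, where a cocycle vanishes since
    h is perfect.  Otherwise S is invertible on a nonzero ideal of h, and the Casimir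
    operator C of E V for this ideal has as trace the dimension of the ideal; in
    characteristic zero C is not nilpotent.  The cocycle is a coboundary on the part
    where C is invertible, and the rest has smaller rank. *)
Theorem whitehead1 (r : {linear 'cV[R]_m.+1 -> 'M[R]_n.+1}) (z : 'M[R]_(n.+1, m.+1)) :
    lie_rep W r ->
    (forall x y, z *m (W x *m y) = r x *m (z *m y) - r y *m (z *m x)) ->
  exists v, forall x, z *m x = r x *m v.
Proof.
move=> rW.
have main k (E : 'M[R]_n.+1) (z' : 'M[R]_(n.+1, m.+1)) : (\rank E <= k)%N -> E *m E = E ->
    (forall x, E *m r x = r x *m E) -> E *m z' = z' ->
    (forall x y, z' *m (W x *m y) = r x *m (z' *m y) - r y *m (z' *m x)) ->
    exists v, forall x, z' *m x = r x *m v.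
  elim: k E z' => [|k IH] E z' rkE EE Er Ez zc.
    move: rkE; rewrite leqn0 mxrank_eq0 => /eqP E0.
    by exists 0 => x; rewrite mulmx0 -Ez E0 !mul0mx.
  pose r' x := E *m r x.
  have r'l : linear r' by move=> c x y; rewrite /r' linearP mulmxDr scalemxAr.
  pose rl : {linear 'cV[R]_m.+1 -> 'M[R]_n.+1} := lin_pack r'l.
  have r'W : lie_rep W rl.
    move=> x y; rewrite /= /r' rW mulmxBr -!mulmxA.
    by rewrite [r x *m (E *m _)]mulmxA [r y *m (E *m _)]mulmxA -!Er -!mulmxA !(mulmxA E E) EE.
  pose T := trace_form rl; pose S := Q *m T.
  have SW x : S *m W x = W x *m S.
    have tI := trace_form_invariant x r'W.
    rewrite /S -mulmxA -[T *m W x]opprK -tI mulmxN !mulmxA.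
    by rewrite (casimir_shift Wlie Wnd) mulNmx opprK.
  (* p(S) projects h to the ideal on which S is invertible, with inverse f'. *)
  have [p [f [pp Sf p0]]] := fitting S.
  set P0 := horner_mx S p in pp Sf p0; set f' := horner_mx S f in Sf.
  have [P00|P00] := eqVneq P0 0.
    have [j Sj] := p0 P00; have S0 := centroid_nilp SW Sj.
    have T0 : T = 0 by rewrite -[T]mul1mx -(mulmxV Wnd) -mulmxA -/K -/Q -/S S0 mulmx0.
    have rl0 := trace_form0_rep r'W T0.
    exists 0 => x; rewrite mulmx0 [x]lie_perfect mulmx_sumr big1 // => i _.
    rewrite zc -Ez -!mulmxA !(mulmxA (r _) E) -!Er.
    by rewrite -![E *m r _]/(rl _) !rl0 !mul0mx subr0.
  have f'W x : f' *m W x = W x *m f'.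
    by apply/esym; apply: comm_mx_horner; apply/esym/SW.
  (* The Casimir operator of the form T restricted to that ideal: the matrix f' Q is
     the inverse of T there. *)
  pose C := \sum_i r' (f' *m ebase i) *m r' (q i).
  have fW x y : f' *m (W x *m y) = W x *m (f' *m y) by rewrite mulmxA f'W mulmxA.
  have Er' x : r' x *m E = r' x by rewrite /r' -mulmxA -Er mulmxA EE.
  have rr' x y : r x *m r' y = r' (W x *m y) + r' y *m r x.
    by rewrite /r' rW mulmxBr -!mulmxA subrK !mulmxA -Er.
  pose F1 (Z : lmodType R) (f1 : 'cV[R]_m.+1 -> 'cV[R]_m.+1 -> Z) :=
    fun fl fr x => casimir_invariance Wlie Wnd (f := f1) x fl fr.
  have Cr x : C *m r x = r x *m C.
    pose g (u v : 'cV[R]_m.+1) := r' (f' *m u) *m r' v.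
    have gl v : linear (g^~ v).
      by move=> c u w; rewrite /g mulmxDr -scalemxAr r'l mulmxDl scalemxAl.
    have gr u : linear (g u).
      by move=> c v w; rewrite /g r'l mulmxDr -scalemxAr.
    have inv := F1 _ g gl gr x; rewrite /g -/Q in inv.
    rewrite [RHS]mulmx_sumr.
    transitivity (\sum_i r' (f' *m (W x *m ebase i)) *m r' (q i)
        + \sum_i r' (f' *m ebase i) *m (r x *m r' (q i))).
      rewrite inv addrC -sumrB [LHS]mulmx_suml; apply: eq_bigr => i _.
      by rewrite -mulmxA -mulmxBr rr' addrC addKr.
    rewrite -big_split; apply: eq_bigr => i _ /=.
    by rewrite fW [r x *m (r' (f' *m _) *m _)]mulmxA (rr' x (f' *m _)) mulmxDl -mulmxA.
  have trC : \tr C != 0.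
    have -> : \tr C = \tr P0.
      have -> : P0 = (f'^T *m T *m Q)^T.
        by rewrite !trmx_mul trmxK trmx_inv !trace_form_sym mulmxA.
      rewrite mxtrace_tr [RHS]mxtrace_ebase /C raddf_sum /=; apply: eq_bigr => i _.
      by rewrite -[r' _]/(rl _) -[r' (q i)]/(rl _) trace_formE trmx_mul -!mulmxA.
    by rewrite mxtrace_idem // pnatr_eq0 mxrank_eq0.
  have [p1 [d [PP Cd P1]]] := fitting C.
  set P := horner_mx C p1 in PP Cd P1; set D := horner_mx C d in Cd.
  have P0' : P != 0.
    by apply: contraNneq trC => /P1[j Cj]; rewrite (mxtrace_nilp Cj).
  have Dr x : D *m r x = r x *m D.
    by apply/esym; apply: comm_mx_horner; apply/esym/Cr.
  have Pr x : P *m r x = r x *m P by rewrite -Cd -mulmxA Dr mulmxA Cr mulmxA.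
  have CD : C *m D = D *m C by apply: comm_mx_horner.
  have EC : E *m C = C.
    rewrite mulmx_sumr; apply: eq_bigr => i _; rewrite mulmxA; congr (_ *m _).
    by rewrite /r' mulmxA EE.
  have CE : C *m E = C.
    rewrite mulmx_suml; apply: eq_bigr => i _; rewrite -mulmxA; congr (_ *m _).
    by rewrite Er'.
  have EP : E *m P = P by rewrite -Cd mulmxA EC.
  have PE : P *m E = P by rewrite -Cd CD -mulmxA CE.
  (* P projects to the part of E V on which C is invertible. *)
  have [] := IH (E - P) ((E - P) *m z').
  - have : (\rank (E - P))%:R = \tr E - \tr P :> R.
      rewrite -mxtraceB mxtrace_idem //.
      by rewrite mulmxBl !mulmxBr EE EP PE PP subrr subr0.
    rewrite !mxtrace_idem // => /eqP; rewrite -subr_eq opprK -natrD eqr_nat => /eqP rk.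
    have : (0 < \rank P)%N by rewrite lt0n mxrank_eq0.
    by move=> rP; rewrite -ltnS (leq_trans _ rkE) // -rk -[X in (X < _)%N]addn0 ltn_add2l.
  - by rewrite mulmxBl !mulmxBr EE EP PE PP subrr subr0.
  - by move=> x; rewrite mulmxBl mulmxBr Er Pr.
  - by rewrite mulmxA mulmxBl !mulmxBr EE EP PE PP subrr subr0.
  - move=> x y; rewrite -mulmxA zc mulmxBr ![(E - P) *m (_ *m _)]mulmxA.
    have EPr w : (E - P) *m r w = r w *m (E - P) by rewrite mulmxBl mulmxBr Er Pr.
    by rewrite !EPr -!mulmxA.
  move=> v2 zv2.
  pose g (u v : 'cV[R]_m.+1) := r' (f' *m u) *m (z' *m v).
  have gl v : linear (g^~ v).
    by move=> c u w; rewrite /g mulmxDr -scalemxAr r'l mulmxDl scalemxAl.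
  have gr u : linear (g u).
    by move=> c v w; rewrite /g !mulmxDr -!scalemxAr.
  exists (D *m (\sum_i r' (f' *m ebase i) *m (z' *m q i)) + v2) => x.
  rewrite mulmxDr -zv2 !mulmxA -Dr -!mulmxA.
  have inv := F1 _ g gl gr x; rewrite /g -/Q in inv.
  have -> : r x *m (\sum_i r' (f' *m ebase i) *m (z' *m q i)) = C *m (z' *m x).
    transitivity (\sum_i r' (f' *m (W x *m ebase i)) *m (z' *m q i)
        + \sum_i r' (f' *m ebase i) *m (r x *m (z' *m q i))).
      rewrite -big_split mulmx_sumr; apply: eq_bigr => i _ /=.
      by rewrite mulmxA rr' mulmxDl fW -mulmxA.
    rewrite inv addrC -sumrB mulmx_suml; apply: eq_bigr => i _.
    rewrite -mulmxBr -mulmxA zc opprB addrC subrK; congr (_ *m _).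
    by rewrite -{1}Ez !mulmxA -Er.
  by rewrite mulmxA -CD Cd !mulmxA -mulmxDl -mulmxDl addrC subrK Ez.
move=> zc; apply: (main n.+1 1%:M z) => //; rewrite ?rank_leq_row ?mul1mx //.
by move=> x; rewrite mul1mx mulmx1.
Qed.

End WhiteheadOne.

(** * Pairs of a bracket and a representation *)

Section Brackets.
Variables (F : fieldType) (n : nat).
Implicit Types A B C : 'M[F]_n.

Definition brk A B : 'M[F]_n := A *m B - B *m A.

Lemma brk_jacobi A B C : brk A (brk B C) = brk (brk A B) C + brk B (brk A C).
Proof.
rewrite /brk !mulmxBl !mulmxBr !mulmxA !opprB !addrA.
move: (A *m B *m C) (A *m C *m B) (B *m C *m A) (C *m B *m A) (B *m A *m C) (C *m A *m B).
move=> a b c d e f.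
by rewrite [RHS](ACl (1*8*3*6*(5*2)*(7*4)))/= !subrr !addr0.
Qed.

Lemma brkC A B : brk A B = - brk B A.
Proof. by rewrite /brk opprB. Qed.

Lemma brkDl A B C : brk (A + B) C = brk A C + brk B C.
Proof. by rewrite /brk mulmxDl mulmxDr opprD addrACA. Qed.
Lemma brkDr A B C : brk A (B + C) = brk A B + brk A C.
Proof. by rewrite /brk mulmxDl mulmxDr opprD addrACA. Qed.
Lemma brkNl A B : brk (- A) B = - brk A B.
Proof. by rewrite /brk mulNmx mulmxN opprB opprK addrC. Qed.
Lemma brkNr A B : brk A (- B) = - brk A B.
Proof. by rewrite /brk mulNmx mulmxN opprB opprK addrC. Qed.
Lemma brk_tr A B : (brk A B)^T = - brk A^T B^T.
Proof. by rewrite /brk linearB /= !trmx_mul opprB. Qed.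
Lemma mxtrace_brk A B : \tr (brk A B) = 0.
Proof. by rewrite /brk mxtraceB mxtrace_mulC subrr. Qed.

Lemma islin_brkl (U : lmodType F) (f : U -> 'M[F]_n) B :
  islin f -> islin (fun x => brk (f x) B).
Proof.
by move=> fl c x y; rewrite /brk fl mulmxDl mulmxDr -scalemxAl -scalemxAr scalerBr opprD addrACA.
Qed.
Lemma islin_brkr (U : lmodType F) (f : U -> 'M[F]_n) A :
  islin f -> islin (fun x => brk A (f x)).
Proof.
by move=> fl c x y; rewrite /brk fl mulmxDl mulmxDr -scalemxAl -scalemxAr scalerBr opprD addrACA.
Qed.

End Brackets.

Section Tensor.
Variables (F : fieldType) (n m : nat).

(** A linear map from column vectors to matrices, stored as a matrix whose rows are
    the flattened values on the standard basis. *)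
Definition opm k (T : 'M[F]_(k, n * n)) (v : 'cV[F]_k) : 'M[F]_n := vec_mx (v^T *m T).

Lemma opm_is_linear k (T : 'M[F]_(k, n * n)) : linear (opm T).
Proof. by move=> c x y; rewrite /opm !linearP mulmxDl -scalemxAl linearP. Qed.
HB.instance Definition _ k T :=
  GRing.isLinear.Build F 'cV[F]_k 'M[F]_n _ (opm T) (opm_is_linear T).

Lemma islin_opm (U : lmodType F) k T (f : U -> 'cV[F]_k) :
  islin f -> islin (fun x => opm T (f x)).
Proof. by move=> fl c x y; rewrite fl opm_is_linear. Qed.

(** A pair of linear maps W : R^n -> M_n (a bracket on R^n) and R : R^m -> M_n (a
    representation on R^n), stored as one matrix, so that the topology and the
    Euclidean norm of matrices apply to it. *)
Definition tensor := 'M[F]_(n + m, n * n).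

Definition tW (t : tensor) : 'cV[F]_n -> 'M[F]_n := opm (usubmx t).
Definition tR (t : tensor) : 'cV[F]_m -> 'M[F]_n := opm (dsubmx t).
HB.instance Definition _ t := GRing.Linear.on (tW t).
HB.instance Definition _ t := GRing.Linear.on (tR t).

Lemma islin_tW (U : lmodType F) t (f : U -> 'cV[F]_n) :
  islin f -> islin (fun x => tW t (f x)).
Proof. exact: islin_opm. Qed.
Lemma islin_tR (U : lmodType F) t (f : U -> 'cV[F]_m) :
  islin f -> islin (fun x => tR t (f x)).
Proof. exact: islin_opm. Qed.
Lemma islin_tWt (U : lmodType F) v (f : U -> tensor) :
  islin f -> islin (fun x => tW (f x) v).
Proof. by move=> fl c x y; rewrite fl /tW /opm linearP mulmxDr -scalemxAr linearP. Qed.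
Lemma islin_tRt (U : lmodType F) v (f : U -> tensor) :
  islin f -> islin (fun x => tR (f x) v).
Proof. by move=> fl c x y; rewrite fl /tR /opm linearP mulmxDr -scalemxAr linearP. Qed.

Lemma tWD t s v : tW (t + s) v = tW t v + tW s v.
Proof. exact: (islin_add _ _ (islin_tWt v (@islin_id _ _))). Qed.
Lemma tRD t s v : tR (t + s) v = tR t v + tR s v.
Proof. exact: (islin_add _ _ (islin_tRt v (@islin_id _ _))). Qed.

Lemma tWZ c t v : tW (c *: t) v = c *: tW t v.
Proof. by rewrite /tW /opm linearZ /= -scalemxAr linearZ. Qed.
Lemma tRZ c t v : tR (c *: t) v = c *: tR t v.
Proof. by rewrite /tR /opm linearZ /= -scalemxAr linearZ. Qed.

Lemma tW0 v : tW (0 : tensor) v = 0.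
Proof. by rewrite /tW /opm linear0 mulmx0 linear0. Qed.
Lemma tR0 v : tR (0 : tensor) v = 0.
Proof. by rewrite /tR /opm linear0 mulmx0 linear0. Qed.

Definition mk_tensor (fW : 'cV[F]_n -> 'M[F]_n) (fR : 'cV[F]_m -> 'M[F]_n) : tensor :=
  col_mx (\matrix_i mxvec (fW (ebase i))) (\matrix_a mxvec (fR (ebase a))).

Lemma opm_mk k (f : 'cV[F]_k -> 'M[F]_n) v : islin f ->
  opm (\matrix_i mxvec (f (ebase i))) v = f v.
Proof.
move=> fl; pose g := lin_pack fl; rewrite -[RHS]/(g v) {2}[v]cV_sum_ebase linear_sum.
rewrite /opm mulmx_sum_row linear_sum; apply: eq_bigr => i _.
by rewrite rowK mxE !linearZ /= mxvecK.
Qed.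

Lemma tW_mk fW fR v : islin fW -> tW (mk_tensor fW fR) v = fW v.
Proof. by move=> fl; rewrite /tW col_mxKu opm_mk. Qed.
Lemma tR_mk fW fR v : islin fR -> tR (mk_tensor fW fR) v = fR v.
Proof. by move=> fl; rewrite /tR col_mxKd opm_mk. Qed.

Lemma tensor_ext s t : tW s =1 tW t -> tR s =1 tR t -> s = t.
Proof.
have opmK k (S T : 'M[F]_(k, n * n)) : opm S =1 opm T -> S = T.
  move=> ST; apply/row_matrixP => i; have := ST (ebase i).
  by rewrite /opm trmx_delta -!rowE => /(can_inj vec_mxK).
move=> /opmK eW /opmK eR; by rewrite -[s]vsubmxK -[t]vsubmxK eW eR.
Qed.

Lemma islin_mk (U : lmodType F) fW fR :
    (forall v, islin (fun x : U => fW x v)) -> (forall v, islin (fun x : U => fR x v)) ->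
  islin (fun x : U => mk_tensor (fW x) (fR x)).
Proof.
move=> lW lR c x y; apply/matrixP => i j; rewrite !mxE.
by case: splitP => k _; rewrite !mxE ?lW ?lR linearP !mxE.
Qed.

End Tensor.

(** Proves linearity of an expression by following its syntax. *)
Ltac lin_step := cbv beta; match goal with
  | |- islin (fun x => x) => exact: islin_id
  | |- islin (fun x => @?f x + @?g x) => apply: islinD
  | |- islin (fun x => - @?f x) => apply: islinN
  | |- islin (fun x => brk (@?f x) ?B) => apply: islin_brkl
  | |- islin (fun x => brk ?A (@?f x)) => apply: islin_brkr
  | |- islin (fun x => @?f x *m ?B) => apply: islin_mull
  | |- islin (fun x => ?A *m @?f x) => apply: islin_mulr
  | |- islin (fun x => (@?f x)^T) => apply: islin_tr
  | |- islin (fun x => tW ?t (@?f x)) => apply: islin_tW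
  | |- islin (fun x => tR ?t (@?f x)) => apply: islin_tR
  | |- islin (fun x => tW (@?f x) ?v) => apply: islin_tWt
  | |- islin (fun x => tR (@?f x) ?v) => apply: islin_tRt
  | |- islin (fun x => opm ?T (@?f x)) => apply: islin_opm
  | |- islin (fun x => 0) => exact: islin_cst0
  | |- islin _ => apply: islin_comp
  end.

Ltac lin := repeat lin_step.

Lemma bilin_ebase (F : fieldType) k l (Z : lmodType F)
    (f : 'cV[F]_k -> 'cV[F]_l -> Z) :
    (forall v, islin (f^~ v)) -> (forall u, islin (f u)) ->
  (forall i j, f (ebase i) (ebase j) = 0) -> forall u v, f u v = 0.
Proof.
move=> fl fr f0 u v; rewrite [v]cV_sum_ebase -[LHS]/(lin_pack (fr u) _) linear_sum.
rewrite big1 // => j _; rewrite linearZ /= [u]cV_sum_ebase.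
rewrite -[f _ _]/(lin_pack (fl (ebase j)) _) linear_sum big1 ?scaler0 // => i _.
by rewrite linearZ /= f0 scaler0.
Qed.

(** * The deformation complex of a pair *)

Lemma whitehead1_gen (R : rcfType) m n (W : {linear 'cV[R]_m -> 'M[R]_m}) :
    lie_tensor W -> killing_mx W \in unitmx ->
  forall (r : {linear 'cV[R]_m -> 'M[R]_n}) (z : 'M[R]_(n, m)), lie_rep W r ->
    (forall x y, z *m (W x *m y) = r x *m (z *m y) - r y *m (z *m x)) ->
  exists v, forall x, z *m x = r x *m v.
Proof.
case: n => [|n]; first by move=> _ _ r z _ _; exists 0 => x; rewrite [LHS]flatmx0 [RHS]flatmx0.
case: m W => [|m] W Wl Wn r z; last exact: whitehead1.
by move=> _ _; exists 0 => x; rewrite [x]flatmx0 !mulmx0.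
Qed.

Lemma linear_factor (F : fieldType) k n (W : {linear 'cV[F]_n -> 'M[F]_n})
    (f : 'cV[F]_k -> 'M[F]_n) : islin f ->
    (forall i, exists u, f (ebase i) = W u) ->
  exists Z : 'M[F]_(n, k), forall w, f w = W (Z *m w).
Proof.
move=> fl /fin_all_exists[z0 z0P]; exists (\matrix_(j, i) z0 i j 0) => w.
apply/eqP; rewrite -subr_eq0; apply/eqP.
have gl : islin (fun w => f w - W ((\matrix_(j, i) z0 i j 0) *m w)) by lin.
rewrite -[LHS]/(lin_pack gl w) [w]cV_sum_ebase linear_sum big1 // => i _.
rewrite linearZ /= z0P mulmx_ebase.
suff -> : col i (\matrix_(j, i) z0 i j 0) = z0 i by rewrite subrr scaler0.
by apply/matrixP => j l; rewrite !mxE ord1.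
Qed.

Section Deformation.
Variables (R : rcfType) (n m : nat).
Variable Wh : {linear 'cV[R]_m -> 'M[R]_m}.
Local Notation tensor := (tensor R n m).
Implicit Types (t p x y : tensor) (a b : 'M[R]_n).

(** A Lie algebra structure on R^n with an action of (R^m, [Wh]) by derivations. *)
Definition lie_pair t : Prop :=
  [/\ lie_tensor (tW t),
      forall u v, tW t (tR t u *m v) = brk (tR t u) (tW t v) &
      lie_rep Wh (tR t)].

(** The values, on pairs of basis vectors, of the four families of equations that
    define [lie_pair]: antisymmetry, the Jacobi identity, the derivation property and
    the representation property. *)
Definition equations : Type :=
  {ffun 'I_n * 'I_n -> 'cV[R]_n} * {ffun 'I_n * 'I_n -> 'M[R]_n} *
  {ffun 'I_m * 'I_n -> 'M[R]_n} * {ffun 'I_m * 'I_m -> 'M[R]_n}.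
HB.instance Definition _ := Vector.on equations.

Definition eqn_lin x : equations :=
  ([ffun ij => tW x (ebase ij.1) *m ebase ij.2 + tW x (ebase ij.2) *m ebase ij.1],
   0, 0, [ffun ab => tR x (Wh (ebase ab.1) *m ebase ab.2)]).

(** The quadratic part of the equations, as the diagonal of a bilinear map. *)
Definition eqn_quad x y : equations :=
  (0,
   [ffun ij => tW x (tW y (ebase ij.1) *m ebase ij.2)
               - brk (tW x (ebase ij.1)) (tW y (ebase ij.2))],
   [ffun aj => tW x (tR y (ebase aj.1) *m ebase aj.2)
               - brk (tR y (ebase aj.1)) (tW x (ebase aj.2))],
   [ffun ab => - brk (tR x (ebase ab.1)) (tR y (ebase ab.2))]).

Lemma islin_pair (U : lmodType R) (V1 V2 : lmodType R) (f : U -> V1) (g : U -> V2) :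
  islin f -> islin g -> islin (fun u => (f u, g u)).
Proof. by move=> fl gl c u v; rewrite fl gl. Qed.

Lemma islin_pair4 (U : lmodType R) (V1 V2 V3 V4 : lmodType R)
    (f1 : U -> V1) (f2 : U -> V2) (f3 : U -> V3) (f4 : U -> V4) :
  islin f1 -> islin f2 -> islin f3 -> islin f4 -> islin (fun u => (f1 u, f2 u, f3 u, f4 u)).
Proof. by move=> *; do 3![apply: islin_pair => //]. Qed.

Lemma islin_ffun (U : lmodType R) (I : finType) (V : lmodType R) (f : U -> I -> V) :
  (forall i, islin (f^~ i)) -> islin (fun u => [ffun i => f u i]).
Proof. by move=> fl c u v; apply/ffunP => i; rewrite !ffunE fl. Qed.

Lemma eqn_lin_linear : islin eqn_lin.
Proof.
by apply: islin_pair4; [apply: islin_ffun => i; lin | exact: islin_cst0 |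
  exact: islin_cst0 | apply: islin_ffun => i; lin].
Qed.
Lemma eqn_quad_linearl y : islin (eqn_quad^~ y).
Proof.
by apply: islin_pair4; [exact: islin_cst0 | apply: islin_ffun => i; lin |
  apply: islin_ffun => i; lin | apply: islin_ffun => i; lin].
Qed.
Lemma eqn_quad_linearr x : islin (eqn_quad x).
Proof.
by apply: islin_pair4; [exact: islin_cst0 | apply: islin_ffun => i; lin |
  apply: islin_ffun => i; lin | apply: islin_ffun => i; lin].
Qed.

Lemma pair_add_eq0 (V1 V2 : zmodType) (x y : V1 * V2) :
  x + y = 0 <-> x.1 + y.1 = 0 /\ x.2 + y.2 = 0.
Proof.
split=> [xy0|[e1 e2]]; last by rewrite [LHS]surjective_pairing /= e1 e2.
by split; [have := congr1 fst xy0 | have := congr1 snd xy0].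
Qed.

Lemma equations_eq0 (X Y : equations) : X + Y = 0 <->
  [/\ X.1.1.1 + Y.1.1.1 = 0, X.1.1.2 + Y.1.1.2 = 0, X.1.2 + Y.1.2 = 0 & X.2 + Y.2 = 0].
Proof.
split=> [/pair_add_eq0[/pair_add_eq0[/pair_add_eq0[e1 e2] e3] e4] // | [e1 e2 e3 e4]].
by do 3![apply/pair_add_eq0; split=> //].
Qed.

Lemma lie_pair_eqn t : lie_pair t <-> eqn_lin t + eqn_quad t t = 0.
Proof.
split.
  case=> [[ta tb] td tr]; apply/equations_eq0; split; apply/ffunP => -[i j]; rewrite !ffunE /=.
  - by rewrite ta addr0 addNr.
  - by rewrite add0r tb subrr.
  - by rewrite add0r td subrr.
  - by rewrite tr subrr.
move=> /equations_eq0[/ffunP e1 /ffunP e2 /ffunP e3 /ffunP e4].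
split; first split.
- move=> u v; apply/eqP; rewrite -addr_eq0; apply/eqP; move: u v.
  apply: bilin_ebase => [v|u|i j]; [lin|lin|].
  by have := e1 (i, j); rewrite !ffunE addr0.
- move=> u v; apply/eqP; rewrite -subr_eq0; apply/eqP; move: u v.
  apply: bilin_ebase => [v|u|i j]; [lin|lin|].
  by have := e2 (i, j); rewrite !ffunE add0r.
- move=> u v; apply/eqP; rewrite -subr_eq0; apply/eqP; move: u v.
  apply: bilin_ebase => [v|u|i j]; [lin|lin|].
  by have := e3 (i, j); rewrite !ffunE add0r.
- move=> u v; apply/eqP; rewrite -subr_eq0; apply/eqP; move: u v.
  apply: bilin_ebase => [v|u|i j]; [lin|lin|].
  by have := e4 (i, j); rewrite !ffunE.
Qed.

Variable p : tensor.

(** The derivative at the identity of the action of GL_n on [p]. *)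
Definition d0 b : tensor :=
  mk_tensor (fun v => brk b (tW p v) - tW p (b *m v)) (fun w => brk b (tR p w)).

Lemma d0W b v : tW (d0 b) v = brk b (tW p v) - tW p (b *m v).
Proof. by rewrite tW_mk //; lin. Qed.
Lemma d0R b (w : 'cV_m) : tR (d0 b) w = brk b (tR p w).
Proof. by rewrite tR_mk //; lin. Qed.
Lemma d0_linear : islin d0.
Proof. by apply: islin_mk => v; lin. Qed.

(** The linearisation of the equations at [p]. *)
Definition d1 x : equations := eqn_lin x + (eqn_quad p x + eqn_quad x p).
Lemma d1_linear : islin d1.
Proof.
apply: islinD; first exact: eqn_lin_linear.
by apply: islinD; [exact: eqn_quad_linearr | exact: eqn_quad_linearl].
Qed.

Lemma d1P (x : tensor) : d1 x = 0 ->
  [/\ forall u v : 'cV_n, tW x u *m v = - (tW x v *m u),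
      forall u v : 'cV_n, tW x (tW p u *m v) + tW p (tW x u *m v)
         = brk (tW p u) (tW x v) + brk (tW x u) (tW p v),
      forall (u : 'cV_m) (v : 'cV_n), tW x (tR p u *m v) + tW p (tR x u *m v)
         = brk (tR p u) (tW x v) + brk (tR x u) (tW p v) &
      forall u v : 'cV_m, tR x (Wh u *m v) = brk (tR p u) (tR x v) + brk (tR x u) (tR p v)].
Proof.
move=> /equations_eq0[/ffunP e1 /ffunP e2 /ffunP e3 /ffunP e4].
split.
- move=> u v; apply/eqP; rewrite -addr_eq0; apply/eqP; move: u v.
  apply: bilin_ebase => [v|u|i j]; [lin|lin|].
  by have := e1 (i, j); rewrite !ffunE !addr0.
- move=> u v; apply/eqP; rewrite -subr_eq0; apply/eqP; move: u v.
  apply: bilin_ebase => [v|u|i j]; [lin|lin|].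
  by have := e2 (i, j); rewrite !ffunE add0r addrACA -opprD [X in X - _]addrC.
- move=> u v; apply/eqP; rewrite -subr_eq0; apply/eqP; move: u v.
  apply: bilin_ebase => [v|u|i j]; [lin|lin|].
  have := e3 (i, j); rewrite !ffunE add0r addrACA -opprD [X in X - _]addrC.
  by rewrite [X in _ - X]addrC.
- move=> u v; apply/eqP; rewrite -subr_eq0; apply/eqP; move: u v.
  apply: bilin_ebase => [v|u|i j]; [lin|lin|].
  by have := e4 (i, j); rewrite !ffunE -opprD.
Qed.

Hypotheses (Whl : lie_tensor Wh) (Whn : killing_mx Wh \in unitmx).
Hypotheses (pg : lie_pair p) (pn : killing_mx (tW p) \in unitmx).

(** Every infinitesimal deformation comes from a change of basis.  After subtracting
    the change of basis that accounts for the bracket (H^2(g, g) = 0), the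
    deformation f of the representation consists of derivations of g, which are
    inner: f w = ad (z w).  The map z is a cocycle of h with values in g, hence
    z w = R(w) v (H^1(h, g) = 0), and the inner derivation by v, which does not
    change the bracket, accounts for f. *)
Lemma d_exact x : d1 x = 0 -> exists b, x = d0 b.
Proof.
case: pg => [Wl Wd Rr] /d1P[xa x2 x3 x4].
have [a aP] := whitehead2_adjoint Wl pn xa x2.
have WxE u : tW x u = - brk a (tW p u) + tW p (a *m u).
  by rewrite aP /brk opprB [RHS]addrC addrA.
pose f w := tR x w + brk a (tR p w).
have fl : islin f by rewrite /f; lin.
have zmod_key (B A1 A2 C J1 J2 J3 : 'M[R]_n) :
    - J1 + A1 + B = - J2 + A2 + C -> J1 = J3 + J2 -> B + (A1 - A2) = C + J3.
  move=> /eqP e eJ; apply/eqP; move: e; rewrite -subr_eq0 -[X in _ -> is_true X]subr_eq0 eJ.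
  rewrite !opprD !opprK !addrA => /eqP <-.
  by rewrite [eqbRHS](ACl (4*3*6*7*1*(2*5)))/= addNr addr0.
have fder w v : tW p (f w *m v) = brk (f w) (tW p v).
  have x3wv := x3 w v; rewrite !WxE brkDr brkNr -[brk _ (tW p (a *m v))]Wd in x3wv.
  rewrite /f mulmxDl linearD /= brkDl [brk a _ *m v]mulmxBl linearB /= -!mulmxA.
  by apply: (zmod_key _ _ _ _ _ _ _ x3wv); rewrite Wd brk_jacobi.
have [z zP] : exists z : 'M[R]_(n, m), forall w, f w = tW p (z *m w).
  apply: (linear_factor (W := tW p) fl) => i.
  by apply: (derivation_inner Wl pn) => v; rewrite [RHS]fder.
have fcoc u v : f (Wh u *m v) = brk (tR p u) (f v) + brk (f u) (tR p v).
  rewrite /f x4 Rr -/(brk _ _) brk_jacobi brkDl brkDr.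
  by rewrite [brk (brk a _) _ + _]addrC addrACA.
have zc u v : z *m (Wh u *m v) = tR p u *m (z *m v) - tR p v *m (z *m u).
  apply/eqP; rewrite -subr_eq0; apply/eqP; apply: (ad_inj pn).
  rewrite linearB linearB /= -zP fcoc !zP !Wd [brk (tW p _) _]brkC.
  by rewrite subrr.
have [v vP] := whitehead1_gen Whl Whn Rr zc.
exists (- a - tW p v); apply: tensor_ext => u.
  rewrite d0W WxE brkDl !brkNl mulmxBl mulNmx !linearB linearN /= opprK.
  rewrite Wl.2 -/(brk _ _) opprB -!addrA; do 2!congr (_ + _).
  by rewrite !opprK opprB !addrA [RHS](ACl (3*(1*4)*(2*5)))/= addNr subrr !addr0.
rewrite d0R brkDl !brkNl -[LHS](addrK (brk a (tR p u))) -/(f u) zP vP Wd addrC.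
by rewrite [brk (tW p v) _]brkC opprK.
Qed.

End Deformation.

(** * An entrywise norm on matrices *)

Section EntrywiseNorm.
Variable R : realFieldType.

Definition nrm p q (A : 'M[R]_(p, q)) : R := \sum_i \sum_j `|A i j|.

Lemma nrm_ge0 p q (A : 'M[R]_(p, q)) : 0 <= nrm A.
Proof. by do 2!apply: sumr_ge0 => ? _. Qed.

Lemma entry_le_nrm p q (A : 'M[R]_(p, q)) i j : `|A i j| <= nrm A.
Proof.
rewrite /nrm (bigD1 i) //= (bigD1 j) //= -addrA lerDl addr_ge0 //.
  exact: sumr_ge0.
by do 2!apply: sumr_ge0 => ? _.
Qed.

Lemma nrm_eq0 p q (A : 'M[R]_(p, q)) : nrm A = 0 -> A = 0.
Proof.
move=> A0; apply/matrixP => i j; rewrite mxE; apply/eqP.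
by rewrite -normr_le0 -A0 entry_le_nrm.
Qed.

Lemma nrm0 p q : nrm (0 : 'M[R]_(p, q)) = 0.
Proof. by do 2![rewrite /nrm big1 // => ? _]; rewrite mxE normr0. Qed.

Lemma nrmD p q (A B : 'M[R]_(p, q)) : nrm (A + B) <= nrm A + nrm B.
Proof.
rewrite /nrm -big_split; apply: ler_sum => i _; rewrite -big_split /=.
by apply: ler_sum => j _; rewrite mxE ler_normD.
Qed.

Lemma nrmN p q (A : 'M[R]_(p, q)) : nrm (- A) = nrm A.
Proof. by do 2!apply: eq_bigr => ? _; rewrite mxE normrN. Qed.

Lemma nrmB p q (A B : 'M[R]_(p, q)) : nrm (A - B) <= nrm A + nrm B.
Proof. by rewrite (le_trans (nrmD _ _)) // nrmN. Qed.

Lemma nrmBC p q (A B : 'M[R]_(p, q)) : nrm (A - B) = nrm (B - A).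
Proof. by rewrite -nrmN opprB. Qed.

Lemma nrmZ p q c (A : 'M[R]_(p, q)) : nrm (c *: A) = `|c| * nrm A.
Proof.
rewrite /nrm mulr_sumr; apply: eq_bigr => i _; rewrite mulr_sumr.
by apply: eq_bigr => j _; rewrite mxE normrM.
Qed.

Lemma nrm_sum p q (I : finType) (A : I -> 'M[R]_(p, q)) :
  nrm (\sum_i A i) <= \sum_i nrm (A i).
Proof.
elim/big_rec2: _ => [|i x y _ h]; first by rewrite nrm0.
by rewrite (le_trans (nrmD _ _)) // lerD2l.
Qed.

Lemma nrm_mul p q r (A : 'M[R]_(p, q)) (B : 'M[R]_(q, r)) :
  nrm (A *m B) <= nrm A * nrm B.
Proof.
rewrite [X in X * _]/nrm mulr_suml; apply: ler_sum => i _; rewrite mulr_suml.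
apply: le_trans (_ : \sum_j \sum_k `|A i k| * `|B k j| <= _).
  apply: ler_sum => j _; rewrite mxE (le_trans (ler_norm_sum _ _ _)) //.
  by apply: ler_sum => k _; rewrite normrM.
rewrite exchange_big; apply: ler_sum => k _; rewrite -mulr_sumr ler_wpM2l //.
rewrite /nrm [leRHS](bigD1 k) //= lerDl.
by do 2!apply: sumr_ge0 => ? _.
Qed.

Lemma nrm_mxvec p q (A : 'M[R]_(p, q)) : nrm (mxvec A) = nrm A.
Proof.
rewrite /nrm big_ord1 (reindex _ (curry_mxvec_bij _ _)) /= pair_bigA /=.
by apply: eq_bigr => -[i j] _; rewrite mxvecE.
Qed.

Lemma nrm_vec_mx p q (v : 'rV[R]_(p * q)) : nrm (vec_mx v) = nrm v.
Proof. by rewrite -nrm_mxvec vec_mxK. Qed.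

Lemma nrm_tr p q (A : 'M[R]_(p, q)) : nrm A^T = nrm A.
Proof.
by rewrite /nrm exchange_big; do 2!apply: eq_bigr => ? _; rewrite mxE.
Qed.

Lemma nrm_rows p q (A : 'M[R]_(p, q)) : nrm A = \sum_i nrm (row i A).
Proof. by apply: eq_bigr => i _; rewrite /nrm big_ord1; apply: eq_bigr => j _; rewrite mxE. Qed.

Lemma nrm_col_mx p1 p2 q (A : 'M[R]_(p1, q)) (B : 'M[R]_(p2, q)) :
  nrm (col_mx A B) = nrm A + nrm B.
Proof.
by rewrite /nrm big_split_ord; congr (_ + _); do 2!apply: eq_bigr => ? _;
  rewrite ?col_mxEu ?col_mxEd.
Qed.

Lemma nrm_ebase n (i : 'I_n) : nrm (ebase i : 'cV[R]_n) = 1.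
Proof.
rewrite -nrm_tr trmx_delta /nrm big_ord1 (bigD1 i) //= mxE !eqxx normr1.
by rewrite big1 ?addr0 // => j /negbTE ji; rewrite mxE ji andbF normr0.
Qed.

Lemma nrm_1 n : nrm (1%:M : 'M[R]_n) = n%:R.
Proof.
rewrite nrm_rows (eq_bigr (fun=> 1)) ?sumr_const ?card_ord // => i _.
by rewrite row1 -(nrm_ebase i) -nrm_tr trmx_delta.
Qed.

Lemma linear_bounded p q p' q' (f : 'M[R]_(p, q) -> 'M[R]_(p', q')) :
  islin f -> exists2 C, 0 < C & forall x, nrm (f x) <= C * nrm x.
Proof.
move=> fl; pose C := \sum_i \sum_j nrm (f (delta_mx i j)).
have C0 : 0 <= C by do 2!apply: sumr_ge0 => ? _; apply: nrm_ge0.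
exists (C + 1); first by rewrite ltr_wpDl.
move=> x; apply: le_trans (_ : C * nrm x <= _); last first.
  by rewrite ler_wpM2r ?nrm_ge0 // lerDl.
rewrite {1}(matrix_sum_delta x) -[f _]/(lin_pack fl _) linear_sum.
rewrite (le_trans (nrm_sum _)) // mulr_suml ler_sum // => i _.
rewrite linear_sum (le_trans (nrm_sum _)) // mulr_suml ler_sum // => j _.
by rewrite linearZ /= nrmZ mulrC ler_wpM2l ?nrm_ge0 ?entry_le_nrm.
Qed.

Lemma bilinear_bounded p q p1 q1 p' q'
    (f : 'M[R]_(p, q) -> 'M[R]_(p1, q1) -> 'M[R]_(p', q')) :
    (forall y, islin (f^~ y)) -> (forall x, islin (f x)) ->
  exists2 C, 0 < C & forall x y, nrm (f x y) <= C * nrm x * nrm y.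
Proof.
move=> fl fr.
have /fin_all_exists2[c c0 cP] : forall ij : 'I_p * 'I_q, exists2 C, 0 < C &
    forall y, nrm (f (delta_mx ij.1 ij.2) y) <= C * nrm y.
  by move=> ij; apply: linear_bounded.
pose C := \sum_ij c ij.
have C0 : 0 <= C by apply: sumr_ge0 => ij _; apply: ltW.
exists (C + 1); first by rewrite ltr_wpDl.
move=> x y; apply: le_trans (_ : C * nrm x * nrm y <= _); last first.
  by rewrite ler_wpM2r ?nrm_ge0 // ler_wpM2r ?nrm_ge0 // lerDl.
rewrite {1}(matrix_sum_delta x) pair_bigA -[f _ y]/(lin_pack (fl y) _) linear_sum.
rewrite (le_trans (nrm_sum _)) // !mulr_suml ler_sum // => ij _.
rewrite linearZ /= nrmZ mulrAC mulrC ler_pM ?nrm_ge0 ?entry_le_nrm //.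
Qed.

(** A kernel vector k of a satisfies k = k (1 - a), hence |k| <= |k| / 2.  The
    constant n is the norm of the identity matrix. *)
Lemma near1_unitmx n (a : 'M[R]_n) : nrm (a - 1%:M) <= 1 / 2 ->
  a \in unitmx /\ nrm (invmx a) <= 2 * n%:R.
Proof.
move=> a1; have au : a \in unitmx.
  rewrite -row_free_unit -kermx_eq0; apply/eqP/nrm_eq0/eqP.
  set k := kermx a; have : k = k *m (1%:M - a) by rewrite mulmxBr mulmx1 mulmx_ker subr0.
  move=> /(congr1 (@nrm _ _)) kk; have := nrm_mul k (1%:M - a).
  rewrite -kk nrmBC.
  have := nrm_ge0 k; move: (nrm k) (nrm (a - 1%:M)) a1 => x y *.
  rewrite eq_le; apply/andP; split=> //; nra.
split=> //; have : invmx a = 1%:M + (1%:M - a) *m invmx a.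
  by rewrite mulmxBl mul1mx mulmxV // addrC subrK.
move=> /(congr1 (@nrm _ _)) e.
have : nrm (invmx a) <= n%:R + nrm (a - 1%:M) * nrm (invmx a).
  rewrite {1}e (le_trans (nrmD _ _)) // nrm_1 lerD2l (le_trans (nrm_mul _ _)) //.
  by rewrite nrmBC.
have := nrm_ge0 (invmx a); move: (nrm (invmx a)) (nrm (a - 1%:M)) a1 => x y *.
nra.
Qed.

Section TensorNorm.
Variables (n m : nat).
Implicit Types t : tensor R n m.

Lemma nrm_opm k (T : 'M[R]_(k, n * n)) v : nrm (opm T v) <= nrm T * nrm v.
Proof. by rewrite /opm nrm_vec_mx (le_trans (nrm_mul _ _)) // nrm_tr mulrC. Qed.

Lemma nrm_tW t v : nrm (tW t v) <= nrm t * nrm v.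
Proof.
rewrite (le_trans (nrm_opm _ _)) // ler_wpM2r ?nrm_ge0 //.
by rewrite -[t in leRHS]vsubmxK nrm_col_mx lerDl nrm_ge0.
Qed.

Lemma nrm_tR t v : nrm (tR t v) <= nrm t * nrm v.
Proof.
rewrite (le_trans (nrm_opm _ _)) // ler_wpM2r ?nrm_ge0 //.
by rewrite -[t in leRHS]vsubmxK nrm_col_mx lerDr nrm_ge0.
Qed.

Lemma nrm_mk fW fR (c : R) :
    (forall i : 'I_n, nrm (fW (ebase i)) <= c) ->
    (forall a : 'I_m, nrm (fR (ebase a)) <= c) ->
  nrm (mk_tensor fW fR) <= (n + m)%:R * c.
Proof.
move=> cW cR; rewrite nrm_col_mx natrD mulrDl; apply: lerD.
  rewrite nrm_rows; apply: le_trans (_ : \sum_(i < n) c <= _); last first.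
    by rewrite sumr_const card_ord mulr_natl.
  by apply: ler_sum => i _; rewrite rowK nrm_mxvec.
rewrite nrm_rows; apply: le_trans (_ : \sum_(i < m) c <= _); last first.
  by rewrite sumr_const card_ord mulr_natl.
by apply: ler_sum => i _; rewrite rowK nrm_mxvec.
Qed.

Lemma nrm_tensor_le t (c : R) :
    (forall i : 'I_n, nrm (tW t (ebase i)) <= c) ->
    (forall a : 'I_m, nrm (tR t (ebase a)) <= c) ->
  nrm t <= (n + m)%:R * c.
Proof.
move=> cW cR; suff -> : t = mk_tensor (tW t) (tR t) by apply: nrm_mk.
by apply: tensor_ext => v; rewrite ?tW_mk ?tR_mk //; lin.
Qed.

End TensorNorm.
End EntrywiseNorm.

(** * Quadratic improvement of approximate conjugacies *)

Section Improvement.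
Variables (R : rcfType) (n m : nat).
Variable Wh : {linear 'cV[R]_m -> 'M[R]_m}.
Local Notation tensor := (tensor R n m).
Implicit Types (t p x y : tensor) (a b : 'M[R]_n).

(** Measures how far [a] is from carrying [t] to [p]; written without the inverse of
    [a], it is polynomial in [a]. *)
Definition defect p t a : tensor :=
  mk_tensor (fun v => a *m tW t v - tW p (a *m v) *m a) (fun w => a *m tR t w - tR p w *m a).

Lemma defectW p t a v : tW (defect p t a) v = a *m tW t v - tW p (a *m v) *m a.
Proof. by rewrite tW_mk //; lin. Qed.
Lemma defectR p t a w : tR (defect p t a) w = a *m tR t w - tR p w *m a.
Proof. by rewrite tR_mk //; lin. Qed.

Definition intertwines p t a : Prop :=
  (forall v, a *m tW t v = tW p (a *m v) *m a) /\
  (forall w, a *m tR t w = tR p w *m a).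

Lemma defect_eq0 p t a : defect p t a = 0 -> intertwines p t a.
Proof.
move=> d0; split=> v; apply/eqP; rewrite -subr_eq0 -?defectW -?defectR d0.
  by rewrite tW0.
by rewrite tR0.
Qed.

Lemma lie_pair_conj t p a : a \in unitmx -> intertwines p t a -> lie_pair Wh t -> lie_pair Wh p.
Proof.
move=> au [aW aR] [[ta tb] td tr].
have pW u : tW p u = a *m tW t (invmx a *m u) *m invmx a.
  by rewrite aW mulmxA mulmxV // mul1mx mulmxK.
have pR w : tR p w = a *m tR t w *m invmx a by rewrite aR mulmxK.
have brk_conj A B : brk (a *m A *m invmx a) (a *m B *m invmx a) = a *m brk A B *m invmx a.
  by rewrite /brk mulmxBr mulmxBl !mulmxA !mulmxKV.
split; first split.
- by move=> u v; rewrite !pW -!mulmxA ta mulmxN.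
- move=> u v; rewrite -/(brk _ _) !pW brk_conj /brk -tb.
  by rewrite -!mulmxA mulKmx.
- move=> w v; rewrite !pW !pR brk_conj -td.
  by rewrite -!mulmxA mulKmx.
- by move=> u v; rewrite -/(brk _ _) !pR brk_conj tr.
Qed.

Variable p : tensor.
Hypotheses (Whl : lie_tensor Wh) (Whn : killing_mx Wh \in unitmx).
Hypotheses (pg : lie_pair Wh p) (pn : killing_mx (tW p) \in unitmx).

(** If p and p + x both satisfy the equations, then d1 x = - Q(x, x) is quadratically
    small.  Correcting x by a linear partial inverse of d1 makes it an exact solution
    of the linearised equations, hence a coboundary, up to an error quadratic in x. *)
Lemma approximate_coboundary : exists2 C, 0 < C & forall x, lie_pair Wh (p + x) ->
  exists b, nrm b <= C * nrm x /\ nrm (x + d0 p b) <= C * nrm x * nrm x.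
Proof.
pose D0 := linfun (lin_pack (@d0_linear R n m p)).
pose D1 := linfun (lin_pack (@d1_linear R n m Wh p)).
pose S0 : tensor -> 'M[R]_n := fun x => (D0^-1)%VF (x - (D1^-1)%VF (D1 x)).
have S0l : islin S0.
  move=> c x y; rewrite /S0 -linearP; congr (_ _).
  by rewrite linearP linearP scalerBr opprD addrACA.
pose S1 x y : tensor := (D1^-1)%VF (eqn_quad x y).
have S1l y : islin (S1^~ y).
  by move=> c u v; rewrite /S1 eqn_quad_linearl linearP.
have S1r x : islin (S1 x).
  by move=> c u v; rewrite /S1 eqn_quad_linearr linearP.
have [C0 C0p C0P] := linear_bounded S0l.
have [C1 C1p C1P] := bilinear_bounded S1l S1r.
exists (C0 + C1); first exact: addr_gt0.
move=> x pxg; exists (- S0 x); split.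
  by rewrite nrmN (le_trans (C0P x)) // ler_wpM2r ?nrm_ge0 // lerDl ltW.
have D1x : D1 x = - eqn_quad x x.
  have zmod_key (V : zmodType) (L1 L2 q1 q2 q3 q4 : V) : L1 + q1 = 0 ->
      L1 + L2 + (q1 + q3 + (q2 + q4)) = 0 -> L2 + (q3 + q2) = - q4.
    move=> e1 e2; apply/eqP; rewrite -addr_eq0 -[0]e2 -[eqbLHS]add0r -e1 !addrA.
    by rewrite [eqbLHS](ACl (1*3*2*4*5*6))/=.
  have /lie_pair_eqn : lie_pair Wh p := pg; have /lie_pair_eqn := pxg.
  rewrite (islin_add _ _ (eqn_lin_linear Wh)) (islin_add _ _ (eqn_quad_linearl _)).
  rewrite !(islin_add _ _ (eqn_quad_linearr _)) lfunE /= /d1 => e2 e1.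
  exact: zmod_key e1 e2.
have y0 : D1 (x - (D1^-1)%VF (D1 x)) = 0.
  by rewrite linearB /= limg_lfunVK ?memv_img ?memvf ?subrr.
have : x - (D1^-1)%VF (D1 x) \in limg D0.
  have := y0; rewrite lfunE /= => /(d_exact Whl Whn pg pn)[b ->].
  by apply/memv_imgP; exists b; rewrite ?memvf ?lfunE.
move=> /limg_lfunVK; rewrite -/(S0 x) lfunE /= => S0x.
have -> : x + d0 p (- S0 x) = - S1 x x.
  rewrite -[d0 p _]/(lin_pack (@d0_linear R n m p) _) linearN /= S0x D1x.
  by rewrite linearN /= opprD opprK addrA subrr sub0r.
rewrite nrmN (le_trans (C1P x x)) // -!mulrA ler_wpM2r ?mulr_ge0 ?nrm_ge0 //.
by rewrite lerDr ltW.
Qed.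

(** One Newton step.  Let x be such that a carries t to p + x; then x is comparable to
    the defect of a.  With b as in [approximate_coboundary], replacing a by (1 + b) a
    makes the defect quadratically small. *)
Lemma improvement : exists2 C, 0 < C & forall t a, lie_pair Wh t ->
    nrm (a - 1%:M) <= 1 / 2 -> nrm (defect p t a) <= 1 ->
  exists b, nrm b <= C * nrm (defect p t a) /\
    nrm (defect p t ((1%:M + b) *m a)) <= C * nrm (defect p t a) * nrm (defect p t a).
Proof.
have [C0 C0p C0P] := approximate_coboundary.
pose N : R := n%:R + 1; pose k : R := 2 * n%:R + 1; pose M : R := (n + m)%:R + 1.
have n0 : (0 : R) <= n%:R by apply: ler0n.
have M1 : 1 <= M by rewrite lerDr ler0n.
pose C1 := M * (k * k).
have k0 : 0 < k by rewrite /k; lra.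
have k1 : 1 <= k by rewrite /k; lra.
have N0 : 0 < N by rewrite /N; lra.
have C10 : 0 < C1 by rewrite /C1 !mulr_gt0 //; lra.
have b_ge0 := nrm_ge0 p; set np := nrm p in b_ge0.
pose C2 := C0 * C1.
pose C3 := M * ((C0 * C1 * C1 * N + C2 * C1 * N + np * C2 * N * C2) * N).
have C20 : 0 < C2 by rewrite mulr_gt0.
have C30 : 0 <= C3.
  have M0 := ltW (lt_le_trans ltr01 M1); have N0' := ltW N0.
  have C0' := ltW C0p; have C1' := ltW C10; have C2' := ltW C20.
  by rewrite /C3; repeat first [done | apply: addr_ge0 | apply: mulr_ge0].
exists (C2 + C3); first by rewrite ltr_wpDr.
move=> t a tg a1 d1; have [au ai] := near1_unitmx a1.
have {}ai : nrm (invmx a) <= k by rewrite (le_trans ai) // lerDl.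
have na : nrm a <= N.
  rewrite -[a](subrK 1%:M) (le_trans (nrmD _ _)) // nrm_1 /N addrC lerD2l.
  by rewrite (le_trans a1) //; lra.
set d := defect p t a in d1 *; have dge0 := nrm_ge0 d.
pose x : tensor := mk_tensor (fun u => tW d (invmx a *m u) *m invmx a) (fun w => tR d w *m invmx a).
have xW u : tW x u = tW d (invmx a *m u) *m invmx a by rewrite tW_mk //; lin.
have xR w : tR x w = tR d w *m invmx a by rewrite tR_mk //; lin.
have xd : nrm x <= C1 * nrm d.
  have ka : nrm (invmx a) * nrm (invmx a) <= k * k by rewrite ler_pM ?nrm_ge0.
  have : nrm x <= (n + m)%:R * (k * k * nrm d).
    apply: nrm_mk => i.
      rewrite (le_trans (nrm_mul _ _)) //.
      apply: le_trans (_ : nrm d * nrm (invmx a) * nrm (invmx a) <= _).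
        rewrite ler_wpM2r ?nrm_ge0 // (le_trans (nrm_tW _ _)) // ler_wpM2l //.
        by rewrite (le_trans (nrm_mul _ _)) // nrm_ebase mulr1.
      by rewrite -mulrA mulrC ler_wpM2r.
    rewrite (le_trans (nrm_mul _ _)) //.
    apply: le_trans (_ : nrm d * nrm (invmx a) <= _).
      by rewrite ler_wpM2r ?nrm_ge0 // (le_trans (nrm_tR _ _)) // nrm_ebase mulr1.
    by rewrite mulrC ler_wpM2r // (le_trans ai) // ler_peMr // ltW.
  move=> xle; apply: (le_trans xle); rewrite /C1 -!mulrA ler_wpM2r ?lerDl //.
  by rewrite !mulr_ge0 // ltW.
have pxW u : tW (p + x) u = tW p u + tW x u by apply: tWD.
have pxR u : tR (p + x) u = tR p u + tR x u by apply: tRD.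
have pxg : lie_pair Wh (p + x).
  apply: (lie_pair_conj au _ tg); split=> [v|w].
    by rewrite pxW xW mulKmx // mulmxDl mulmxKV // /d defectW addrC subrK.
  by rewrite pxR xR [RHS]mulmxDl mulmxKV // /d defectR addrC subrK.
have [b [bx yx]] := C0P x pxg.
set y := x + d0 p b in yx.
exists b.
have bd : nrm b <= C2 * nrm d.
  by rewrite (le_trans bx) // /C2 -mulrA ler_wpM2l // ltW.
split; first by rewrite (le_trans bd) // ler_wpM2r // lerDl.
have yd : nrm y <= C0 * C1 * C1 * nrm d * nrm d.
  have -> : C0 * C1 * C1 * nrm d * nrm d = C0 * (C1 * nrm d * (C1 * nrm d)) by ring.
  rewrite (le_trans yx) // -[leLHS]mulrA ler_wpM2l ?(ltW C0p) //.
  by rewrite ler_pM ?nrm_ge0.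
have bdbd : nrm b * nrm b <= (C2 * nrm d) * (C2 * nrm d) by rewrite ler_pM ?nrm_ge0.
have bdxd : nrm b * nrm x <= (C2 * nrm d) * (C1 * nrm d) by rewrite ler_pM ?nrm_ge0.
have yW u : tW y u = tW x u + (brk b (tW p u) - tW p (b *m u)).
  by rewrite /y -d0W tWD.
have yR w : tR y w = tR x w + brk b (tR p w).
  by rewrite /y -d0R tRD.
(* The terms of first order in b and x combine into y, the error of the
   approximation by a coboundary; the others are products of two small factors. *)
have dW v : tW (defect p t ((1%:M + b) *m a)) v =
   (tW y (a *m v) + b *m tW x (a *m v) - tW p (b *m (a *m v)) *m b) *m a.
  set u := a *m v.
  have ta : a *m tW t v = (tW x u + tW p u) *m a.
    by rewrite xW mulKmx // mulmxDl mulmxKV // /d defectW subrK.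
  rewrite defectW -![(1%:M + b) *m a *m _]mulmxA -/u ta !mulmxA -mulmxBl.
  have Wu : tW p ((1%:M + b) *m u) = tW p u + tW p (b *m u).
    by rewrite mulmxDl mul1mx linearD.
  rewrite -[_ *m a *m v]mulmxA -/u Wu; congr (_ *m a); rewrite yW /brk.
  rewrite -[b *m a *m v]mulmxA -/u.
  move: (tW x u) (tW p u) (tW p (b *m u)) => A1 A2 A5.
  rewrite !(mulmxDl, mulmxDr, mul1mx, mulmx1) !opprD !addrA.
  by rewrite [LHS](ACl (1*4*6*7*3*8*(2*5)))/= subrr addr0.
have dR w : tR (defect p t ((1%:M + b) *m a)) w = (tR y w + b *m tR x w) *m a.
  have ta : a *m tR t w = (tR x w + tR p w) *m a.
    by rewrite xR mulmxDl mulmxKV // /d defectR subrK.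
  rewrite defectR -[(1%:M + b) *m a *m _]mulmxA ta !mulmxA -mulmxBl.
  congr (_ *m a); rewrite yR /brk !(mulmxDl, mulmxDr, mul1mx, mulmx1) !opprD !addrA.
  set A1 := tR x w; set A2 := tR p w; set A3 := b *m A1; set A4 := b *m A2.
  set A6 := A2 *m b.
  by rewrite [LHS](ACl (1*4*6*3*(2*5)))/= subrr addr0.
have dle : nrm (defect p t ((1%:M + b) *m a)) <= (n + m)%:R *
   ((C0 * C1 * C1 * nrm d * nrm d * N + C2 * nrm d * (C1 * nrm d) * N
    + np * (C2 * nrm d) * N * (C2 * nrm d)) * N).
  apply: nrm_tensor_le => i.
    have uN : nrm (a *m ebase i) <= N.
      by rewrite (le_trans (nrm_mul _ _)) // nrm_ebase mulr1.
    rewrite dW.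
    rewrite (le_trans (nrm_mul _ _)) // ler_pM ?nrm_ge0 //.
    rewrite (le_trans (nrmB _ _)) // lerD //; first rewrite (le_trans (nrmD _ _)) // lerD //.
    - by rewrite (le_trans (nrm_tW _ _)) // ler_pM ?nrm_ge0.
    - rewrite (le_trans (nrm_mul _ _)) // -mulrA ler_pM ?nrm_ge0 //.
      by rewrite (le_trans (nrm_tW _ _)) // ler_pM ?nrm_ge0.
    - rewrite (le_trans (nrm_mul _ _)) // ler_pM ?nrm_ge0 //.
      rewrite (le_trans (nrm_tW _ _)) // -mulrA ler_wpM2l //.
      by rewrite (le_trans (nrm_mul _ _)) // ler_pM ?nrm_ge0.
  rewrite dR.
  rewrite (le_trans (nrm_mul _ _)) // ler_pM ?nrm_ge0 //.
  have eN : nrm (ebase i : 'cV[R]_m) <= N by rewrite nrm_ebase /N lerDr.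
  have S3 : 0 <= np * (C2 * nrm d) * N * (C2 * nrm d).
    have C2' := ltW C20; have N' := ltW N0.
    by repeat first [done | apply: mulr_ge0].
  rewrite (le_trans (nrmD _ _)) // -[leLHS]addr0 lerD // lerD //.
    by rewrite (le_trans (nrm_tR _ _)) // ler_pM ?nrm_ge0.
  rewrite (le_trans (nrm_mul _ _)) // -mulrA ler_pM ?nrm_ge0 //.
  by rewrite (le_trans (nrm_tR _ _)) // ler_pM ?nrm_ge0.
apply: (le_trans dle).
have -> : (C2 + C3) * nrm d * nrm d = C2 * nrm d * nrm d + C3 * (nrm d * nrm d) by ring.
apply: ler_wpDl; first by rewrite mulr_ge0 // mulr_ge0 // ltW.
have -> : (C0 * C1 * C1 * nrm d * nrm d * N + C2 * nrm d * (C1 * nrm d) * N +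
   np * (C2 * nrm d) * N * (C2 * nrm d)) * N =
   (C0 * C1 * C1 * N + C2 * C1 * N + np * C2 * N * C2) * N * (nrm d * nrm d) by ring.
rewrite /C3; move: C30; rewrite /C3; set Z := (_ + _ + _) * N => MZ0.
rewrite mulrA ler_wpM2r ?mulr_ge0 // ler_wpM2r ?lerDl //.
by rewrite pmulr_rge0 // (lt_le_trans ltr01) in MZ0.
Qed.

End Improvement.

(** * The action of gl_n x gl_m on pairs *)

Section SquareZero.
Variable F : fieldType.

(** Both sides are the determinant of the block matrix with rows (1, - B) and
    (A, 1), eliminated in two ways. *)
Lemma det_1_mulmx k l (A : 'M[F]_(k, l)) (B : 'M[F]_(l, k)) :
  \det (1%:M + A *m B) = \det (1%:M + B *m A).
Proof.
pose M := block_mx (1%:M : 'M[F]_l) (- B) A (1%:M : 'M[F]_k).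
have e1 : block_mx 1%:M 0 (- A) 1%:M *m M = block_mx 1%:M (- B) 0 (1%:M + A *m B).
  rewrite mulmx_block !(mul1mx, mulmx1, mul0mx, addr0, mulNmx, mulmxN, opprK).
  by rewrite addNr addrC.
have e2 : block_mx 1%:M B 0 1%:M *m M = block_mx (1%:M + B *m A) 0 A 1%:M.
  by rewrite mulmx_block !(mul1mx, mulmx1, mul0mx, add0r) addNr.
transitivity (\det M).
  have := congr1 determinant e1.
  by rewrite det_mulmx det_lblock !det1 !mul1r det_ublock det1 mul1r.
have := congr1 determinant e2.
by rewrite det_mulmx det_ublock !det1 !mul1r det_lblock det1 mulr1.
Qed.

Lemma det_1_sqr0 n (N : 'M[F]_n) : N *m N = 0 -> \det (1%:M + N) = 1.
Proof.
have [r [L [U [B [D [_ -> BL UD]]]]]] := rank_factorisation N.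
move=> NN; have UL : U *m L = 0.
  have : B *m (L *m U *m (L *m U)) *m D = 0 by rewrite NN mulmx0 mul0mx.
  by rewrite !mulmxA BL mul1mx -!mulmxA UD mulmx1.
by rewrite det_1_mulmx UL addr0 det1.
Qed.

(** The matrices e_ij with i <> j have square zero, and so does
    e_ii - e_jj + e_ij - e_ji; so [phi] vanishes off the diagonal and takes the same
    value on all e_ii. *)
Lemma trace_functional n (phi : 'M[F]_n -> F^o) : islin phi ->
    (forall N, N *m N = 0 -> phi N = 0) ->
  exists c, forall S, phi S = c * \tr S.
Proof.
move=> phil phi0.
have off (i j : 'I_n) : i != j -> phi (delta_mx i j) = 0.
  by move=> ij; apply: phi0; rewrite mul_delta_mx_0 // eq_sym.
have diag (i j : 'I_n) : phi (delta_mx i i) = phi (delta_mx j j).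
  have [->//|ij] := eqVneq i j; have ji : j != i by rewrite eq_sym.
  apply/eqP; rewrite -subr_eq0; apply/eqP.
  have : phi (delta_mx i i - delta_mx j j + (delta_mx i j - delta_mx j i)) = 0.
    apply: phi0; rewrite !(mulmxDl, mulmxDr, mulNmx, mulmxN).
    rewrite !mul_delta_mx_cond !eqxx (negbTE ij) (negbTE ji) !mulr1n !mulr0n.
    rewrite !(oppr0, subr0, addr0, add0r, opprK).
    by rewrite !addrA [LHS](ACl ((1*6)*(2*5)*(3*8)*(4*7)))/= !subrr !addr0.
  rewrite -[phi _]/(lin_pack phil _) !(linearD, linearN, linearB) /= => <-.
  by rewrite (off i j) // (off j i) // subrr addr0.
case: n phi phil phi0 off diag => [|n] phi phil phi0 off diag.
  by exists 0 => S; rewrite [S]flatmx0 -[LHS]/(lin_pack phil _) linear0 mul0r.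
exists (phi (delta_mx 0 0)) => S.
rewrite {1}(matrix_sum_delta S) -[LHS]/(lin_pack phil _) linear_sum /mxtrace mulr_sumr.
apply: eq_bigr => i _; rewrite linear_sum (bigD1 i) //= big1 ?addr0.
  by rewrite -[LHS]/(lin_pack phil _) linearZ /= (diag i 0) mulrC.
move=> j ji; rewrite -[LHS]/(lin_pack phil _) linearZ /= off ?scaler0 //.
by rewrite eq_sym.
Qed.

End SquareZero.

Section TensorDot.
Variables (R : rcfType) (n m : nat).
Local Notation tensor := (tensor R n m).
Implicit Types s t p : tensor.

(** The Euclidean scalar product; its norm, unlike [nrm], is differentiable. *)
Definition dot s t : R := \tr (s *m t^T).

Lemma dotE s t : dot s t =
  \sum_i \tr (tW s (ebase i) *m (tW t (ebase i))^T)
  + \sum_a \tr (tR s (ebase a) *m (tR t (ebase a))^T).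
Proof.
have trE k l (A B : 'M[R]_(k, l)) : \tr (A *m B^T) = \sum_i \sum_j A i j * B i j.
  by apply: eq_bigr => i _; rewrite mxE; apply: eq_bigr => j _; rewrite mxE.
have opE k (A B : 'M[R]_(k, n * n)) i :
    \tr (opm A (ebase i) *m (opm B (ebase i))^T) = \sum_j A i j * B i j.
  rewrite /opm !trmx_delta -!rowE trE.
  rewrite [RHS](reindex _ (curry_mxvec_bij _ _)) /= pair_bigA /=.
  by apply: eq_bigr => -[k1 k2] _; rewrite !mxE.
rewrite /dot trE big_split_ord /=; congr (_ + _); apply: eq_bigr => i _; rewrite opE.
  by apply: eq_bigr => j _; rewrite !mxE.
by apply: eq_bigr => j _; rewrite !mxE.
Qed.

Lemma dotC s t : dot s t = dot t s.
Proof. by rewrite /dot -mxtrace_tr trmx_mul trmxK. Qed.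
Lemma dotDl s1 s2 t : dot (s1 + s2) t = dot s1 t + dot s2 t.
Proof. by rewrite /dot mulmxDl mxtraceD. Qed.
Lemma dotDr s t1 t2 : dot s (t1 + t2) = dot s t1 + dot s t2.
Proof. by rewrite dotC dotDl !(dotC s). Qed.
Lemma dotZl c s t : dot (c *: s) t = c * dot s t.
Proof. by rewrite /dot -scalemxAl mxtraceZ. Qed.
Lemma dotZr c s t : dot s (c *: t) = c * dot s t.
Proof. by rewrite dotC dotZl dotC. Qed.
Lemma frob_eq0 k l (A : 'M[R]_(k, l)) : \tr (A *m A^T) = 0 -> A = 0.
Proof.
move=> A0; apply/matrixP => i j; rewrite mxE; apply/eqP; rewrite -sqrf_eq0; apply/eqP.
have ge0 i' : 0 <= (A *m A^T) i' i'.
  by rewrite mxE; apply: sumr_ge0 => k' _; rewrite mxE -expr2 sqr_ge0.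
have := psumr_eq0P (fun i' _ => ge0 i') A0 (i := i) isT; rewrite mxE => e.
have := psumr_eq0P _ e (i := j) isT; rewrite mxE -expr2; apply=> k' _.
by rewrite mxE -expr2 sqr_ge0.
Qed.

(** The infinitesimal action of gl_n x gl_m by change of basis of R^n and R^m.  For
    D = 0 it agrees with [d0]. *)
Definition act (S : 'M[R]_n) (D : 'M[R]_m) t : tensor :=
  mk_tensor (fun v => brk S (tW t v) - tW t (S *m v)) (fun w => brk S (tR t w) - tR t (D *m w)).

Lemma actW S D t v : tW (act S D t) v = brk S (tW t v) - tW t (S *m v).
Proof. by rewrite tW_mk //; lin. Qed.
Lemma actR S D t v : tR (act S D t) v = brk S (tR t v) - tR t (D *m v).
Proof. by rewrite tR_mk //; lin. Qed.

Lemma act_linear t : islin (fun S => act S 0 t).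
Proof. by apply: islin_mk => v; lin; rewrite mul0mx; lin. Qed.

Lemma frob_brk (S A B : 'M[R]_n) : \tr (brk S A *m B^T) = \tr (A *m (brk S^T B)^T).
Proof.
rewrite /brk linearB /= !trmx_mul trmxK mulmxBl mulmxBr !mxtraceB; congr (_ - _).
  by rewrite -mulmxA mxtrace_mulC -mulmxA.
by rewrite -mulmxA.
Qed.

Lemma frobBr (A B C : 'M[R]_n) :
  \tr (A *m (B - C)^T) = \tr (A *m B^T) - \tr (A *m C^T).
Proof. by rewrite linearB /= mulmxBr mxtraceB. Qed.

Lemma act_adjoint S D s t : dot (act S D s) t = dot s (act S^T D^T t).
Proof.
rewrite !dotE; congr (_ + _).
  transitivity (\sum_i \tr (tW s (ebase i) *m (brk S^T (tW t (ebase i)))^T)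
      - \sum_i \tr (tW s (ebase i) *m (tW t (S^T *m ebase i))^T)).
    pose f (u v : 'cV[R]_n) : R^o := \tr (tW s u *m (tW t v)^T).
    have fl v : islin (f^~ v).
      by move=> c x y; rewrite /f linearP mulmxDl -scalemxAl linearP.
    have fr u : islin (f u).
      by move=> c x y; rewrite /f (linearP (tW t)) linearP mulmxDr -scalemxAr linearP.
    have := bilinear_sum_move fl fr S 1%:M; rewrite /f.
    under eq_bigr do rewrite mul1mx; under [in RHS]eq_bigr do rewrite mul1mx.
    move=> <-; rewrite -sumrB; apply: eq_bigr => i _.
    by rewrite actW mulmxBl mxtraceB frob_brk.
  by rewrite -sumrB; apply: eq_bigr => i _; rewrite actW [RHS]frobBr.
transitivity (\sum_i \tr (tR s (ebase i) *m (brk S^T (tR t (ebase i)))^T)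
    - \sum_i \tr (tR s (ebase i) *m (tR t (D^T *m ebase i))^T)).
  pose f (u v : 'cV[R]_m) : R^o := \tr (tR s u *m (tR t v)^T).
  have fl v : islin (f^~ v).
    by move=> c x y; rewrite /f linearP mulmxDl -scalemxAl linearP.
  have fr u : islin (f u).
    by move=> c x y; rewrite /f (linearP (tR t)) linearP mulmxDr -scalemxAr linearP.
  have := bilinear_sum_move fl fr D 1%:M; rewrite /f.
  under eq_bigr do rewrite mul1mx; under [in RHS]eq_bigr do rewrite mul1mx.
  move=> <-; rewrite -sumrB; apply: eq_bigr => i _.
  by rewrite actR mulmxBl mxtraceB frob_brk.
by rewrite -sumrB; apply: eq_bigr => i _; rewrite actR [RHS]frobBr.
Qed.

Lemma act0 S D : act S D 0 = 0.
Proof.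
apply: tensor_ext => v; rewrite ?actW ?actR ?tW0 ?tR0 /brk mulmx0 mul0mx.
  by rewrite !subr0.
by rewrite !subr0.
Qed.

Lemma act_commutator S D S' D' t :
  act S D (act S' D' t) = act (brk S S') (brk D D') t + act S' D' (act S D t).
Proof.
have key (J0 J1 J2 x y z w : 'M[R]_n) : J1 = J0 + J2 ->
    J1 - x - (y - z) = J0 - (w - z) + (J2 - y - (x - w)).
  move=> ->; rewrite !opprD !opprK !addrA.
  by rewrite [RHS](ACl (1*4*6*5*3*(2*7)))/= addNr addr0.
have brkB (A B C : 'M[R]_n) : brk A (B - C) = brk A B - brk A C.
  by rewrite brkDr brkNr.
have actW2 A E B G v : tW (act A E (act B G t)) v =
    brk A (brk B (tW t v)) - brk A (tW t (B *m v))
    - (brk B (tW t (A *m v)) - tW t (B *m A *m v)).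
  rewrite [LHS]actW [X in brk A X - _]actW [X in _ - X = _]actW brkB.
  by rewrite -mulmxA.
have actR2 A E B G w : tR (act A E (act B G t)) w =
    brk A (brk B (tR t w)) - brk A (tR t (G *m w))
    - (brk B (tR t (E *m w)) - tR t (G *m E *m w)).
  rewrite [LHS]actR [X in brk A X - _]actR [X in _ - X = _]actR brkB.
  by rewrite -mulmxA.
apply: tensor_ext => v.
  rewrite [LHS]actW2 [RHS]tWD [X in _ = X + _]actW [X in _ = _ + X]actW2.
  rewrite [brk S S' *m v]mulmxBl [X in _ = _ - X + _]linearB.
  by apply: key; exact: brk_jacobi.
rewrite [LHS]actR2 [RHS]tRD [X in _ = X + _]actR [X in _ = _ + X]actR2.
rewrite [brk D D' *m v]mulmxBl [X in _ = _ - X + _]linearB.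
by apply: key; exact: brk_jacobi.
Qed.

(** |X^T t|^2 = <X X^T t, t> = <[X, X^T] t, t> + |X t|^2 for X = (S, D), by
    [act_adjoint] and [act_commutator]. *)
Lemma act_transpose_eq0 S D t : act S D t = 0 ->
  dot t (act (brk S S^T) (brk D D^T) t) = 0 -> act S^T D^T t = 0.
Proof.
move=> a0 m0; apply: frob_eq0; rewrite -/(dot _ _) act_adjoint !trmxK.
by rewrite act_commutator a0 act0 addr0.
Qed.

End TensorDot.

(** * Critical points of the norm *)

(** A nonnegative polynomial that vanishes at 0 has no linear term; degree 6 is that
    of the squared norm along the cubic curves below. *)
Lemma linear_coef0 (R : realFieldType) (c e2 e3 e4 e5 e6 : R) :
    (forall s, 0 <= s * c + s ^+ 2 * e2 + s ^+ 3 * e3 + s ^+ 4 * e4 + s ^+ 5 * e5 + s ^+ 6 * e6) ->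
  c = 0.
Proof.
move=> pos; pose B := `|e2| + `|e3| + `|e4| + `|e5| + `|e6|.
have B0 : 0 <= B by rewrite !addr_ge0.
have bnd (s : R) k (e : R) : `|s| <= 1 -> s ^+ k.+2 * e <= s ^+ 2 * `|e|.
  move=> s1; rewrite !exprS expr0 mulr1 mulrA -!mulrA mulrA [leRHS]mulrA.
  apply: ler_wpM2l; first by rewrite -expr2 sqr_ge0.
  apply: le_trans (ler_norm _) _; rewrite normrM normrX ler_piMl //.
  by rewrite exprn_ile1.
have pos' (s : R) : `|s| <= 1 -> 0 <= s * c + s ^+ 2 * B.
  move=> s1; apply: le_trans (pos s) _; rewrite -!addrA lerD2l /B !mulrDr.
  have := bnd s 0 e2 s1; have := bnd s 1 e3 s1; have := bnd s 2 e4 s1.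
  have := bnd s 3 e5 s1; have := bnd s 4 e6 s1; rewrite -!addrA.
  by lra.
apply/eqP; apply: contraT => c0.
pose D := 1 + B + `|c|; have D0 : 0 < D by rewrite /D; have := normr_ge0 c; lra.
have s1 : `|- c / D| <= 1.
  by rewrite normrM normrN normfV (gtr0_norm D0) ler_pdivrMr // mul1r /D; lra.
have := pos' _ s1; rewrite (_ : _ + _ = c ^+ 2 / D * (B / D - 1)); last first.
  by field; rewrite gt_eqF.
have c2 : 0 < c ^+ 2 / D by rewrite divr_gt0 // exprn_even_gt0.
rewrite pmulr_rge0 // subr_ge0 ler_pdivlMr // mul1r /D.
by have := normr_ge0 c; lra.
Qed.

Section CriticalPoint.
Variables (R : rcfType) (n m : nat).
Local Notation tensor := (tensor R n m).
Variable p : tensor.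
Hypothesis pmin : forall t b, \det b ^+ 2 = 1 -> intertwines t p b -> dot p p <= dot t t.

(** The inverse of 1 + s N being 1 - s N, the curve is polynomial in s. *)
Lemma unipotent_expansion (A B N : 'M[R]_n) s :
  (1%:M + s *: N) *m (A - s *: B) *m (1%:M - s *: N) =
  A + s *: (brk N A - B) + s ^+ 2 *: (B *m N - N *m B - N *m A *m N)
    + s ^+ 3 *: (N *m B *m N).
Proof.
have expand (U X : 'M[R]_n) : (1%:M + U) *m (A - X) *m (1%:M - U) =
    A + (U *m A - A *m U - X) + (X *m U - U *m X - U *m A *m U) + U *m X *m U.
  rewrite mulmxBr mulmx1 mulmxDl mul1mx !mulmxBr !mulmxDl !mulNmx.
  rewrite !opprD !opprK !addrA.
  by rewrite [LHS](ACl (1*3*5*2*6*4*7*8)).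
rewrite expand; congr (A + _ + _ + _).
- by rewrite /brk !scalerBr -!scalemxAl -!scalemxAr.
- by rewrite !scalerBr -!(scalemxAl, scalemxAr) !scalerA -expr2.
- by rewrite -!(scalemxAl, scalemxAr) !scalerA -expr2 -exprS.
Qed.

(** Changes of basis by the unimodular matrices 1 + s N move p along a polynomial
    curve, on which the norm is minimal at s = 0.  Restricting to N with N^2 = 0 makes
    exponentials unnecessary; by [trace_functional] it loses no information. *)
Lemma critical_sqr0 (N : 'M[R]_n) : N *m N = 0 -> dot p (act N 0 p) = 0.
Proof.
move=> NN; pose x1 := act N 0 p.
pose x2 : tensor := mk_tensor (fun v => tW p (N *m v) *m N - N *m tW p (N *m v) - N *m tW p v *m N)
   (fun w => - (N *m tR p w *m N)).
pose x3 : tensor := mk_tensor (fun v => N *m tW p (N *m v) *m N) (fun w => 0).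
have ts s : dot p p <= dot (p + s *: x1 + s ^+ 2 *: x2 + s ^+ 3 *: x3)
    (p + s *: x1 + s ^+ 2 *: x2 + s ^+ 3 *: x3).
  have sNN : (s *: N) *m (s *: N) = 0 by rewrite -scalemxAl -scalemxAr NN !scaler0.
  apply: (pmin (b := 1%:M + s *: N)); first by rewrite det_1_sqr0 // expr1n.
  have inv : (1%:M - s *: N) *m (1%:M + s *: N) = 1%:M.
    by rewrite mulmxBl mul1mx mulmxDr mulmx1 sNN addr0 addrK.
  split=> v; rewrite ?tWD ?tRD ?tWZ ?tRZ ?actW ?actR ?tW_mk ?tR_mk; try by lin.
    have := unipotent_expansion (tW p ((1%:M + s *: N) *m v)) (tW p (N *m ((1%:M + s *: N) *m v))) N s.
    move=> <-; rewrite -linearZ -linearB /= scalemxAl.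
    have -> : (1%:M + s *: N) *m v - (s *: N) *m ((1%:M + s *: N) *m v) = v.
      by rewrite -[X in X - _]mul1mx -mulmxBl mulmxA inv mul1mx.
    by rewrite -!mulmxA inv mulmx1.
  have := unipotent_expansion (tR p v) 0 N s.
  rewrite mul0mx linear0 !scaler0 !subr0 !mulmx0 !mul0mx subr0 sub0r scaler0 addr0.
  rewrite (linear0 (tR p)) subr0 addr0 => <-.
  by rewrite -[RHS]mulmxA inv mulmx1.
have lin0 : 2 * dot p x1 = 0.
  apply: (@linear_coef0 R _ (dot x1 x1 + 2 * dot p x2) (2 * dot p x3 + 2 * dot x1 x2)
    (dot x2 x2 + 2 * dot x1 x3) (2 * dot x2 x3) (dot x3 x3)) => s.
  have := ts s; rewrite -subr_ge0 => /le_trans; apply.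
  rewrite !(dotDl, dotDr, dotZl, dotZr) (dotC x1 p) (dotC x2 p) (dotC x3 p).
  rewrite (dotC x2 x1) (dotC x3 x1) (dotC x3 x2).
  by rewrite le_eqVlt; apply/orP; left; apply/eqP; ring.
by move/eqP: lin0; rewrite mulf_eq0 pnatr_eq0 /= => /eqP.
Qed.

Lemma critical_trace : exists c, forall S, dot p (act S 0 p) = c * \tr S.
Proof.
apply: (@trace_functional _ n (fun S => dot p (act S 0 p))); last exact: critical_sqr0.
by move=> c x y; rewrite act_linear dotDr dotZr.
Qed.

End CriticalPoint.

(** * The involution attached to a critical pair *)

Section SelfAdjoint.
Variables (R : rcfType) (n m : nat).
Variables (Wh : {linear 'cV[R]_m -> 'M[R]_m}) (s : 'M[R]_m).
Hypotheses (Whl : lie_tensor Wh) (Whn : killing_mx Wh \in unitmx).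
Hypotheses (sym_s : s^T = s) (inv_s : s *m s = 1%:M).
Hypothesis (aut_s : forall u v : 'cV[R]_m, s *m (Wh u *m v) = Wh (s *m u) *m (s *m v)).
Hypothesis (trWh : forall w, (Wh w)^T = - Wh (s *m w)).
Variable p : tensor R n m.
Hypotheses (pg : lie_pair Wh p) (pn : killing_mx (tW p) \in unitmx).
Hypothesis pmin : forall t b, \det b ^+ 2 = 1 -> intertwines t p b -> dot p p <= dot t t.

Let Wl : lie_tensor (tW p). Proof. by case: pg. Qed.
Let Rd w v : tW p (tR p w *m v) = brk (tR p w) (tW p v). Proof. by case: pg. Qed.
Let Rr u v : tR p (Wh u *m v) = brk (tR p u) (tR p v). Proof. by case: pg. Qed.

(** The derivation and representation properties say that h, acting on R^n and on
    itself, preserves the pair. *)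
Lemma stabiliser_rep w : act (tR p w) (Wh w) p = 0.
Proof.
apply: tensor_ext => v.
  by rewrite [LHS]actW tW0 Rd subrr.
by rewrite [LHS]actR tR0 Rr subrr.
Qed.

(** By [act_transpose_eq0], it suffices that the commutator of (R(w), ad w) with its
    transpose is orthogonal to p.  Its second entry is again ad u, since
    (ad w)^T = - ad (s w); as (R(u), ad u) kills p it may be traded for a matrix in
    the first entry, and criticality leaves traces of commutators. *)
Lemma stabiliser_rep_tr w : act (tR p w)^T (Wh w)^T p = 0.
Proof.
have [c cP] := critical_trace pmin.
apply: act_transpose_eq0; first exact: stabiliser_rep.
set u := - (Wh w *m (s *m w)).
have -> : brk (Wh w) (Wh w)^T = Wh u.
  by rewrite trWh brkNr /u linearN /= Whl.2.
have split_act X D : act X D p = act X 0 p + act 0 D p.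
  have brk0 (A : 'M[R]_n) : brk 0 A = 0 by rewrite /brk mul0mx mulmx0 subr0.
  apply: tensor_ext => v.
    by rewrite [LHS]actW [RHS]tWD [X in _ = X + _]actW [X in _ = _ + X]actW
       brk0 mul0mx linear0 subr0 addr0.
  by rewrite [LHS]actR [RHS]tRD [X in _ = X + _]actR [X in _ = _ + X]actR
       brk0 mul0mx linear0 subr0 sub0r.
have actu : act 0 (Wh u) p = - act (tR p u) 0 p.
  by apply/eqP; rewrite -addr_eq0 addrC -split_act stabiliser_rep.
rewrite split_act actu dotDr -scaleN1r dotZr !cP mxtrace_brk.
by rewrite /u linearN /= Rr mxtraceN mxtrace_brk oppr0 !mulr0 addr0.
Qed.

Lemma tr_rep_brk w v : brk (tR p w)^T (tR p v) = - brk (tR p (s *m w)) (tR p v).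
Proof.
have := congr1 (fun t => tR t v) (stabiliser_rep_tr w).
rewrite /= [LHS]actR tR0 => /eqP; rewrite subr_eq0 => /eqP ->.
by rewrite trWh mulNmx linearN /= Rr.
Qed.

(** The difference A(w) = R(w)^T + R(s w) commutes with all R(v) and is symmetric up to
    s, so it commutes with all R(v)^T too.  Then A vanishes on brackets, and h is
    perfect. *)
Lemma rep_tr w : (tR p w)^T = - tR p (s *m w).
Proof.
pose A w := (tR p w)^T + tR p (s *m w).
have Al : islin A by rewrite /A; lin.
suff A0 : A w = 0 by apply/eqP; rewrite -addr_eq0; apply/eqP.
have AR x y : brk (A x) (tR p y) = 0 by rewrite brkDl tr_rep_brk addNr.
have ss (x : 'cV_m) : s *m (s *m x) = x by rewrite mulmxA inv_s mul1mx.
have Atr x : (A x)^T = A (s *m x) by rewrite /A linearD /= trmxK ss addrC.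
have ARt x y : brk (A x) (tR p y)^T = 0.
  rewrite -[brk _ _]trmxK brk_tr trmxK Atr AR.
  by rewrite oppr0 trmx0.
have AA x y : brk (A x) (A y) = 0 by rewrite [A y]/A brkDr ARt AR addr0.
have Abr x y : A (Wh x *m y) = 0.
  have RsE z : tR p (s *m z) = A z - (tR p z)^T by rewrite /A addrC addKr.
  have brkDD (B C D E : 'M[R]_n) : brk (B - C) (D - E) = brk B D - brk B E - brk C D + brk C E.
    by rewrite brkDl !brkDr !brkNr !brkNl opprK addrA.
  rewrite {1}/A aut_s !Rr !RsE brkDD AA ARt [brk _ (A y)]brkC ARt brk_tr.
  by rewrite !(subr0, oppr0, add0r) addNr.
rewrite -[w]mul1mx -(casimir_adjoint Whl Whn) mulmx_suml -[A _]/(lin_pack Al _) linear_sum.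
by rewrite big1 // => i _; rewrite /= -mulmxA Abr.
Qed.

(** The representation part of <S p, p> vanishes: by [rep_tr] it is a trace against
    R applied to sum_a [e_a, s e_a], and this sum is zero because s is symmetric and
    the bracket is antisymmetric. *)
Lemma rep_part_eq0 S :
  \sum_a \tr (tR p (ebase a) *m (tR (act S 0 p) (ebase a))^T) = 0.
Proof.
pose f (u v : 'cV[R]_m) := Wh u *m v.
have fl v : islin (f^~ v) by rewrite /f; lin.
have fr u : islin (f u) by rewrite /f; lin.
have sum0 : \sum_a Wh (ebase a) *m (s *m ebase a) = 0.
  have := bilinear_sum_move fl fr s 1%:M; rewrite /f.
  under eq_bigr do rewrite mul1mx Whl.1; under [in RHS]eq_bigr do rewrite mul1mx sym_s.
  rewrite sumrN => /eqP; rewrite eq_sym -addr_eq0 -mulr2n -scaler_nat scaler_eq0 pnatr_eq0.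
  by move=> /eqP.
transitivity (- \tr (S^T *m tR p (\sum_a Wh (ebase a) *m (s *m ebase a)))); last first.
  by rewrite sum0 linear0 mulmx0 mxtrace0 oppr0.
rewrite linear_sum mulmx_sumr (big_morph _ (@mxtraceD _ _) (mxtrace0 _ _)) -sumrN.
apply: eq_bigr => a _ /=.
rewrite [X in X^T]actR mul0mx linear0 subr0 -[S in brk S _]trmxK -frob_brk rep_tr Rr.
rewrite mulmxN mxtraceN /brk mulmxBl mulmxBr !mxtraceB; congr (- (_ - _)).
  by rewrite mulmxA.
by rewrite -mulmxA mxtrace_mulC -mulmxA.
Qed.

Definition bracket_part : tensor R n m := mk_tensor (tW p) (fun=> 0).

Lemma bracket_partW v : tW bracket_part v = tW p v.
Proof. by rewrite tW_mk //; lin. Qed.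
Lemma bracket_partR v : tR bracket_part v = 0.
Proof. by rewrite tR_mk //; lin. Qed.

Lemma bracket_part_critical : exists c, forall S, dot bracket_part (act S 0 bracket_part) = c * \tr S.
Proof.
have [c cP] := critical_trace pmin; exists c => S.
transitivity (dot p (act S 0 p)); last exact: cP.
rewrite [LHS]dotE [RHS]dotE; apply: (congr2 +%R).
  by apply: eq_bigr => i _; rewrite [X in _ *m X^T]actW [X in _ = \tr (_ *m X^T)]actW !bracket_partW.
rewrite [RHS]rep_part_eq0 [LHS]big1 // => a _.
by rewrite bracket_partR mul0mx mxtrace0.
Qed.

(** For the pair without representation, [act_transpose_eq0] says that derivations
    are stable under transposition, with the criticality relation cancelling the
    commutator term. *)
Lemma ad_tr z : exists z', (tW p z)^T = tW p z'.
Proof.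
have [c cP] := bracket_part_critical.
have : act (tW p z)^T (0 : 'M[R]_m)^T bracket_part = 0.
  apply: act_transpose_eq0.
    apply: tensor_ext => v.
      by rewrite [LHS]actW tW0 !bracket_partW Wl.2 subrr.
    by rewrite [LHS]actR tR0 !bracket_partR /brk mulmx0 mul0mx !subr0.
  by rewrite [brk 0 _]/brk mulmx0 mul0mx subr0 cP mxtrace_brk mulr0.
move=> act0; apply: (derivation_inner Wl pn) => v.
have := congr1 (fun t => tW t v) act0.
by rewrite /= [LHS]actW tW0 !bracket_partW => /eqP; rewrite subr_eq0 => /eqP.
Qed.

Lemma tW_inj u v : tW p u = tW p v -> u = v.
Proof.
move=> uv; apply/eqP; rewrite -subr_eq0; apply/eqP; apply: (ad_inj pn).
by rewrite linearB /= uv subrr.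
Qed.

(** The matrix theta is defined by W(theta z) = - W(z)^T, and [tW] is injective
    because the Killing form is nondegenerate. *)
Theorem cartan_of_critical : exists theta : 'M[R]_n,
  [/\ forall x : 'cV[R]_n, theta *m (theta *m x) = x,
      forall u v : 'cV[R]_n, theta *m (tW p u *m v) = tW p (theta *m u) *m (theta *m v),
      forall x : 'cV[R]_n, x != 0 -> 0 < - \tr (tW p (theta *m x) *m tW p x) &
      forall (w : 'cV[R]_m) (z : 'cV[R]_n), tR p w = tW p z -> tR p (s *m w) = tW p (theta *m z)].
Proof.
have fl : islin (fun z => - (tW p z)^T) by lin.
have [theta thetaP] : exists theta : 'M[R]_n, forall z, - (tW p z)^T = tW p (theta *m z).
  apply: (linear_factor (W := tW p) fl) => i; have [z' ->] := ad_tr (ebase i).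
  by exists (- z'); rewrite linearN.
exists theta; split.
- move=> x; apply: tW_inj; rewrite -!thetaP linearN /= trmxK opprK.
  by [].
- move=> u v; apply: tW_inj; rewrite -thetaP !Wl.2 -!/(brk _ _) brk_tr -!thetaP.
  by rewrite brkNl brkNr !opprK.
- move=> x x0; rewrite -thetaP mulNmx mxtraceN opprK lt_neqAle; apply/andP; split.
    apply: contraNneq x0; rewrite mxtrace_mulC => /esym/frob_eq0 Wx0.
    by apply/eqP/(ad_inj pn).
  rewrite mxtrace_mulC; apply: sumr_ge0 => i _; rewrite mxE; apply: sumr_ge0 => j _.
  by rewrite [_^T _ _]mxE -expr2 sqr_ge0.
- by move=> w z wz; rewrite -thetaP -wz rep_tr opprK.
Qed.

End SelfAdjoint.

(** * Coordinates on an abstract Lie algebra *)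

Section ColumnMatrix.
Variables (F : fieldType) (k l : nat).
Definition col_of_fun (f : 'cV[F]_k -> 'cV[F]_l) : 'M[F]_(l, k) :=
  \matrix_(i, j) f (ebase j) i 0.

Lemma col_of_funE f v : islin f -> col_of_fun f *m v = f v.
Proof.
move=> fl; rewrite -[RHS]/(lin_pack fl v) [v]cV_sum_ebase !linear_sum; apply: eq_bigr => j _.
rewrite !linearZ /= mulmx_ebase; congr (_ *: _).
by apply/matrixP => i i'; rewrite !mxE ord1.
Qed.
End ColumnMatrix.

Section Coordinates.
Variables (F : fieldType) (L : lieAlgType F) (n : nat).
Variables (c : {linear L -> 'cV[F]_n}) (d : {linear 'cV[F]_n -> L}).

Definition end_mx (f : L -> L) : 'M[F]_n := col_of_fun (fun v => c (f (d v))).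
Definition ad_mx (v : 'cV[F]_n) : 'M[F]_n := end_mx (lie (d v)).

Lemma ad_mx_linear : linear ad_mx.
Proof.
move=> a u v; apply/matrixP => i j.
by rewrite !mxE linearP [lie _ _]lie_linearl linearP !mxE.
Qed.
HB.instance Definition _ :=
  GRing.isLinear.Build F 'cV[F]_n 'M[F]_n _ ad_mx ad_mx_linear.

Hypotheses (cK : cancel c d) (dK : cancel d c).

Lemma end_mxE (f : {linear L -> L}) x : end_mx f *m c x = c (f x).
Proof. by rewrite col_of_funE ?cK // => a u v; rewrite !linearP. Qed.

Lemma ad_mxE v x : ad_mx v *m c x = c (lie (d v) x).
Proof. exact: end_mxE. Qed.

Lemma ad_mx_mul u v : ad_mx u *m v = c (lie (d u) (d v)).
Proof. by rewrite -ad_mxE dK. Qed.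

Lemma lieC (x y : L) : lie x y = - lie y x.
Proof.
apply/eqP; rewrite -addr_eq0; apply/eqP.
have lieDl (u v w : L) : lie (u + v) w = lie u w + lie v w.
  by have /= := lie_linearl w 1 u v; rewrite !scale1r.
by have := liexx (x + y); rewrite lieDl !linearD /= !liexx add0r addr0.
Qed.

Lemma ad_mx_lie : lie_tensor ad_mx.
Proof.
split=> u v; first by rewrite !ad_mx_mul lieC linearN.
apply: mulmx_cV_inj => w; rewrite mulmxBl -!mulmxA !ad_mx_mul !cK -linearB; congr (c _).
set x := d u; set y := d v; set z := d w.
have := lie_jacobi x y z; rewrite (lieC z (lie x y)) (lieC z x) linearN /=.
by move/eqP; rewrite subr_eq0 => /eqP.
Qed.

(** The trace is defined through a chosen basis; the matrices P and Q change from it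
    to the coordinates [c]. *)
Lemma lftrace_end_mx (f : 'End(L)) : lftrace f = \tr (end_mx f).
Proof.
rewrite /lftrace; set e := vbasis _; set D := \dim _ in e *.
have eB : basis_of {:L} e by apply: vbasisP.
pose P := col_of_fun (fun v : 'cV_D => c (passmx.vecof e v^T)).
pose Q := col_of_fun (fun v : 'cV_n => (passmx.rVof e (d v))^T).
have PE v : P *m v = c (passmx.vecof e v^T).
  by rewrite col_of_funE // => a x y; rewrite linearP /= passmx.vecof_linear linearP.
have QE v : Q *m v = (passmx.rVof e (d v))^T.
  by rewrite col_of_funE // => a x y; rewrite linearP passmx.rVof_linear linearP.
have QP : Q *m P = 1%:M.
  by apply: mulmx_cV_inj => v; rewrite -mulmxA PE QE cK passmx.vecofK ?trmxK ?mul1mx.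
rewrite -[LHS]mxtrace_tr -[_^T in LHS]mulmx1 -QP mulmxA mxtrace_mulC mulmxA.
congr (\tr _); apply: mulmx_cV_inj => v.
rewrite -!mulmxA QE -trmx_mul PE trmxK -passmx.rVof_app // passmx.rVofK //.
by rewrite -{2}[v]dK end_mxE.
Qed.

Lemma killing_ad_mx x y : killing x y = \tr (ad_mx (c x) *m ad_mx (c y)).
Proof.
rewrite /killing lftrace_end_mx; congr (\tr _); apply: mulmx_cV_inj => v.
by rewrite -[v]dK [LHS]end_mxE /= comp_lfunE !adE -mulmxA !ad_mxE !cK.
Qed.

Lemma trace_form_killing u v : (u^T *m killing_mx ad_mx *m v) 0 0 = killing (d u) (d v).
Proof. by rewrite -trace_formE -{1}[u]dK -{1}[v]dK -killing_ad_mx. Qed.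

Lemma killing_lie (x y z : L) : killing (lie x y) z = - killing y (lie x z).
Proof.
have adlie u v : ad_mx (c (lie u v)) = brk (ad_mx (c u)) (ad_mx (c v)).
  by rewrite /brk -ad_mx_lie.2 ad_mxE cK.
rewrite !killing_ad_mx !adlie /brk mulmxBl mulmxBr !mxtraceB opprB -!mulmxA.
by congr (_ - _); rewrite mxtrace_mulC -mulmxA.
Qed.
End Coordinates.

Section SymmetricForms.
Variable R : rcfType.

(** Gram-Schmidt: the block matrix [u] splits off the first basis vector, and D' is
    the Schur complement. *)
Lemma orthonormal_basis n (Q : 'M[R]_n) : Q^T = Q ->
    (forall x : 'cV_n, x != 0 -> 0 < (x^T *m Q *m x) 0 0) ->
  exists P : 'M_n, P^T *m Q *m P = 1%:M.
Proof.
elim: n Q => [|n IHn] Q; first by exists 1%:M; apply/matrixP=> -[].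
suff step : forall A : 'M[R]_(1 + n), A^T = A ->
    (forall x : 'cV_(1 + n), x != 0 -> 0 < (x^T *m A *m x) 0 0) ->
    exists P : 'M_(1 + n), P^T *m A *m P = 1%:M by apply: step.
move=> A; rewrite -(submxK A).
move: (ulsubmx _) (ursubmx _) (dlsubmx _) (drsubmx _) => a b b' D.
rewrite tr_block_mx => As Qpos; have [_ _ bE Ds] := eq_block_mx As; subst b'.
set al := a 0 0; have aE : a = al%:M by apply: mx11_scalar.
pose u : 'M_(1 + n) := block_mx 1%:M (- al^-1 *: b) 0 1%:M.
pose D' := D - al^-1 *: (b^T *m b).
have al0 : 0 < al.
  have := Qpos (col_mx 1%:M 0).
  rewrite tr_col_mx trmx1 trmx0 mul_row_block !mul1mx !mul0mx !addr0 mul_row_col mulmx1 mulmx0 addr0.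
  apply; apply/negP => /eqP/(congr1 (@usubmx _ 1 n 1)); rewrite col_mxKu => /matrixP/(_ 0 0).
  by rewrite !mxE => /eqP; rewrite oner_eq0.
have uQ : u^T *m block_mx a b b^T D *m u = block_mx al%:M 0 0 D'.
  rewrite tr_block_mx !mulmx_block !trmx0 !trmx1.
  have -> : (- al^-1 *: b)^T = - al^-1 *: b^T by rewrite linearZ.
  rewrite !(mul1mx, mulmx1, mul0mx, mulmx0, addr0, add0r) aE mul_mx_scalar mul_scalar_mx.
  rewrite !scalerA mulrN divff ?gt_eqF // !scaleN1r !addNr.
  by rewrite mul0mx add0r -scalemxAl scaleNr addrC.
have congr_form k (y : 'M_(1 + n, k)) : let A := block_mx a b b^T D in
    (u *m y)^T *m A *m (u *m y) = y^T *m block_mx al%:M 0 0 D' *m y.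
  by rewrite /= -uQ trmx_mul !mulmxA.
have [||P PD] := IHn D'.
- by rewrite /D' linearB linearZ /= trmx_mul trmxK Ds.
- move=> x x0; have := Qpos (u *m col_mx 0 x).
  rewrite congr_form.
  rewrite tr_col_mx trmx0 mul_row_block mul_row_col !mul0mx !mulmx0 !add0r; apply.
  apply: contraNneq x0 => /(congr1 (@dsubmx _ 1 n 1)); rewrite mul_block_col !mul1mx mul0mx !add0r.
  by rewrite col_mxKd linear0 => ->.
exists (u *m block_mx (Num.sqrt al)^-1%:M 0 0 P).
rewrite congr_form.
rewrite tr_block_mx !mulmx_block !trmx0 !(mulmx0, mul0mx, addr0, add0r) PD tr_scalar_mx.
rewrite -!scalar_mxM (@scalar_mx_block _ 1 n); congr (block_mx _%:M _ _ _).
by rewrite mulrAC -expr2 exprVn sqr_sqrtr ?ltW // mulVf ?gt_eqF.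
Qed.

End SymmetricForms.

(** * Nondegeneracy of the Killing form *)

Lemma derived_series_stable (F : fieldType) (L : lieAlgType F) (I : {vspace L}) :
    (liev I I <= I)%VS ->
  exists k, let J := derived_series k I in (J <= I)%VS /\ liev J J = J.
Proof.
have [b] := ubnP (\dim I); elim: b I => // b IHb I dimI II.
have [eqI | neqI] := eqVneq (liev I I) I; first by exists 0%N.
have ltI : (\dim (liev I I) < \dim I)%N.
  rewrite ltnNge; apply: contraNN neqI => leI; by rewrite eqEdim II leI.
have [||k [JI Jst]] := IHb (liev I I).
- by rewrite -ltnS (leq_ltn_trans ltI).
- by apply/lievP => u v /(subvP II) uI /(subvP II) vI; apply: memv_lie.
exists k.+1; rewrite /derived_series iterSr; split=> //.
exact: subv_trans JI II.
Qed.

Section KillingRadical.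
Variables (R : rcfType) (L : lieAlgType R) (n : nat).
Variables (c : {linear L -> 'cV[R]_n}) (d : {linear 'cV[R]_n -> L}).
Hypotheses (cK : cancel c d) (dK : cancel d c).

(** By Cartan's criterion the adjoint action of [P] on L is zero, and then P = [P, P]
    is zero. *)
Lemma perfect_isotropic_eq0 (P : {vspace L}) :
  liev P P = P -> {in P &, forall x y, killing x y = 0} -> P = 0%VS.
Proof.
move=> PP Pkill.
have [n0|] := posnP n.
  apply/eqP; rewrite -subv0; apply/subvP => x _; rewrite -[x]cK.
  suff -> : c x = 0 by rewrite linear0 mem0v.
  by apply/matrixP => i; have := ltn_ord i; rewrite {2}n0.
case: n c d cK dK => // n' c' d' c'K d'K _.
pose f := linfun (ad_mx c' d' \o c').
have fE x : f x = ad_mx c' d' (c' x) by rewrite lfunE.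
have fbrk x y : commv (f x) (f y) = f (lie x y).
  by rewrite !fE /commv -[LHS](ad_mx_lie c'K d'K).2 ad_mxE // c'K.
have fP0 : (f @: P)%VS = 0%VS.
  apply: cartan_criterion.
  - move=> _ _ /memv_imgP[x xP ->] /memv_imgP[y yP ->].
    by rewrite fbrk memv_img // -PP memv_lie.
  - move=> _ _ /memv_imgP[x xP ->] /memv_imgP[y yP ->].
    by rewrite !fE -killing_ad_mx // Pkill.
  - move=> W UW; have : (liev P P <= f @^-1: W)%VS; last first.
      rewrite PP => /subvP PW; apply/subvP => _ /memv_imgP[x xP ->].
      by rewrite memv_preim PW.
    by apply/lievP => x y xP yP; rewrite -memv_preim -fbrk UW // memv_img.
rewrite -PP; apply/eqP; rewrite -subv0; apply/lievP => x y xP yP.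
have : f x = 0 by apply/eqP; rewrite -memv0 -fP0 memv_img.
rewrite fE => /(congr1 (fun A => A *m c' y)); rewrite ad_mxE // mul0mx c'K => cxy.
by rewrite memv0 -[lie x y]c'K cxy linear0.
Qed.

(** The derived series of the radical of the Killing form stops at a perfect
    isotropic subspace, which is zero; so the radical is a solvable ideal. *)
Theorem killing_nondegenerate : semisimple L -> killing_mx (ad_mx c d) \in unitmx.
Proof.
move=> Lss; set K := killing_mx _.
pose f := linfun (mulmxr K \o trmx \o c).
pose N := lker f.
have NP x : reflect (forall y, killing x y = 0) (x \in N).
  have fxE y : killing x y = (f x *m c y) 0 0 by rewrite lfunE /= trace_form_killing ?cK.
  rewrite memv_ker; apply: (iffP eqP) => [fx0 y | x0]; first by rewrite fxE fx0 mul0mx mxE.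
  apply/rowP => i; rewrite mxE -(x0 (d (ebase i))) fxE dK.
  by rewrite mulmx_ebase mxE.
have N0 : N = 0%VS.
  apply: Lss; have Nideal : lie_ideal N.
    by move=> x y /NP yN; apply/NP => z; rewrite (killing_lie cK dK) yN oppr0.
  split=> //; have [|k [JN Jst]] := @derived_series_stable _ _ N.
    by apply/lievP => x y _ /Nideal.
  exists k; apply: perfect_isotropic_eq0 => // x y /(subvP JN)/NP xN _; exact: xN.
rewrite -row_free_unit -kermx_eq0; apply/rowV0P => u /sub_kermxP uK.
have : d u^T \in N by rewrite memv_ker lfunE /= dK trmxK uK.
rewrite N0 memv0 => /eqP/(congr1 c); rewrite dK linear0 => /(congr1 trmx).
by rewrite trmxK trmx0.
Qed.

End KillingRadical.

Import numFieldNormedType.Exports.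
Local Open Scope classical_set_scope.
Local Open Scope ring_scope.

(** * Compactness *)

Section ContinuousEntries.
Variables (R : realType) (T : topologicalType).

Lemma continuous_sumr (I : Type) (r : seq I) (f : I -> T -> R) :
  (forall i, continuous (f i)) -> continuous (fun t => \sum_(i <- r) f i t).
Proof.
move=> fc; elim: r => [|i r IH] x.
  under eq_fun do rewrite big_nil; exact: cvg_cst.
by under eq_fun do rewrite big_cons; apply: cvgD; [apply: fc | apply: IH].
Qed.

(** Continuity of matrix-valued maps is only used through the entries, which makes
    polynomial expressions easy to treat. *)
Definition mx_continuous p q (A : T -> 'M[R]_(p, q)) : Prop :=
  forall i j, continuous (fun t => A t i j : R).

Lemma mx_continuous_cst p q (A : 'M[R]_(p, q)) : mx_continuous (fun=> A).
Proof. by move=> i j; apply: cst_continuous. Qed.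

Lemma mx_continuousD p q (A B : T -> 'M[R]_(p, q)) :
  mx_continuous A -> mx_continuous B -> mx_continuous (fun t => A t + B t).
Proof.
by move=> Ac Bc i j x; under eq_fun do rewrite mxE; apply: cvgD; [apply: Ac|apply: Bc].
Qed.

Lemma mx_continuousN p q (A : T -> 'M[R]_(p, q)) : mx_continuous A -> mx_continuous (fun t => - A t).
Proof. by move=> Ac i j x; under eq_fun do rewrite mxE; apply: cvgN; apply: Ac. Qed.

Lemma mx_continuousM p q r (A : T -> 'M[R]_(p, q)) (B : T -> 'M[R]_(q, r)) :
  mx_continuous A -> mx_continuous B -> mx_continuous (fun t => A t *m B t).
Proof.
move=> Ac Bc i j; under eq_fun do rewrite mxE.
by apply: continuous_sumr => k x; apply: cvgM; [apply: Ac|apply: Bc].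
Qed.

Lemma mx_continuous_sub p q p' q' (A : T -> 'M[R]_(p, q)) (B : T -> 'M[R]_(p', q'))
   (s : 'I_p' -> 'I_q' -> 'I_p * 'I_q) :
  mx_continuous A -> (forall t i j, B t i j = A t (s i j).1 (s i j).2) -> mx_continuous B.
Proof.
by move=> Ac AB i j; under eq_fun do rewrite AB; apply: Ac.
Qed.

Lemma mx_continuous_tr p q (A : T -> 'M[R]_(p, q)) : mx_continuous A -> mx_continuous (fun t => (A t)^T).
Proof. by move=> Ac; apply: (mx_continuous_sub (s := fun i j => (j, i)) Ac) => t i j; rewrite mxE. Qed.

Lemma mx_continuous_vec_mx p q (A : T -> 'rV[R]_(p * q)) :
  mx_continuous A -> mx_continuous (fun t => vec_mx (A t)).
Proof.
by move=> Ac; apply: (mx_continuous_sub (s := fun i j => (ord0, mxvec_index i j)) Ac) => t i j; rewrite mxE.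
Qed.

Lemma mx_continuous_opm n k (A : T -> 'M[R]_(k, n * n)) (v : T -> 'cV[R]_k) :
  mx_continuous A -> mx_continuous v -> mx_continuous (fun t => opm (A t) (v t)).
Proof. by move=> Ac vc; apply/mx_continuous_vec_mx/mx_continuousM => //; apply: mx_continuous_tr. Qed.

Lemma mx_continuous_tW n m (A : T -> tensor R n m) v :
  mx_continuous A -> mx_continuous v -> mx_continuous (fun t => tW (A t) (v t)).
Proof.
move=> Ac vc; apply: mx_continuous_opm => //.
by apply: (mx_continuous_sub (s := fun i j => (lshift m i, j)) Ac) => t i j; rewrite mxE.
Qed.

Lemma mx_continuous_tR n m (A : T -> tensor R n m) v :
  mx_continuous A -> mx_continuous v -> mx_continuous (fun t => tR (A t) (v t)).
Proof.
move=> Ac vc; apply: mx_continuous_opm => //.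
by apply: (mx_continuous_sub (s := fun i j => (rshift n i, j)) Ac) => t i j; rewrite mxE.
Qed.

Lemma continuous_nrm p q (A : T -> 'M[R]_(p, q)) : mx_continuous A -> continuous (fun t => nrm (A t)).
Proof.
move=> Ac; apply: continuous_sumr => i; apply: continuous_sumr => j x.
by apply: cvg_norm; apply: Ac.
Qed.

Lemma continuous_mxtrace n (A : T -> 'M[R]_n) : mx_continuous A -> continuous (fun t => \tr (A t)).
Proof. by move=> Ac; apply: continuous_sumr => i; apply: Ac. Qed.

Lemma continuous_prodr (I : Type) (r : seq I) (f : I -> T -> R) :
  (forall i, continuous (f i)) -> continuous (fun t => \prod_(i <- r) f i t).
Proof.
move=> fc; elim: r => [|i r IH] x.
  under eq_fun do rewrite big_nil; exact: cvg_cst.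
by under eq_fun do rewrite big_cons; apply: cvgM; [apply: fc | apply: IH].
Qed.

Lemma continuous_det n (A : T -> 'M[R]_n) : mx_continuous A -> continuous (fun t => \det (A t)).
Proof.
move=> Ac; apply: continuous_sumr => s x; apply: cvgM; first exact: cvg_cst.
by apply: continuous_prodr => i; apply: Ac.
Qed.

End ContinuousEntries.

Section Compactness.
Variables (R : realType) (N : nat).
Implicit Types r : 'rV[R]_N.

Lemma mx_continuous_id p q : mx_continuous (fun A : 'M[R]_(p, q) => A).
Proof. by move=> i j; apply: coord_continuous. Qed.

Lemma nrm_bounded (A : set 'rV[R]_N) M : (forall r, A r -> nrm r <= M) -> bounded_set A.
Proof.
move=> AM; exists M; split; first exact: num_real.
move=> M' MM' r Ar /=; rewrite -[leLHS]/(mx_norm r) mx_normrE; apply/bigmax_leP; split.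
  by rewrite (le_trans _ (ltW MM')) // (le_trans (nrm_ge0 r)) // AM.
by move=> ij _; rewrite (le_trans (entry_le_nrm _ _ _)) // (le_trans (AM _ Ar)) // ltW.
Qed.

Lemma sublevel_min (f g : 'rV[R]_N -> R) (c M : R) r0 :
    continuous f -> continuous g -> g r0 <= c -> (forall r, g r <= c -> nrm r <= M) ->
  exists2 r, g r <= c & forall s, g s <= c -> f r <= f s.
Proof.
move=> fc gc gr0 bnd; pose A : set 'rV[R]_N := [set r | g r <= c].
have Ac : compact A.
  apply: bounded_closed_compact; first exact: (@nrm_bounded _ M).
  apply: (@closed_comp _ _ g [set x | x <= c]); last exact: closed_le.
  by move=> x _; apply: gc.
have [|r rA rmin] := @compact_EVT_min _ R f A (ex_intro _ r0 gr0) Ac.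
  exact: continuous_subspaceT.
exists r; first by rewrite inE in rA.
by move=> s gs; apply: rmin; rewrite inE.
Qed.

(** That p lies in the closure of [O] is recorded by two consequences: continuous
    equations that hold on [O] hold at p, and [O] comes arbitrarily close to p.  The
    closed part of the closure below the norm of one point is compact. *)
Lemma closure_min (O : set 'rV[R]_N) o0 : O o0 -> exists p,
  [/\ forall f : 'rV[R]_N -> R, continuous f -> (forall t, O t -> f t = 0) -> f p = 0,
      forall e, 0 < e -> exists2 t, O t & nrm (t - p) < e &
      forall t, O t -> \tr (p *m p^T) <= \tr (t *m t^T)].
Proof.
move=> Oo0; pose f r := \tr (r *m r^T).
have fc : continuous f.
  by apply: continuous_mxtrace; apply: mx_continuousM; [|apply: mx_continuous_tr]; apply: mx_continuous_id.
pose A : set 'rV[R]_N := closure O `&` [set r | f r <= f o0].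
have Acl : closed A.
  apply: closedI; first exact: closed_closure.
  by apply: (@closed_comp _ _ f [set x | x <= f o0]); [move=> x _; apply: fc | apply: closed_le].
have ent r i : `|r 0 i| <= 1 + f r.
  have : `|r 0 i| ^+ 2 <= f r.
    rewrite real_normK ?num_real // /f /mxtrace big_ord1 mxE (bigD1 i) //= mxE -expr2 lerDl.
    by apply: sumr_ge0 => j _; rewrite mxE -expr2 sqr_ge0.
  by have := normr_ge0 (r 0 i); nra.
have Ac : compact A.
  apply: bounded_closed_compact Acl; apply: (@nrm_bounded _ (\sum_(i < N) (1 + f o0))).
  move=> r [_ fr]; rewrite /nrm big_ord1; apply: ler_sum => i _.
  by rewrite (le_trans (ent _ _)) // lerD2l.
have A0 : A o0 by split; [apply: subset_closure | rewrite /= lexx].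
have [|p pA pmin] := @compact_EVT_min _ R f A (ex_intro _ o0 A0) Ac.
  exact: continuous_subspaceT.
have [clp fp] : A p by rewrite inE in pA.
exists p; split.
- move=> h hc hO; have cl0 : closed (h @^-1` [set 0]).
    by apply: closed_comp => [x _|]; [apply: hc | apply: closed_eq].
  have : closure (h @^-1` [set 0]) p by apply: closure_subset clp => t Ot; apply: hO.
  by rewrite -((closure_id _).1 cl0).
- move=> e e0; have hc : continuous (fun r => nrm (r - p)).
    by apply: continuous_nrm; apply: mx_continuousD; [apply: mx_continuous_id | apply: mx_continuous_cst].
  have : nbhs p [set r | nrm (r - p) < e].
    apply: (hc p [set x | x < e]); rewrite /= subrr nrm0.
    exact: lt_nbhsl.
  by move=> /clp[t [Ot te]]; exists t.
- move=> t Ot; have [ft|ft] := leP (f t) (f o0); last first.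
    by apply: le_trans fp _; apply: ltW.
  by apply: pmin; rewrite inE; split; [apply: subset_closure|].
Qed.

End Compactness.

(** * Rigidity *)

Lemma mx_continuous_mxvec (R : realType) (T : topologicalType) p q (A : T -> 'M[R]_(p, q)) :
  mx_continuous A -> mx_continuous (fun t => mxvec (A t)).
Proof.
move=> Ac i j; rewrite ord1; case/mxvec_indexP: j => k l.
by under eq_fun do rewrite mxvecE; apply: Ac.
Qed.

Lemma mx_continuous_mk (R : realType) (T : topologicalType) n m
    (fW : T -> 'cV[R]_n -> 'M[R]_n) (fR : T -> 'cV[R]_m -> 'M[R]_n) :
    (forall i, mx_continuous (fun t => fW t (ebase i))) ->
    (forall i, mx_continuous (fun t => fR t (ebase i))) ->
  mx_continuous (fun t => mk_tensor (fW t) (fR t) : 'M[R]_(_, _)).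
Proof.
move=> Wc Rc i j; rewrite /mk_tensor; case: (fintype.splitP i) => k ik.
  have -> : i = lshift m k by apply: val_inj.
  by under eq_fun do rewrite col_mxEu mxE; apply: mx_continuous_mxvec.
have -> : i = rshift n k by apply: val_inj.
by under eq_fun do rewrite col_mxEd mxE; apply: mx_continuous_mxvec.
Qed.

Lemma continuous_add_scale (R : realType) (T : topologicalType) (f g : T -> R) c :
  continuous f -> continuous g -> continuous (fun t => f t + c * g t).
Proof.
move=> fc gc x; apply: cvgD; [exact: fc | apply: cvgM; [exact: cvg_cst | exact: gc]].
Qed.

Lemma continuous_sub_cst (R : realType) (T : topologicalType) (f : T -> R) c :
  continuous f -> continuous (fun t => f t - c).
Proof. by move=> fc x; apply: cvgD; [exact: fc | exact: cvg_cst]. Qed.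

Section Rigidity.
Variables (R : realType) (n m : nat).
Variable Wh : {linear 'cV[R]_m -> 'M[R]_m}.
Variable p : tensor R n m.
Hypotheses (Whl : lie_tensor Wh) (Whn : killing_mx Wh \in unitmx).
Hypotheses (pg : lie_pair Wh p) (pn : killing_mx (tW p) \in unitmx).

Lemma defect1 t : defect p t 1%:M = t - p.
Proof.
apply: tensor_ext => v; rewrite ?defectW ?defectR !mul1mx !mulmx1.
  by apply/eqP; rewrite subr_eq -tWD subrK.
by apply/eqP; rewrite subr_eq -tRD subrK.
Qed.

(** Instead of iterating the Newton step, the function f(a) = |defect a| + e |a - 1| is
    minimised over the ball |a - 1| <= 1/2.  If the defect d at the minimum were not
    zero, the step of [improvement] would move a by at most k d, hence raise the
    second term by at most e k d = d / 4, while decreasing the first from d to at most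
    d / 4.  The closeness of t to p makes d small and places the minimum in the ball
    of radius 1/4, so that the step stays in the ball of radius 1/2. *)
Theorem rigidity : exists2 eta, 0 < eta & forall t, lie_pair Wh t -> nrm (t - p) < eta ->
  exists2 a, a \in unitmx & intertwines p t a.
Proof.
have [C C0 CP] := improvement Whl Whn pg pn.
pose N : R := n%:R + 1; have n0 : (0 : R) <= n%:R by apply: ler0n.
have N0 : 0 < N by rewrite /N; lra.
pose k := C * N; have k0 : 0 < k by apply: mulr_gt0.
pose S := 1 + 4 * C + 16 * k; have S0 : 0 < S by rewrite /S; lra.
exists S^-1; first by rewrite invr_gt0.
move=> t tg tp.
have {}tp : nrm (t - p) * S < 1 by rewrite -ltr_pdivlMr // mul1r.
have [e e0 ek] : exists2 e, 0 < e & e * (4 * k) = 1.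
  by exists (4 * k)^-1; rewrite ?invr_gt0 ?mulVf ?gt_eqF // mulr_gt0.
pose g (r : 'rV[R]_(n * n)) := nrm (vec_mx r - 1%:M : 'M[R]_n).
pose f (r : 'rV[R]_(n * n)) := nrm (defect p t (vec_mx r)) + e * g r.
have vc : mx_continuous (fun r : 'rV[R]_(n * n) => vec_mx r : 'M[R]_n).
  by apply: mx_continuous_vec_mx; apply: mx_continuous_id.
have gc : continuous g.
  by apply: continuous_nrm; apply: mx_continuousD => //; apply: mx_continuous_cst.
have fc : continuous f.
  apply: continuous_add_scale gc.
  apply: (continuous_nrm (A := fun r : 'rV[R]_(n * n) => defect p t (vec_mx r))).
  apply: mx_continuous_mk => i; apply: mx_continuousD.
  - by apply: mx_continuousM => //; apply: mx_continuous_cst.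
  - apply: mx_continuousN; apply: mx_continuousM => //.
    by apply: mx_continuous_tW; [apply: mx_continuous_cst |
      apply: mx_continuousM => //; apply: mx_continuous_cst].
  - by apply: mx_continuousM => //; apply: mx_continuous_cst.
  - by apply: mx_continuousN; apply: mx_continuousM => //; apply: mx_continuous_cst.
have bnd r : g r <= 1 / 2 -> nrm r <= N.
  move=> gr; rewrite -nrm_vec_mx -[vec_mx r](subrK 1%:M) (le_trans (nrmD _ _)) // nrm_1.
  by move: gr; rewrite /g /N; lra.
have g1 : g (mxvec 1%:M) <= 1 / 2 by rewrite /g mxvecK subrr nrm0; lra.
have [r gr rmin] := sublevel_min fc gc g1 bnd.
set a := vec_mx r : 'M[R]_n; have [au _] := near1_unitmx gr.
exists a => //; apply: defect_eq0; apply: nrm_eq0.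
set d := nrm (defect p t a); have dge0 : 0 <= d by apply: nrm_ge0.
have fr1 : f r <= nrm (t - p).
  rewrite (le_trans (rmin (mxvec 1%:M) g1)) // /f /g mxvecK defect1.
  by rewrite [1%:M - _]subrr nrm0 mulr0 addr0.
have gr0 : 0 <= g r by apply: nrm_ge0.
have egr0 : 0 <= e * g r by rewrite mulr_ge0 // ltW.
have dS : d * S < 1.
  apply: le_lt_trans tp; rewrite ler_wpM2r // ?(ltW S0) // (le_trans _ fr1) //.
  by rewrite /f lerDl.
have gS : e * g r * S < 1.
  apply: le_lt_trans tp; rewrite ler_wpM2r // ?(ltW S0) // (le_trans _ fr1) //.
  by rewrite /f lerDr nrm_ge0.
have dC0 : 0 <= d * C by rewrite mulr_ge0 // ltW.
have dk0 : 0 <= d * k by rewrite mulr_ge0 // ltW.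
have d1 : d <= 1 by move: dS; rewrite /S; lra.
have dC : 4 * (d * C) < 1 by move: dS; rewrite /S; lra.
have dk : 16 * (d * k) < 1 by move: dS; rewrite /S; lra.
have [b [bC dC']] := CP t a tg gr d1; rewrite -/d in bC dC'.
have na : nrm a <= N by rewrite nrm_vec_mx bnd.
have nba : nrm (b *m a) <= k * d.
  rewrite (le_trans (nrm_mul _ _)) // /k mulrAC ler_pM ?nrm_ge0 //.
set a' := (1%:M + b) *m a in dC'.
have ga' : g (mxvec a') <= g r + k * d.
  rewrite /g mxvecK /a' mulmxDl mul1mx addrAC (le_trans (nrmD _ _)) //.
  by rewrite lerD2l.
have gr4 : g r <= 1 / 4.
  have : e * g r * (16 * k) < 1.
    apply: le_lt_trans gS; rewrite ler_wpM2l // /S; lra.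
  have -> : e * g r * (16 * k) = 4 * (e * (4 * k)) * g r by ring.
  by rewrite ek; lra.
have ga'2 : g (mxvec a') <= 1 / 2.
  by apply: (le_trans ga'); move: dk gr4; rewrite [k * d]mulrC; lra.
have := rmin _ ga'2; rewrite /f mxvecK -/a -/d.
have : e * g (mxvec a') <= e * g r + e * (k * d) by rewrite -mulrDr ler_wpM2l // ltW.
have -> : e * (k * d) = d / 4.
  have -> : e * (k * d) = e * (4 * k) * (d / 4); first by field.
  by rewrite ek mul1r.
have : C * d * d <= d / 4.
  have -> : C * d * d = d * C * d by ring.
  by have := dge0; move: dC; move: (d * C) => y; nra.
move: dC' => *; apply/eqP; rewrite eq_le dge0 andbT; lra.
Qed.

End Rigidity.

(** * The norm-minimal point of an orbit closure *)

Section Intertwiners.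
Variables (R : rcfType) (n m : nat).
Implicit Types t p s : tensor R n m.

Lemma intertwines1 t : intertwines t t 1%:M.
Proof. by split=> v; rewrite !mul1mx mulmx1. Qed.

Lemma intertwines_comp t s p a b :
  intertwines s t a -> intertwines p s b -> intertwines p t (b *m a).
Proof.
move=> [aW aR] [bW bR]; split=> v.
  by rewrite -mulmxA aW mulmxA bW -!mulmxA.
by rewrite -mulmxA aR mulmxA bR -!mulmxA.
Qed.

(** Changes of basis of determinant +-1 thus preserve the determinant of the Killing
    form, which keeps the Killing form nondegenerate in the closure of the orbit. *)
Lemma killing_intertwines p t a : a \in unitmx -> intertwines p t a ->
  killing_mx (tW t) = a^T *m killing_mx (tW p) *m a.
Proof.
move=> au [aW _]; apply: bilin_form_inj => u v; rewrite !mulmxA -trmx_mul -[_ *m a *m v]mulmxA.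
rewrite -!trace_formE /=.
have tE w : tW t w = invmx a *m tW p (a *m w) *m a by rewrite -mulmxA -aW mulKmx.
rewrite !tE -!mulmxA mulKVmx // mxtrace_mulC -!mulmxA mulmxV // mulmx1.
by [].
Qed.

End Intertwiners.

Lemma mxtrace_mxvec (R : comPzRingType) p q (A B : 'M[R]_(p, q)) :
  \tr (mxvec A *m (mxvec B)^T) = \tr (A *m B^T).
Proof.
transitivity (\sum_i \sum_j A i j * B i j); last first.
  by apply: eq_bigr => i _; rewrite mxE; apply: eq_bigr => j _; rewrite mxE.
rewrite /mxtrace big_ord1 mxE (reindex _ (curry_mxvec_bij _ _)) /= pair_bigA /=.
by apply: eq_bigr => -[i j] _; rewrite mxE !mxvecE.
Qed.

Section MinimalVector.
Variables (R : realType) (n m : nat).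
Variable Wh : {linear 'cV[R]_m -> 'M[R]_m}.
Hypotheses (Whl : lie_tensor Wh) (Whn : killing_mx Wh \in unitmx).
Variable t0 : tensor R n m.
Hypotheses (t0g : lie_pair Wh t0) (t0n : killing_mx (tW t0) \in unitmx).

Lemma detsq_unit (a : 'M[R]_n) : \det a ^+ 2 = 1 -> a \in unitmx.
Proof.
move=> a1; rewrite unitmxE unitfE; apply: contra_eq_neq a1 => ->.
by rewrite expr0n /= eq_sym oner_eq0.
Qed.

Lemma lie_pair_closed (O : set 'rV[R]_((n + m) * (n * n))) p :
    (forall f : 'rV[R]_((n + m) * (n * n)) -> R, continuous f -> (forall t, O t -> f t = 0) -> f p = 0) ->
    (forall r, O r -> lie_pair Wh (vec_mx r) /\
       \det (killing_mx (tW (vec_mx r : tensor R n m))) = \det (killing_mx (tW t0))) ->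
  lie_pair Wh (vec_mx p) /\ \det (killing_mx (tW (vec_mx p : tensor R n m))) = \det (killing_mx (tW t0)).
Proof.
move=> pO OP.
have vc : mx_continuous (fun r : 'rV[R]_((n + m) * (n * n)) => vec_mx r : tensor R n m).
  by apply: mx_continuous_vec_mx; apply: mx_continuous_id.
have cc k l (A : 'M[R]_(k, l)) :
  mx_continuous (fun r : 'rV[R]_((n + m) * (n * n)) => A) by apply: mx_continuous_cst.
have mx0 k l (A : 'rV[R]_((n + m) * (n * n)) -> 'M[R]_(k, l)) : mx_continuous A ->
    (forall r, O r -> A r = 0) -> A p = 0.
  move=> Ac A0; apply/matrixP => i j; rewrite mxE.
  by apply: (pO _ (Ac i j)) => r /A0 ->; rewrite mxE.
split; first split; first split.
- move=> u v; apply/eqP; rewrite -addr_eq0; apply/eqP; move: u v => u v.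
  apply: (mx0 _ _ (fun r => tW (vec_mx r : tensor R n m) u *m v + tW (vec_mx r : tensor R n m) v *m u)).
    by apply: mx_continuousD; apply: mx_continuousM => //; apply: mx_continuous_tW.
  by move=> r /OP[[[ta _] _ _] _]; rewrite ta addNr.
- move=> u v; apply/eqP; rewrite -subr_eq0; apply/eqP.
  apply: (mx0 _ _ (fun r => tW (vec_mx r : tensor R n m) (tW (vec_mx r : tensor R n m) u *m v)
     - (tW (vec_mx r : tensor R n m) u *m tW (vec_mx r : tensor R n m) v
       - tW (vec_mx r : tensor R n m) v *m tW (vec_mx r : tensor R n m) u))).
    apply: mx_continuousD; first by apply: mx_continuous_tW => //;
      apply: mx_continuousM => //; apply: mx_continuous_tW.
    by apply: mx_continuousN; apply: mx_continuousD; [|apply: mx_continuousN];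
      apply: mx_continuousM; apply: mx_continuous_tW.
  by move=> r /OP[[[_ tb] _ _] _]; rewrite tb subrr.
- move=> u v; apply/eqP; rewrite -subr_eq0; apply/eqP.
  apply: (mx0 _ _ (fun r => tW (vec_mx r : tensor R n m) (tR (vec_mx r : tensor R n m) u *m v)
     - (tR (vec_mx r : tensor R n m) u *m tW (vec_mx r : tensor R n m) v
       - tW (vec_mx r : tensor R n m) v *m tR (vec_mx r : tensor R n m) u))).
    apply: mx_continuousD; first by apply: mx_continuous_tW => //;
      apply: mx_continuousM => //; apply: mx_continuous_tR.
    by apply: mx_continuousN; apply: mx_continuousD; [|apply: mx_continuousN];
      apply: mx_continuousM; (apply: mx_continuous_tW || apply: mx_continuous_tR).
  by move=> r /OP[[_ tb _] _]; rewrite tb subrr.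
- move=> u v; apply/eqP; rewrite -subr_eq0; apply/eqP.
  apply: (mx0 _ _ (fun r => tR (vec_mx r : tensor R n m) (Wh u *m v)
     - (tR (vec_mx r : tensor R n m) u *m tR (vec_mx r : tensor R n m) v
       - tR (vec_mx r : tensor R n m) v *m tR (vec_mx r : tensor R n m) u))).
    apply: mx_continuousD; first by apply: mx_continuous_tR.
    by apply: mx_continuousN; apply: mx_continuousD; [|apply: mx_continuousN];
      apply: mx_continuousM; apply: mx_continuous_tR.
  by move=> r /OP[[_ _ tb] _]; rewrite tb subrr.
have kc : mx_continuous (fun r : 'rV[R]_((n + m) * (n * n)) =>
    killing_mx (tW (vec_mx r : tensor R n m))).
  move=> i j; under eq_fun do rewrite mxE.
  by apply: continuous_mxtrace; apply: mx_continuousM; apply: mx_continuous_tW.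
apply/eqP; rewrite -subr_eq0; apply/eqP.
apply: (pO (fun r => \det (killing_mx (tW (vec_mx r : tensor R n m))) - \det (killing_mx (tW t0)))).
  by apply: continuous_sub_cst; apply: continuous_det.
by move=> r /OP[_ ->]; rewrite subrr.
Qed.

(** The orbit consists of the conjugates of t0 by matrices with det^2 = 1.  Rigidity at
    the point p of least norm in its closure conjugates p to an orbit point by some b;
    comparing the determinants of the Killing forms, which [lie_pair_closed] shows to
    be equal, b has det^2 = 1 as well, so the conjugates of p considered in the last
    clause are points of the orbit. *)
Theorem minimal_vector : exists p a,
  [/\ a \in unitmx, intertwines p t0 a, lie_pair Wh p, killing_mx (tW p) \in unitmx &
      forall t b, \det b ^+ 2 = 1 -> intertwines t p b ->
        \tr (p *m p^T) <= \tr (t *m t^T)].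
Proof.
pose O : set 'rV[R]_((n + m) * (n * n)) :=
  [set r | exists2 a : 'M[R]_n, \det a ^+ 2 = 1 & intertwines (vec_mx r) t0 a].
have Ot0 : O (mxvec t0).
  by exists 1%:M; rewrite ?det1 ?expr1n // mxvecK; apply: intertwines1.
have [p' [pc pnear pmin]] := closure_min Ot0.
set p : tensor R n m := vec_mx p'.
have OP r : O r -> lie_pair Wh (vec_mx r) /\
    \det (killing_mx (tW (vec_mx r : tensor R n m))) = \det (killing_mx (tW t0)).
  move=> [a a1 ar]; have au := detsq_unit a1; split; first exact: lie_pair_conj au ar t0g.
  by rewrite (killing_intertwines au ar) !det_mulmx det_tr mulrAC -expr2 a1 mul1r.
have [pg pK] := lie_pair_closed pc OP.
have pn : killing_mx (tW p) \in unitmx by rewrite unitmxE pK -unitmxE.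
have [eta eta0 etaP] := rigidity Whl Whn pg pn.
have [r Or rp] := pnear _ eta0.
have [a a1 ar] := Or; have [rg rK] := OP _ Or.
have [|b bu bp] := etaP _ rg; first by rewrite -/p -linearB nrm_vec_mx.
have bap := intertwines_comp ar bp.
have bau : b *m a \in unitmx by rewrite unitmx_mul bu detsq_unit.
exists p, (b *m a); split=> // t c c1 cp.
have ba1 : \det (b *m a) ^+ 2 = 1.
  have := congr1 determinant (killing_intertwines bau bap).
  rewrite det_mulmx det_mulmx det_tr pK mulrAC -expr2 -[LHS]mul1r.
  by move: t0n; rewrite unitmxE unitfE => nz /(mulIf nz) ->.
have := pmin (mxvec t); rewrite -[p']vec_mxK !mxtrace_mxvec -/p.
apply; exists (c *m (b *m a)).
  by rewrite det_mulmx exprMn c1 ba1 mulr1.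
by rewrite mxvecK; apply: intertwines_comp bap cp.
Qed.

End MinimalVector.

Local Close Scope classical_set_scope.

(** * Cartan involutions in orthonormal coordinates *)

Import VectorInternalTheory.

Lemma column_coordinates (F : fieldType) (V : vectType F) :
  exists n (c : {linear V -> 'cV[F]_n}) (d : {linear 'cV[F]_n -> V}),
    cancel c d /\ cancel d c.
Proof.
pose c : {linear V -> 'cV[F]__} := trmx \o v2r.
pose d : {linear 'cV[F]_(dim V) -> V} := r2v \o trmx.
by exists (dim V), c, d; split=> x /=; rewrite ?trmxK ?v2rK // r2vK trmxK.
Qed.

Section CartanCoordinates.
Variables (R : realType) (L : lieAlgType R) (s : 'End(L)).
Hypothesis s_cartan : cartan_involution s.

Lemma cartan_coordinates n (c : {linear L -> 'cV[R]_n}) (d : {linear 'cV[R]_n -> L}) :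
    cancel c d -> cancel d c ->
  exists (c' : {linear L -> 'cV[R]_n}) (d' : {linear 'cV[R]_n -> L}),
    [/\ cancel c' d', cancel d' c' &
        forall x y, - killing (s x) y = ((c' x)^T *m c' y) 0 0].
Proof.
move=> cK dK; pose Q := - ((end_mx c d s)^T *m killing_mx (ad_mx c d)).
have QE u v : (u^T *m Q *m v) 0 0 = - killing (s (d u)) (d v).
  rewrite mulmxN mulNmx mxE mulmxA -trmx_mul trace_form_killing //.
  by rewrite -{1}[u]dK end_mxE // cK.
have [||P PQ] := @orthonormal_basis R n Q.
- apply: bilin_form_inj => u v.
  have -> : (u^T *m Q^T *m v) 0 0 = (v^T *m Q *m u) 0 0.
    transitivity ((v^T *m Q *m u)^T 0 0); last by rewrite mxE.
    by rewrite !trmx_mul trmxK mulmxA.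
  by rewrite !QE cartan_form_sym.
- move=> x x0; rewrite QE; case: s_cartan => _ _; apply.
  by apply: contraNneq x0 => dx; rewrite -[x]dK dx linear0.
have Pu : P \in unitmx by have [_] := mulmx1_unit PQ.
exists (mulmx (invmx P) \o c), (d \o mulmx P); split.
- by move=> x /=; rewrite mulKVmx // cK.
- by move=> v /=; rewrite dK mulKmx.
- move=> x y /=; rewrite -{1}[x]cK -{1}[y]cK -QE.
  rewrite -{1}[c x](mulKVmx Pu) -{1}[c y](mulKVmx Pu) trmx_mul !mulmxA.
  by rewrite -[_ *m Q *m P]mulmxA -[_ *m (Q *m P)]mulmxA [P^T *m _]mulmxA PQ mulmx1.
Qed.

Section Orthonormal.
Variables (n : nat) (c : {linear L -> 'cV[R]_n}) (d : {linear 'cV[R]_n -> L}).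
Hypotheses (cK : cancel c d) (dK : cancel d c).
Hypothesis cdot : forall x y, - killing (s x) y = ((c x)^T *m c y) 0 0.

Let S := end_mx c d s.
Let SE x : S *m c x = c (s x). Proof. exact: end_mxE. Qed.

Lemma involution_mx : S *m S = 1%:M.
Proof.
have [sK _ _] := s_cartan; apply: mulmx_cV_inj => v.
by rewrite -[v]dK -mulmxA !SE sK mul1mx.
Qed.

Lemma involution_mx_sym : S^T = S.
Proof.
have [sK _ _] := s_cartan; apply: bilin_form_inj => u v.
rewrite -trmx_mul -[_ *m S *m v]mulmxA -[u]dK -[v]dK !SE -!cdot.
by rewrite (cartan_form_sym _ (s (d v))) // sK sK killingC.
Qed.

Lemma involution_mx_aut (u v : 'cV[R]_n) : S *m (ad_mx c d u *m v) = ad_mx c d (S *m u) *m (S *m v).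
Proof.
have [_ sM _] := s_cartan.
by rewrite -[u]dK -[v]dK !SE !ad_mxE // SE !cK sM.
Qed.

(** K([w, u], v) = - K(u, [w, v]) reads, in terms of the scalar product
    - K(sigma x, y), that the adjoint of ad w is - ad (sigma w). *)
Lemma ad_mx_tr w : (ad_mx c d w)^T = - ad_mx c d (S *m w).
Proof.
have [sK sM _] := s_cartan; apply: bilin_form_inj => u v.
rewrite mulmxN mulNmx [RHS]mxE -trmx_mul -[_ *m _ *m v]mulmxA -[u]dK -[v]dK -[w]dK SE.
by rewrite !ad_mxE // !cK -!cdot sM (killing_lie cK dK) opprK.
Qed.

(** In orthonormal coordinates the Killing form is minus the matrix of the
    involution. *)
Lemma cartan_killing_unit : killing_mx (ad_mx c d) \in unitmx.
Proof.
have [sK _ _] := s_cartan.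
have -> : killing_mx (ad_mx c d) = - S.
  apply: bilin_form_inj => u v; rewrite trace_form_killing // mulmxN mulNmx mxE.
  rewrite -mulmxA -{2}[u]dK -{2}[v]dK SE -cdot opprK.
  apply: oppr_inj; rewrite [RHS](cartan_form_sym _ (s (d v))) // sK.
  by rewrite killingC.
have SS : (- S) *m (- S) = 1%:M by rewrite mulNmx mulmxN opprK involution_mx.
by have [] := mulmx1_unit SS.
Qed.

End Orthonormal.
End CartanCoordinates.

Theorem theorem1p3 (R : realType) (g : lieAlgType R) (h : lieSubalg g)
    (g_ss : semisimple g) (h_ss : semisimple (subvs_of h))
    (sigma' : 'End(subvs_of h)) (sigma'_cartan : cartan_involution sigma') :
  exists sigma : 'End(g),
    cartan_involution sigma /\
    forall x : subvs_of h, sigma (vsval x) = vsval (sigma' x).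
Proof.
have [n [c [d [cK dK]]]] := column_coordinates g.
have [m [ch0 [dh0 [ch0K dh0K]]]] := column_coordinates (subvs_of h).
have [ch [dh [chK dhK chdot]]] := cartan_coordinates sigma'_cartan ch0K dh0K.
pose W0 : {linear _ -> _} := ad_mx c d.
pose Wh : {linear _ -> _} := ad_mx ch dh.
pose R0 w := W0 (c (vsval (dh w))).
have W0l : islin W0 by lin.
have R0l : islin R0 by rewrite /R0; lin.
pose t0 := mk_tensor W0 R0.
have t0W v : tW t0 v = W0 v by rewrite tW_mk.
have t0R w : tR t0 w = R0 w by rewrite tR_mk.
have W0lie : lie_tensor W0 by apply: ad_mx_lie.
have Whlie : lie_tensor Wh by apply: ad_mx_lie.
have Whn : killing_mx Wh \in unitmx by exact: (cartan_killing_unit sigma'_cartan chK dhK chdot).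
have killingW0 : killing_mx (tW t0) = killing_mx W0.
  by apply/matrixP => i j; rewrite !mxE !t0W.
have t0n : killing_mx (tW t0) \in unitmx.
  by rewrite killingW0; exact: (killing_nondegenerate cK dK g_ss).
have t0g : lie_pair Wh t0.
  split.
  - by split=> u v; rewrite !t0W; [apply: W0lie.1 | apply: W0lie.2].
  - by move=> u v; rewrite !t0W !t0R; apply: W0lie.2.
  - move=> u v; rewrite !t0R /R0 -W0lie.2.
    rewrite [X in W0 X](_ : _ = W0 (c (vsval (dh u))) *m c (vsval (dh v))) //.
    by rewrite [RHS]ad_mxE // cK ad_mx_mul // chK vsval_lie.
have [p [a [au [aW aR] pg pn pmin]]] := minimal_vector Whlie Whn t0g t0n.
have [theta [thK thM thpos thR]] := cartan_of_critical Whlie Whn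
  (involution_mx_sym sigma'_cartan chK dhK chdot) (involution_mx sigma'_cartan chK dhK)
  (involution_mx_aut sigma'_cartan chK dhK) (ad_mx_tr sigma'_cartan chK dhK chdot) pg pn pmin.
(* a conjugates the bracket of g to that of p, so theta is transported back by a. *)
pose th0 := invmx a *m theta *m a.
have ath0 v : a *m (th0 *m v) = theta *m (a *m v) by rewrite !mulmxA mulmxV // mul1mx.
pose sigma := linfun (d \o mulmx th0 \o c).
have sigmaE x : c (sigma x) = th0 *m c x by rewrite lfunE [in LHS]/= dK.
have a_inj (u v : 'cV[R]_n) : a *m u = a *m v -> u = v.
  by move=> uv; rewrite -[u](mulKmx au) uv mulKmx.
have c_inj x y : a *m c x = a *m c y -> x = y.
  by move=> /a_inj/(can_inj cK).
have aW0 u v : a *m (W0 u *m v) = tW p (a *m u) *m (a *m v).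
  by rewrite mulmxA -t0W aW mulmxA.
have clie x y : c (lie x y) = W0 (c x) *m c y by rewrite [RHS]ad_mxE ?cK.
exists sigma; split; first split.
- by move=> x; apply: c_inj; rewrite !sigmaE !ath0 thK.
- move=> x y; apply: c_inj.
  by rewrite sigmaE ath0 !clie !aW0 thM !sigmaE !ath0.
- move=> x x0; rewrite (killing_ad_mx cK dK) sigmaE.
  have W0p v : W0 v = invmx a *m tW p (a *m v) *m a by rewrite -mulmxA -aW mulKmx // t0W.
  have -> : \tr (ad_mx c d (th0 *m c x) *m ad_mx c d (c x))
      = \tr (tW p (theta *m (a *m c x)) *m tW p (a *m c x)).
    rewrite -ath0 -!/(W0 _) !W0p -!mulmxA mxtrace_mulC !mulmxA.
    by rewrite !mulmxK.
  apply: thpos; apply: contraNneq x0 => acx.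
  by apply/eqP/c_inj; rewrite linear0 mulmx0.
- move=> x; apply: c_inj; rewrite sigmaE ath0.
  (* p represents h by inner derivations, as t0 does. *)
  have tRp y : tR p (ch y) = tW p (a *m c (vsval y)).
    apply: (can_inj (mulmxK au)).
    by rewrite -aR -aW t0R t0W /R0 chK.
  apply: (tW_inj pn); rewrite -(thR _ _ (tRp x)) -tRp; congr tR.
  by rewrite end_mxE.
Qed.
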